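(* Let $X$ be a complex manifold, $A\colon X\to M(n,\mathbb C)$ a holomorphic map, and $x_o\in X$. The matrix $A$ is locally holomorphically Jordanizable at $x_o$ if and only if the following conditions are satisfied: (1) there exist a (connected) neighborhood $U$ of $x_o$ and a holomorphic map $J\colon U\to M(n,\mathbb C)$ such that $J(x)$ is a Jordan form of $A(x)$ for each $x\in U$; in particular, there exist (pairwise distinct) holomorphic functions $\lambda_1,\dots,\lambda_r\colon U\to\mathbb C$ such that $\sigma(A(x))=\{\lambda_1(x),\dots,\lambda_r(x)\}$ for each $x\in U$; (2) for each $i=1,\dots,r$ the limit of generalized eigenspaces $$\lim_{\substack{z\to x_o\\ z\notin \mathrm{coal}(A)}}\ker\,(A(z)-\lambda_i(z)\mathrm{Id})^n$$ exists in the gap topology of $\mathcal G_n$; (3) we have $$\mathbb C^n=\bigoplus_{i=1}^r\ \lim_{\substack{z\to x_o\\ z\notin \mathrm{coal}(A)}}\ker\,(A(z)-\lambda_i(z)\mathrm{Id})^n .$$ Moreover, conditions (2) and (3) are respectively equivalent to the following ones: (2bis) the function $x\mapsto \dim \mathcal K[(A-\lambda_i\mathrm{Id})^n;x]$ is continuous at $x_o$, for any $i=1,\dots,r$; (3bis) we have $\mathbb C^n=\bigoplus_{i=1}^r\mathcal K[(A-\lambda_i\mathrm{Id})^n;x_o]$.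
   Context: $M(n,\mathbb C)$ is the space of complex $n\times n$ matrices and $\sigma(\Phi)$ denotes the set of eigenvalues of $\Phi\in M(n,\mathbb C)$. $A$ is locally holomorphically Jordanizable at $x_o$ if there exist a neighborhood $U\subseteq X$ of $x_o$ and a holomorphic map $S\colon U\to GL(n,\mathbb C)$ such that $S(x)^{-1}A(x)S(x)$ is a matrix in Jordan canonical form for each $x\in U$. $\mathrm{coal}(A)$ is the set of coalescing points: those $x\in X$ such that every neighborhood of $x$ contains a point $y$ with $\mathrm{card}\,\sigma(A(y))>\mathrm{card}\,\sigma(A(x))$. $\mathcal G_n$ is the set of all complex vector subspaces of $\mathbb C^n$ with the gap metric $\Theta(L_1,L_2)=\|\Pi_1-\Pi_2\|$ (operator norm, $\Pi_i$ the orthogonal projection onto $L_i$ for the standard hermitian structure); equivalently, $\mathcal G_n=\coprod_{k=0}^nG(k,n)$ is the disjoint union of Grassmannians. For a holomorphic map $T\colon Y\to M(n,\mathbb C)$ on a complex manifold $Y$ and $x\in Y$, $\mathcal K[T;x]\subseteq\mathbb C^n$ denotes the space of values $f(x)$ at $x$ of germs at $x$ of holomorphic functions $f$ with values in $\mathbb C^n$ such that $Tf=0$ near $x$ (i.e. germs in the stalk at $x$ of the kernel sheaf of $T\colon \mathcal O_Y^{\oplus n}\to\mathcal O_Y^{\oplus n}$). *)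

(* Defs.v *)
From HB Require Import structures.
From mathcomp Require Import all_boot all_order all_algebra.
From mathcomp Require Import all_classical all_reals all_analysis.
From mathcomp Require Import finmap complex.

Set Implicit Arguments.
Unset Strict Implicit.
Unset Printing Implicit Defensive.

Import Order.TTheory GRing.Theory Num.Theory.
Import numFieldNormedType.Exports.

Local Open Scope classical_set_scope.
Local Open Scope ring_scope.

(* The field of complex numbers over R. The named constant, with its declared
   type, is what makes the normed-module structure of a [numFieldType] over
   itself available: [R[i]] alone does not carry it. *)
Definition Cplx (R : realType) : numClosedFieldType := R[i].

Section ComplexManifolds.
Variable R : realType.
Local Notation C := (Cplx R).

(* [chart_inv] is only meaningful on the image of [chart_dom]. *)
Record chart (X : topologicalType) := Chart {
  chart_dim : nat;
  chart_dom : set X;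
  chart_map : X -> 'rV[C]_chart_dim;
  chart_inv : 'rV[C]_chart_dim -> X;
  chart_dom_open : open chart_dom;
  chart_img_open : open (chart_map @` chart_dom);
  chart_mapK : forall x, chart_dom x -> chart_inv (chart_map x) = x;
  chart_map_continuous : {within chart_dom, continuous chart_map};
  chart_inv_continuous :
    {within chart_map @` chart_dom, continuous chart_inv}
}.

Arguments chart_map {X} c x.
Arguments chart_inv {X} c w.

(* The atlas need not be maximal. In [differentiable] the scalars are C, so it means complex (Frechet)
   differentiability; on an open set this is holomorphy. The dimension may
   vary between connected components. No countability axiom is imposed. *)
Record complexManifold := ComplexManifold {
  manifold_carrier :> topologicalType;
  manifold_hausdorff : hausdorff_space manifold_carrier;
  atlas : set (chart manifold_carrier);
  atlas_cover : forall x, exists2 c, atlas c & chart_dom c x;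
  atlas_compatible : forall c c', atlas c -> atlas c' ->
    forall w, (chart_map c @` (chart_dom c `&` chart_dom c')) w ->
      differentiable (chart_map c' \o chart_inv c) w
}.

Variable X : complexManifold.

(* f is holomorphic in a neighborhood of x. *)
Definition holomorphic_at (f : X -> C) (x : X) :=
  forall c : chart X, atlas c -> chart_dom c x ->
    \forall w \near chart_map c x, differentiable (f \o chart_inv c) w.

Definition holomorphic_mx_at p q (F : X -> 'M[C]_(p, q)) (x : X) :=
  forall i j, holomorphic_at (fun y => F y i j) x.

(* Maps on an open U are total maps X -> _ considered on U only. *)
Definition holomorphic (U : set X) (f : X -> C) :=
  forall x, U x -> holomorphic_at f x.

Definition holomorphic_mx p q (U : set X) (F : X -> 'M[C]_(p, q)) :=
  forall x, U x -> holomorphic_mx_at F x.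

End ComplexManifolds.

Arguments chart_map {R X} c x.
Arguments chart_inv {R X} c w.

Section JordanForms.
Variable R : realType.
Local Notation C := (Cplx R).

Definition jordan_block k (a : C) : 'M[C]_k :=
  \matrix_(i, j) (if i == j then a else (i.+1 == j :> nat)%:R).

Definition jordan_canonical n (J : 'M[C]_n) :=
  exists (k : nat) (p : 'I_k -> nat) (a : 'I_k -> C)
         (e : (\sum_i p i)%N = n),
    (forall i, (0 < p i)%N) /\
    J = castmx (e, e) (\mxdiag_i jordan_block (p i) (a i)).

Definition jordan_form_of n (J M : 'M[C]_n) :=
  jordan_canonical J /\
  exists2 P : 'M[C]_n, P \in unitmx & J = invmx P *m M *m P.

(* [eigenvalue] speaks of row eigenvectors; the set of eigenvalues is the same
   as for column vectors, which are used everywhere else below. *)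
Definition spectrum n (M : 'M[C]_n) : set C := [set a | eigenvalue M a].

Definition card_spectrum n (M : 'M[C]_n) : nat := #|` fset_set (spectrum M)|%fset.

End JordanForms.

Section Grassmannian.
Variables (R : realType) (n : nat).
Local Notation C := (Cplx R).
Local Notation V := ('cV[C]_n).

Definition hermitian_norm (v : V) : R :=
  Num.sqrt (\sum_i complex.Re `|v i 0| ^+ 2).

Definition operator_norm (f : 'End(V)) : R :=
  sup [set hermitian_norm (f v) | v in [set v | hermitian_norm v <= 1]].

Definition orthogonal_complement (L : {vspace V}) : {vspace V} :=
  (\bigcap_(u <- vbasis L) lker (linfun (mulmx (map_mx Num.conj u^T))))%VS.

(* [daddv_pi L M] is the projection onto L along M. *)
Definition orthogonal_projection (L : {vspace V}) : 'End(V) :=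
  daddv_pi L (orthogonal_complement L).

Definition gap (L1 L2 : {vspace V}) : R :=
  operator_norm (orthogonal_projection L1 - orthogonal_projection L2).

(* [gap_cvg F L L0]: convergence of L to L0 along F for the gap metric on the set of all subspaces of C^n. *)
Definition gap_cvg (T : Type) (F : set_system T) (L : T -> {vspace V})
    (L0 : {vspace V}) :=
  gap (L z) L0 @[z --> F] --> (0 : R).

Definition kerv (M : 'M[C]_n) : {vspace V} := lker (linfun (mulmx M)).

Definition direct_sum_full r (L : 'I_r -> {vspace V}) :=
  (\sum_(i < r) L i)%VS = fullv /\ directv (\sum_(i < r) L i).

End Grassmannian.

Lemma vspace_of_set (K : fieldType) (V : vectType K) (S : set V) :
  S 0 -> (forall a u v, S u -> S v -> S (a *: u + v)) ->
  exists W : {vspace V}, forall v, v \in W <-> S v.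
Proof.
move=> S0 Slin.
pose P k := `[< exists W : {vspace V},
  \dim W = k /\ (forall v, v \in W -> S v) >].
have exP : exists k, P k.
  exists 0%N; apply/asboolP; exists 0%VS; split; first exact: dimv0.
  by move=> v; rewrite memv0 => /eqP ->.
have ubP k : P k -> (k <= \dim {:V})%N.
  by move=> /asboolP[W [<- _]]; apply: dimvS; apply: subvf.
case: (ex_maxnP exP ubP) => k /asboolP[W [dW WS]] kmax.
exists W => v; split; first exact: WS.
move=> Sv; apply: contrapT => /negP vW.
have : P (\dim (<[v]> + W)%VS).
  apply/asboolP; exists (<[v]> + W)%VS; split=> // w.
  case/memv_addP => _ /vlineP[a ->] [w' w'W ->].
  by apply: Slin => //; apply: WS.
move/kmax; apply/negP; rewrite -ltnNge -dW.
rewrite ltn_neqAle dimvS ?addvSr// andbT.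
apply: contra vW => /eqP dE.
have /eqP -> : W == (<[v]> + W)%VS by rewrite eqEdim addvSr dE leqnn.
by apply: (subvP (addvSl _ _)); apply: memv_line.
Qed.

Section KernelSheaf.
Variables (R : realType) (X : complexManifold R) (n : nat).
Local Notation C := (Cplx R).
Implicit Types (T : X -> 'M[C]_n) (x : X).

Definition kernel_germ_values T x : set 'cV[C]_n :=
  [set v | exists f : X -> 'cV[C]_n,
     [/\ holomorphic_mx_at f x, \forall y \near x, T y *m f y = 0 & f x = v]].

Lemma kernel_germ_values_vspace T x :
  exists W : {vspace 'cV[C]_n}, forall v, v \in W <-> kernel_germ_values T x v.
Proof.
apply: vspace_of_set => [|a _ _ [f [hf Tf <-]] [g [hg Tg <-]]].
  exists (fun=> 0); split=> //; last by near=> y; rewrite mulmx0.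
  move=> i j c ca cx; near=> w.
  have -> : (fun y : X => (0 : 'cV[C]_n) i j) \o chart_inv c = cst 0.
    by apply/funext => z /=; rewrite mxE.
  exact: differentiable_cst.
exists (fun y => a *: f y + g y); split=> //; last first.
  near=> y; rewrite mulmxDr -scalemxAr.
  have -> : T y *m f y = 0 by near: y.
  have -> : T y *m g y = 0 by near: y.
  by rewrite scaler0 addr0.
move=> i j c ca cx; near=> w.
have -> : (fun y => (a *: f y + g y) i j) \o chart_inv c =
    a *: ((fun y => f y i j) \o chart_inv c)
    + ((fun y => g y i j) \o chart_inv c).
  by apply/funext => z /=; rewrite !mxE.
apply: differentiableD.
  by apply: differentiableZ; near: w; exact: hf.
by near: w; exact: hg.
Unshelve. all: by end_near. Qed.

(* The subspace K[T; x] of C^n. *)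
Definition calK T x : {vspace 'cV[C]_n} :=
  projT1 (cid (kernel_germ_values_vspace T x)).

Lemma mem_calK T x v : v \in calK T x <-> kernel_germ_values T x v.
Proof. exact: (projT2 (cid (kernel_germ_values_vspace T x))). Qed.

End KernelSheaf.

Section Jordanizability.
Variables (R : realType) (X : complexManifold R) (n : nat).
Local Notation C := (Cplx R).
Implicit Types (A J S : X -> 'M[C]_n) (x : X) (U : set X).

Definition locally_holomorphically_jordanizable A x0 :=
  exists (U : set X) (S : X -> 'M[C]_n),
    [/\ open_nbhs x0 U, holomorphic_mx U S,
        forall x, U x -> S x \in unitmx
      & forall x, U x -> jordan_canonical (invmx (S x) *m A x *m S x)].

Definition coal A : set X :=
  [set x | forall W, nbhs x W ->
     exists2 y, W y & (card_spectrum (A x) < card_spectrum (A y))%N].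

Definition holomorphic_jordan_form A x0 U J :=
  [/\ open_nbhs x0 U, connected U, holomorphic_mx U J
    & forall x, U x -> jordan_form_of (J x) (A x)].

Definition holomorphic_eigenvalues A U r (lam : 'I_r -> X -> C) :=
  [/\ forall i, holomorphic U (lam i),
      forall i j, i != j -> exists2 x, U x & lam i x != lam j x
    & forall x, U x -> spectrum (A x) = [set lam i x | i in setT]].

Definition shifted_power A (l : X -> C) x : 'M[C]_n :=
  (A x - (l x)%:M) ^+ n.

(* The limit of ker (A(z) - l(z) Id)^n as z tends to x0 outside coal(A) is L.
   Only coalescing points are excluded: z = x0 is allowed when x0 is not one.
   Since x0 is adherent to the complement of coal(A), the filter is proper. *)
Definition generalized_eigenspace_limit A x0 (l : X -> C)
    (L : {vspace 'cV[C]_n}) :=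
  gap_cvg (within (~` coal A) (nbhs x0))
    (fun z => kerv (shifted_power A l z)) L.

Definition limits_exist A x0 r (lam : 'I_r -> X -> C) :=
  forall i, exists L, generalized_eigenspace_limit A x0 (lam i) L.

Definition limits_direct_sum A x0 r (lam : 'I_r -> X -> C) :=
  exists L : 'I_r -> {vspace 'cV[C]_n},
    (forall i, generalized_eigenspace_limit A x0 (lam i) (L i)) /\
    direct_sum_full L.

Definition calK_dim_continuous A x0 r (lam : 'I_r -> X -> C) :=
  forall i, {for x0, continuous
    (fun x => \dim (calK (shifted_power A (lam i)) x))}.

Definition calK_direct_sum A x0 r (lam : 'I_r -> X -> C) :=
  direct_sum_full (fun i => calK (shifted_power A (lam i)) x0).

End Jordanizability.

(* Main.v *)
(* Away from the coalescing points, a dense open set where the [lam i] are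
   pairwise distinct, the germ space K[(A - lam i)^n] is the whole generalized
   eigenspace, of constant dimension [m i]; everywhere its dimension is at most
   [m i], and it is lower semicontinuous. A frame of germs of maximal rank at
   [x0] spans the generalized eigenspaces nearby, so they converge. Conversely,
   if they converge to [L], Cramer's rule relative to [L] expresses a frame as a
   bounded quotient of holomorphic functions, which is holomorphic by
   Riemann's extension theorem.

   If the limits split C^n, the spectral projections extend holomorphically to
   [x0]. The nilpotent part V of A is then holomorphic, and it is conjugate at
   each point to the off-diagonal part of the Jordan form J; since J is continuous
   with off-diagonal entries 0 and 1, the ranks of the powers of V are constant.
   Hence vectors killed by a power of V at [x0] extend to germs killed by the same
   power, and the Jordan chains at [x0] extend to a holomorphic Jordan basis. *)
From HB Require Import structures.
Require Import Defs.
From mathcomp Require Import all_boot all_order all_algebra.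
From mathcomp Require Import all_classical all_reals all_analysis.
From mathcomp Require Import finmap complex.
From mathcomp Require Import ring lra zify.

Set Implicit Arguments.
Unset Strict Implicit.
Unset Printing Implicit Defensive.

Import Order.TTheory GRing.Theory Num.Theory.
Import numFieldNormedType.Exports.

Local Open Scope classical_set_scope.
Local Open Scope ring_scope.
Local Open Scope complex_scope.

(** * Real-valued norm on complex normed spaces *)

(** Holomorphy is given as complex differentiability, with no continuity of derivatives. All
    analysis therefore rests on Goursat's bisection and on Cauchy's formula for one disc, with
    finite Taylor remainders and explicit constants; several variables enter only through complex
    lines. The zero set of the Cramer determinant can be complicated, so division averages over a
    circle that avoids it, the same circle up to translation for all nearby centres. On the Jordan
    side the obstacle is that [J x] is conjugate to [A x] at each point separately, by matrices
    without any regularity in [x]. Only pointwise invariants can be transferred: spectra, kernels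
    and ranks of powers. Even the index [i] with [J x j j = lam i x] might jump; it does not,
    because germs form an integral domain and [U] is connected. The resulting counts [m i] are thus
    independent of the point and add up to [n], and most equalities of dimensions come from
    inequalities whose two sides have the same sum. *)

Section RealNorm.
Variable R : realType.
Local Notation C := (Cplx R).

(** Over the scalars [C] the norm is an element of [C]. Its real part lives in [R], where the order
    is total and suprema and real integrals are available. *)
Definition nr (V : normedModType C) (v : V) : R := complex.Re `|v|.

Section GeneralNorm.
Variable V : normedModType C.
Implicit Types v w : V.

Lemma nrE v : `|v| = (nr v)%:C :> C.
Proof. by rewrite /nr RRe_real // ger0_real. Qed.

Lemma nr_ge0 v : 0 <= nr v.
Proof. by rewrite -ler0c -nrE normr_ge0. Qed.

Lemma nr0 : nr (0 : V) = 0.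
Proof. by rewrite /nr normr0. Qed.

Lemma nr_eq0 v : (nr v == 0) = (v == 0).
Proof.
by rewrite -(normr_eq0 v) nrE; apply/eqP/eqP => [->//|[]].
Qed.

Lemma nr_gt0 v : (0 < nr v) = (v != 0).
Proof. by rewrite lt_neqAle nr_ge0 andbT eq_sym nr_eq0. Qed.

Lemma nrD v w : nr (v + w) <= nr v + nr w.
Proof. by rewrite -lecR rmorphD /= -!nrE ler_normD. Qed.

Lemma nrN v : nr (- v) = nr v.
Proof. by rewrite /nr normrN. Qed.

Lemma nrBC v w : nr (v - w) = nr (w - v).
Proof. by rewrite -nrN opprB. Qed.

Lemma nrB v w : nr (v - w) <= nr v + nr w.
Proof. by rewrite -(nrN w) nrD. Qed.

Lemma nr_subD v w u : nr (v - w) <= nr (v - u) + nr (u - w).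
Proof. by apply: le_trans (nrD _ _); rewrite addrA subrK. Qed.

Lemma nr_lbB v w : nr v - nr w <= nr (v - w).
Proof. by rewrite lerBlDr; apply: le_trans (nrD _ _); rewrite subrK. Qed.

Lemma nr_sum (I : Type) (s : seq I) (P : pred I) (F : I -> V) :
  nr (\sum_(i <- s | P i) F i) <= \sum_(i <- s | P i) nr (F i).
Proof.
elim/big_ind2: _ => [|x x' y y' hx hy|//]; first by rewrite nr0.
by apply: le_trans (nrD _ _) _; apply: lerD.
Qed.

Lemma nbhs_nrP (x : V) (A : set V) :
  nbhs x A <-> exists2 e : R, 0 < e & forall y, nr (y - x) < e -> A y.
Proof.
rewrite -nbhs_nbhs_norm; split.
  case=> e /= e0 h; exists (complex.Re e).
    by move: e0; rewrite ltcE => /andP[_].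
  move=> y hy; apply: h => /=; rewrite distrC nrE.
  by rewrite -(RRe_real (gtr0_real e0)) ltcR.
case=> e e0 h; exists e%:C => /=; first by rewrite ltcR.
by move=> y /=; rewrite distrC nrE ltcR; exact: h.
Qed.

Lemma cvg_nrP (T : Type) (F : set_system T) (FF : Filter F) (f : T -> V) (l : V) :
  (f @ F --> l) <-> (forall e : R, 0 < e -> \forall x \near F, nr (f x - l) < e).
Proof.
split=> [h e e0|h A].
  by apply: (h [set y | nr (y - l) < e]); apply/nbhs_nrP; exists e.
by case/nbhs_nrP => e e0 hA; apply: filterS (h e e0) => x /hA.
Qed.

End GeneralNorm.

Lemma nrZ (V : normedModType C) (a : C) (v : V) : nr (a *: v) = nr a * nr v.
Proof.
have : (nr (a *: v))%:C = (nr a * nr v)%:C :> C by rewrite rmorphM /= -!nrE normrZ.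
by case.
Qed.

Lemma nrM (a b : C) : nr (a * b) = nr a * nr b.
Proof. exact: (nrZ (a : C) (b : C^o)). Qed.

Lemma nr1 : nr (1 : C) = 1.
Proof. by rewrite /nr normr1. Qed.

Lemma nrV (a : C) : nr a^-1 = (nr a)^-1.
Proof.
have : (nr a^-1)%:C = ((nr a)^-1)%:C :> C by rewrite fmorphV /= -!nrE normfV.
by case.
Qed.

Lemma nrX (a : C) k : nr (a ^+ k) = nr a ^+ k.
Proof. by elim: k => [|k IH]; rewrite ?expr0 ?nr1 // !exprS nrM IH. Qed.

Lemma nr_real (x : R) : nr (x%:C : C) = `|x|.
Proof. by rewrite /nr normc_def /= expr0n addr0 sqrtr_sqr. Qed.

Lemma nr_def (z : C) : nr z = Num.sqrt (complex.Re z ^+ 2 + complex.Im z ^+ 2).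
Proof. by rewrite /nr normc_def. Qed.

Lemma le_Re_nr (z : C) : `|complex.Re z| <= nr z.
Proof.
by rewrite nr_def -sqrtr_sqr ler_wsqrtr // lerDl sqr_ge0.
Qed.

Lemma le_Im_nr (z : C) : `|complex.Im z| <= nr z.
Proof.
by rewrite nr_def -sqrtr_sqr ler_wsqrtr // lerDr sqr_ge0.
Qed.

Lemma nr_le_ReIm (z : C) : nr z <= `|complex.Re z| + `|complex.Im z|.
Proof.
rewrite {1}[z]complexE; apply: le_trans (nrD _ _) _.
by rewrite nrM !nr_real nr_def /= expr0n expr1n add0r sqrtr1 mul1r.
Qed.

Lemma CReD (z w : C) : complex.Re (z + w) = complex.Re z + complex.Re w.
Proof. by case: z w => [? ?] []. Qed.

Lemma CImD (z w : C) : complex.Im (z + w) = complex.Im z + complex.Im w.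
Proof. by case: z w => [? ?] []. Qed.

Lemma CReB (z w : C) : complex.Re (z - w) = complex.Re z - complex.Re w.
Proof. by case: z w => [? ?] []. Qed.

Lemma CImB (z w : C) : complex.Im (z - w) = complex.Im z - complex.Im w.
Proof. by case: z w => [? ?] []. Qed.

Lemma CReM (z w : C) : complex.Re (z * w) =
  complex.Re z * complex.Re w - complex.Im z * complex.Im w.
Proof. by case: z w => [? ?] []. Qed.

Lemma CImM (z w : C) : complex.Im (z * w) =
  complex.Re z * complex.Im w + complex.Im z * complex.Re w.
Proof. by case: z w => [? ?] []. Qed.

Lemma Cplx_eq (z w : C) : complex.Re z = complex.Re w ->
  complex.Im z = complex.Im w -> z = w.
Proof. by case: z w => [? ?] [? ?] /= -> ->. Qed.

Lemma continuous_Re : continuous (fun z : C => complex.Re z).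
Proof.
move=> z; apply/(@cvgrPdist_lt _ _ _ (nbhs z)) => e e0.
apply/nbhs_nrP; exists e => // y.
by rewrite -CReB nrBC; apply: le_lt_trans (le_Re_nr _).
Qed.

Lemma continuous_Im : continuous (fun z : C => complex.Im z).
Proof.
move=> z; apply/(@cvgrPdist_lt _ _ _ (nbhs z)) => e e0.
apply/nbhs_nrP; exists e => // y.
by rewrite -CImB nrBC; apply: le_lt_trans (le_Im_nr _).
Qed.

Lemma cvg_ReIm (T : Type) (F : set_system T) (FF : Filter F) (f : T -> C) (l : C) :
  (complex.Re (f x) @[x --> F] --> complex.Re l) ->
  (complex.Im (f x) @[x --> F] --> complex.Im l) -> f @ F --> l.
Proof.
move=> /cvgrPdist_lt hR /cvgrPdist_lt hI; apply/cvg_nrP => e e0.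
have e2 : 0 < e / 2 by rewrite divr_gt0.
near=> x; apply: le_lt_trans (nr_le_ReIm _) _.
rewrite [e]splitr CReB CImB; apply: ltrD; rewrite distrC; near: x; [exact: hR|exact: hI].
Unshelve. all: by end_near. Qed.

Lemma continuous_real : continuous (fun x : R => x%:C : C).
Proof.
move=> x; apply: cvg_ReIm => /=; first exact: cvg_id.
exact: cvg_cst.
Qed.

Lemma diff_nr (V : normedModType C) (f : V -> C) (x : V) : differentiable f x ->
  forall e : R, 0 < e -> exists2 d : R, 0 < d &
    forall h, nr h < d -> nr (f (x + h) - f x - 'd f x h) <= e * nr h.
Proof.
move=> /diff_locallyP[_ /eqaddoP h] e e0.
have /nbhs_nrP[d d0 hd] := h e%:C ltac:(by rewrite ltcR).
exists d => // k kd; move: (hd k); rewrite subr0 => /(_ kd).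
have -> : ((f \o shift x) - (cst (f x) + 'd f x)) k = f (x + k) - f x - 'd f x k.
  transitivity (f (k + x) - (f x + 'd f x k)) => //.
  by rewrite opprD addrA [k + x]addrC.
by rewrite !nrE -rmorphM /= lecR.
Qed.

(** A quadratic remainder beats [e * nr h] for every [e], and the bound on [L] makes it continuous.
    Derivatives of Taylor quotients and of parameter integrals are obtained from estimates of this
    kind. *)
Lemma differentiable_quad (V : normedModType C) (f : V -> C) (x : V)
    (L : {linear V -> C}) (B M d : R) : 0 < d ->
  (forall h, nr (L h) <= B * nr h) ->
  (forall h, nr h < d -> nr (f (x + h) - f x - L h) <= M * nr h ^+ 2) ->
  differentiable f x /\ ('d f x = L :> (V -> C)).
Proof.
move=> d0 hB hM.
have cL : continuous (L : V -> C).
  move=> y; apply/cvg_nrP => e e0; apply/nbhs_nrP.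
  exists (e / (`|B| + 1)); first by rewrite divr_gt0 // ltr_wpDl.
  move=> z; rewrite ltr_pdivlMr ?ltr_wpDl // => hz.
  rewrite -linearB; apply: le_lt_trans (hB _) _.
  apply: le_lt_trans hz; rewrite mulrC ler_wpM2l ?nr_ge0 //.
  by rewrite (le_trans (ler_norm _)) // lerDl.
have hL : f \o shift x = cst (f x) + L +o_ 0 id.
  apply/eqaddoP => e e0; apply/nbhs_nrP.
  have e0' : 0 < complex.Re e by move: e0; rewrite ltcE => /andP[].
  exists (Num.min d (complex.Re e / (`|M| + 1))).
    by rewrite lt_min d0 divr_gt0 // ltr_wpDl.
  move=> h; rewrite subr0 lt_min => /andP[hd].
  rewrite ltr_pdivlMr ?ltr_wpDl // => he.
  rewrite /= !nrE -(RRe_real (gtr0_real e0)) -rmorphM /= lecR.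
  have -> : ((f \o shift x) - (cst (f x) + L)) h = f (x + h) - f x - L h.
    transitivity (f (h + x) - (f x + L h)) => //.
    by rewrite opprD addrA [h + x]addrC.
  apply: le_trans (hM _ hd) _; rewrite expr2 mulrA ler_wpM2r ?nr_ge0 //.
  apply: le_trans (ltW he); rewrite mulrC ler_wpM2l ?nr_ge0 //.
  by rewrite (le_trans (ler_norm _)) // lerDl.
have dE : 'd f x = L :> (V -> C) by apply: diff_unique.
split; last exact: dE.
by apply/diff_locallyP; split; [rewrite dE; exact: cL | rewrite dE; exact: hL].
Qed.

End RealNorm.

(** * Complex-valued integrals and Cauchy's formula *)

Section ComplexIntegral.
Variable R : realType.
Local Notation C := (Cplx R).
Local Notation mu := (@lebesgue_measure R).
Implicit Types (f g : R -> C) (a b c : R).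

(** The limits are two-sided in [R], even at the end points, so that subintervals inherit the
    property without subspace topologies. *)
Definition cont_on f a b := forall x, a <= x <= b -> f @ x --> f x.

Definition cint f a b : C :=
  (\int[mu]_(x in `[a, b]) complex.Re (f x)) +i*
  (\int[mu]_(x in `[a, b]) complex.Im (f x)).

Lemma cont_on_Re f a b : cont_on f a b ->
  {within `[a, b], continuous (fun x => complex.Re (f x))}.
Proof.
move=> h; apply: continuous_in_subspaceT => x /set_mem /=; rewrite in_itv /= => hx.
exact: (continuous_comp (h x hx) (@continuous_Re R (f x))).
Qed.

Lemma cont_on_Im f a b : cont_on f a b ->
  {within `[a, b], continuous (fun x => complex.Im (f x))}.
Proof.
move=> h; apply: continuous_in_subspaceT => x /set_mem /=; rewrite in_itv /= => hx.
exact: (continuous_comp (h x hx) (@continuous_Im R (f x))).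
Qed.

Lemma intg_Re f a b : cont_on f a b ->
  mu.-integrable `[a, b] (EFin \o (fun x => complex.Re (f x))).
Proof.
move=> h; apply: continuous_compact_integrable; first exact: segment_compact.
exact: cont_on_Re.
Qed.

Lemma intg_Im f a b : cont_on f a b ->
  mu.-integrable `[a, b] (EFin \o (fun x => complex.Im (f x))).
Proof.
move=> h; apply: continuous_compact_integrable; first exact: segment_compact.
exact: cont_on_Im.
Qed.

Lemma cont_onD f g a b : cont_on f a b -> cont_on g a b ->
  cont_on (fun x => f x + g x) a b.
Proof. by move=> hf hg x hx; apply: cvgD; [exact: hf|exact: hg]. Qed.

Lemma cont_onB f g a b : cont_on f a b -> cont_on g a b ->
  cont_on (fun x => f x - g x) a b.
Proof. by move=> hf hg x hx; apply: cvgB; [exact: hf|exact: hg]. Qed.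

Lemma cont_onM f g a b : cont_on f a b -> cont_on g a b ->
  cont_on (fun x => f x * g x) a b.
Proof. by move=> hf hg x hx; apply: cvgM; [exact: hf|exact: hg]. Qed.

Lemma cont_on_cst (k : C) a b : cont_on (fun=> k) a b.
Proof. by move=> x _; apply: cvg_cst. Qed.

Lemma cintD f g a b : cont_on f a b -> cont_on g a b ->
  cint (fun x => f x + g x) a b = cint f a b + cint g a b.
Proof.
move=> hf hg; apply: Cplx_eq; rewrite ?CReD ?CImD /cint /=.
  rewrite -RintegralD //; [|exact: intg_Re|exact: intg_Re].
  by apply: eq_Rintegral => x _; rewrite CReD.
rewrite -RintegralD //; [|exact: intg_Im|exact: intg_Im].
by apply: eq_Rintegral => x _; rewrite CImD.
Qed.

Lemma cintZ (k : C) f a b : cont_on f a b ->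
  cint (fun x => k * f x) a b = k * cint f a b.
Proof.
move=> hf; apply: Cplx_eq; rewrite ?CReM ?CImM /cint /=.
  have iR := intg_Re hf; have iI := intg_Im hf.
  rewrite -!RintegralZl // -RintegralB //; first by
    apply: eq_Rintegral => x _; rewrite CReM.
  - have := intg_Re (cont_onM (@cont_on_cst (complex.Re k)%:C a b) hf).
    by apply: eq_integrable => // x _; congr EFin; rewrite /= CReM /= mul0r subr0.
  - have := intg_Im (cont_onM (@cont_on_cst (complex.Im k)%:C a b) hf).
    by apply: eq_integrable => // x _; congr EFin; rewrite /= CImM /= mul0r addr0.
have iR := intg_Re hf; have iI := intg_Im hf.
rewrite -!RintegralZl // -RintegralD //; first by
  apply: eq_Rintegral => x _; rewrite CImM.
- have := intg_Im (cont_onM (@cont_on_cst (complex.Re k)%:C a b) hf).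
  by apply: eq_integrable => // x _; congr EFin; rewrite /= CImM /= mul0r addr0.
- have := intg_Re (cont_onM (@cont_on_cst (complex.Im k)%:C a b) hf).
  by apply: eq_integrable => // x _; congr EFin; rewrite /= CReM /= mul0r subr0.
Qed.

Lemma eq_cint f g a b : (forall x, a <= x <= b -> f x = g x) ->
  cint f a b = cint g a b.
Proof.
move=> h; apply: Cplx_eq => /=; apply: eq_Rintegral => x /set_mem /=;
  by rewrite in_itv /= => /h ->.
Qed.

Lemma cintB f g a b : cont_on f a b -> cont_on g a b ->
  cint (fun x => f x - g x) a b = cint f a b - cint g a b.
Proof.
move=> hf hg; have cN : cont_on (fun x => -1 * g x) a b.
  by apply: cont_onM hg; apply: cont_on_cst.
have <- : cint (fun x => -1 * g x) a b = - cint g a b by rewrite (cintZ (-1) hg) mulN1r.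
rewrite -(cintD hf cN); apply: eq_cint => x _.
by rewrite mulN1r.
Qed.

Lemma cint_cat f a b c : cont_on f a c -> a <= b <= c ->
  cint f a c = cint f a b + cint f b c.
Proof.
move=> hf /andP[ab bc].
have hab : `[a, b] `<=` `[a, c].
  by move=> x /=; rewrite !in_itv /= => /andP[-> /le_trans]; apply.
have hbc : `[b, c] `<=` `[a, c].
  by move=> x /=; rewrite !in_itv /= => /andP[/(le_trans ab) -> ->].
have main (h : R -> R) : mu.-integrable `[a, c] (EFin \o h) ->
    \int[mu]_(x in `[a, c]) h x =
    \int[mu]_(x in `[a, b]) h x + \int[mu]_(x in `[b, c]) h x.
  move=> ih; rewrite -(@Rintegral_itv_obnd_cbnd _ b); last first.
    apply: integrableS ih => //; apply: (subset_trans _ hbc).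
    by move=> x /=; rewrite !in_itv /= => /andP[/ltW -> ->].
  by rewrite -(Rintegral_itvB (x := b) ih) ?bnd_simp // addrC subrK.
apply: Cplx_eq; rewrite ?CReD ?CImD /cint /=.
  by apply: main; apply: intg_Re.
by apply: main; apply: intg_Im.
Qed.

Lemma fine_mu_itv a b : a <= b -> fine (mu `[a, b]) = b - a.
Proof.
move=> ab; have -> : mu `[a, b] = _ := lebesgue_measure_itv `[a, b].
rewrite /= lte_fin; case: ltrP => // ba.
by rewrite (le_anti (introT andP (conj ab ba))) subrr.
Qed.

Lemma Rint_bound (h : R -> R) a b (M : R) : a <= b ->
  mu.-integrable `[a, b] (EFin \o h) ->
  (forall x, a <= x <= b -> `|h x| <= M) ->
  `|\int[mu]_(x in `[a, b]) h x| <= M * (b - a).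
Proof.
move=> ab ih hM.
have mab : measurable [set` `[a, b]] by exact: measurable_itv.
apply: le_trans (le_normr_Rintegral _ ih) _ => //.
apply: (@le_trans _ _ (\int[mu]_(x in `[a, b]) M)).
  apply: le_Rintegral => //.
  - exact: integrable_norm.
  - apply: continuous_compact_integrable; first exact: segment_compact.
    by apply: continuous_subspaceT => x; exact: cvg_cst.
by rewrite Rintegral_cst // fine_mu_itv.
Qed.

(** The factor 2 comes from bounding real and imaginary parts separately; it reappears in the
    constants of the later estimates. *)
Lemma cint_bound f a b (M : R) : a <= b -> cont_on f a b ->
  (forall x, a <= x <= b -> nr (f x) <= M) ->
  nr (cint f a b) <= 2 * M * (b - a).
Proof.
move=> ab hf hM; apply: le_trans (nr_le_ReIm _) _.
rewrite mulrDl mul1r mulrDl; apply: lerD; apply: Rint_bound => //.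
- exact: intg_Re.
- by move=> x hx; apply: le_trans (hM x hx); exact: le_Re_nr.
- exact: intg_Im.
- by move=> x hx; apply: le_trans (hM x hx); exact: le_Im_nr.
Qed.

Lemma Rint_FTC (F h : R -> R) a b : a <= b ->
  (forall x : R, is_derive x 1 F (h x)) -> continuous h ->
  \int[mu]_(x in `[a, b]) h x = F b - F a.
Proof.
move=> ab hF hc.
have cF : continuous F.
  by move=> x; apply/differentiable_continuous/derivable1_diffP; have [] := hF x.
move: ab; rewrite le_eqVlt => /predU1P[->|ab].
  by rewrite set_itv1 Rintegral_set1 subrr.
rewrite /Rintegral (continuous_FTC2 (F := F)) //.
- exact: continuous_subspaceT.
- split; first by move=> x _; have [] := hF x.
    exact/cvg_at_right_filter/cF.
  exact/cvg_at_left_filter/cF.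
- by move=> x _; rewrite derive1E; apply: derive_val.
Qed.

Lemma cint_FTC (F h : R -> C) a b : a <= b ->
  (forall x : R, is_derive x 1 (fun y => complex.Re (F y)) (complex.Re (h x))) ->
  (forall x : R, is_derive x 1 (fun y => complex.Im (F y)) (complex.Im (h x))) ->
  continuous h ->
  cint h a b = F b - F a.
Proof.
move=> ab hR hI hc; apply: Cplx_eq; rewrite ?CReB ?CImB /=.
  rewrite (Rint_FTC ab hR) //.
  by move=> x; apply: (continuous_comp (hc x)); exact: continuous_Re.
rewrite (Rint_FTC ab hI) //.
by move=> x; apply: (continuous_comp (hc x)); exact: continuous_Im.
Qed.

Lemma cint_cst (k : C) a b : a <= b -> cint (fun=> k) a b = k * (b - a)%:C.
Proof.
move=> ab; apply: Cplx_eq => /=.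
  by rewrite CReM /= mulr0 subr0 Rintegral_cst // fine_mu_itv.
by rewrite CImM /= mulr0 add0r Rintegral_cst // fine_mu_itv.
Qed.

Lemma cint_conj f a b : cont_on f a b ->
  cint (fun x => (f x)^*) a b = (cint f a b)^*.
Proof.
move=> hf; apply: Cplx_eq => /=.
  by apply: eq_Rintegral => x _; case: (f x).
rewrite -[RHS]mulN1r -RintegralZl //; last exact: intg_Im.
by apply: eq_Rintegral => x _; case: (f x) => ? ? /=; rewrite mulN1r.
Qed.

End ComplexIntegral.

(** * Goursat's bisection argument *)

Section Bisection.
Variable R : realType.
Local Notation C := (Cplx R).

(** One of the four quarters keeps at least a quarter of the value, so nested rectangles carry at
    least [s / 4 ^+ k]. At their common point the local bound is [e] times the squared size, which
    also decays like [4 ^- k] but with [e] arbitrarily small. *)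
Lemma bisection_zero (I : R -> R -> R -> R -> C) (a b c d : R) :
  a <= b -> c <= d ->
  (forall x1 x2 y1 y2, a <= x1 -> x1 <= x2 -> x2 <= b ->
     c <= y1 -> y1 <= y2 -> y2 <= d ->
     let xm := (x1 + x2) / 2 in let ym := (y1 + y2) / 2 in
     I x1 x2 y1 y2 = I x1 xm y1 ym + I xm x2 y1 ym + I x1 xm ym y2 + I xm x2 ym y2) ->
  (forall p q, a <= p <= b -> c <= q <= d -> forall e, 0 < e ->
     exists2 dl : R, 0 < dl & forall x1 x2 y1 y2,
       a <= x1 -> x1 <= p -> p <= x2 -> x2 <= b ->
       c <= y1 -> y1 <= q -> q <= y2 -> y2 <= d ->
       x2 - x1 < dl -> y2 - y1 < dl ->
       nr (I x1 x2 y1 y2) <= e * (x2 - x1 + (y2 - y1)) ^+ 2) ->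
  I a b c d = 0.
Proof.
move=> ab cd hadd hloc; apply/eqP; rewrite -nr_eq0 -[_ == _]negbK.
apply/negP => nz; set s := nr (I a b c d).
have s0 : 0 < s by rewrite lt_neqAle eq_sym nz nr_ge0.
pose w k : R := (b - a) / 2 ^+ k; pose h k : R := (d - c) / 2 ^+ k.
have w0 k : 0 <= w k by rewrite divr_ge0 ?subr_ge0 // exprn_ge0.
have h0 k : 0 <= h k by rewrite divr_ge0 ?subr_ge0 // exprn_ge0.
have wS k : w k = w k.+1 + w k.+1.
  by rewrite /w exprS; field; rewrite expf_neq0 // pnatr_eq0.
have hS k : h k = h k.+1 + h k.+1.
  by rewrite /h exprS; field; rewrite expf_neq0 // pnatr_eq0.
pose Q k (p : R * R) := [/\ a <= p.1, p.1 + w k <= b, c <= p.2, p.2 + h k <= d &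
  s / 4 ^+ k <= nr (I p.1 (p.1 + w k) p.2 (p.2 + h k))].
pose rel k (p q : R * R) := [/\ p.1 <= q.1, q.1 + w k.+1 <= p.1 + w k,
  p.2 <= q.2 & q.2 + h k.+1 <= p.2 + h k].
have step k p : Q k p -> exists q, Q k.+1 q /\ rel k p q.
  case: p => x y [/= ax xb cy yd hs].
  have /= := hadd x (x + w k) y (y + h k) ax ltac:(by rewrite lerDl) xb cy
    ltac:(by rewrite lerDl) yd.
  have -> : (x + (x + w k)) / 2 = x + w k.+1 by rewrite wS; field.
  have -> : (y + (y + h k)) / 2 = y + h k.+1 by rewrite hS; field.
  have xw : x + w k = x + w k.+1 + w k.+1 by rewrite wS addrA.
  have yh : y + h k = y + h k.+1 + h k.+1 by rewrite hS addrA.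
  have [wk hk] := (w0 k.+1, h0 k.+1).
  have a1 : a <= x + w k.+1 by rewrite (le_trans ax) ?lerDl.
  have b2 : x + w k.+1 + w k.+1 <= b by rewrite -xw.
  have b1 : x + w k.+1 <= b by rewrite (le_trans _ b2) ?lerDl.
  have c1 : c <= y + h k.+1 by rewrite (le_trans cy) ?lerDl.
  have d2 : y + h k.+1 + h k.+1 <= d by rewrite -yh.
  have d1 : y + h k.+1 <= d by rewrite (le_trans _ d2) ?lerDl.
  have x1 : x <= x + w k.+1 by rewrite lerDl.
  have x2 : x + w k.+1 <= x + w k by rewrite xw lerDl.
  have x3 : x + w k.+1 + w k.+1 <= x + w k by rewrite xw.
  have y1 : y <= y + h k.+1 by rewrite lerDl.
  have y2 : y + h k.+1 <= y + h k by rewrite yh lerDl.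
  have y3 : y + h k.+1 + h k.+1 <= y + h k by rewrite yh.
  set I1 := I x (x + w k.+1) y (y + h k.+1); set I2 := I (x + w k.+1) _ y _.
  set I3 := I x (x + w k.+1) (y + h k.+1) _; set I4 := I (x + w k.+1) _ (y + h k.+1) _.
  move=> E.
  pose t := s / 4 ^+ k.+1.
  have tE : s / 4 ^+ k = t + t + t + t.
    by rewrite /t exprS; field; rewrite expf_neq0 // pnatr_eq0.
  have [h1|h1] := leP t (nr I1).
    by exists (x, y); split; split.
  have [h2|h2] := leP t (nr I2).
    exists (x + w k.+1, y); split; split => //=.
    by move: h2; rewrite /I2 xw.
  have [h3|h3] := leP t (nr I3).
    exists (x, y + h k.+1); split; split => //=.
    by move: h3; rewrite /I3 yh.
  have [h4|h4] := leP t (nr I4).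
    exists (x + w k.+1, y + h k.+1); split; split => //=.
    by move: h4; rewrite /I4 xw yh.
  exfalso; have := nrD (I1 + I2 + I3) I4; have := nrD (I1 + I2) I3.
  have := nrD I1 I2; rewrite -E; move: hs; rewrite tE; lra.
have Q0 : Q 0%N (a, c).
  by split => //=; rewrite ?/w ?/h ?expr0 ?divr1; try lra; rewrite ![_ + (_ - _)]addrC !subrK.
pose nxt k (p : {p | Q k p}) : {q | Q k.+1 q} :=
  let: exist q hq := cid (step k (sval p) (svalP p)) in exist _ q (proj1 hq).
pose fix sq k : {p | Q k p} :=
  if k is k'.+1 then nxt k' (sq k') else exist _ _ Q0.
have relS k : rel k (sval (sq k)) (sval (sq k.+1)).
  by rewrite /= /nxt; case: cid => q [? ?].
pose X k := (sval (sq k)).1; pose Y k := (sval (sq k)).2.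
have QX k : Q k (X k, Y k) by have := svalP (sq k); rewrite /X /Y; case: (sval _).
have mono (u v : nat -> R) : (forall k, 0 <= v k) -> (forall k, u k <= u k.+1) ->
    (forall k, u k.+1 + v k.+1 <= u k + v k) ->
    exists p, forall k, u k <= p <= u k + v k.
  move=> v0 hu huv.
  have umono m n : (m <= n)%N -> u m <= u n.
    by move=> /subnK <-; elim: (n - m)%N => // i IH; exact: le_trans IH (hu _).
  have vmono m n : (m <= n)%N -> u n + v n <= u m + v m.
    by move=> /subnK <-; elim: (n - m)%N => // i IH; exact: le_trans (huv _) IH.
  have ub k : ubound (range u) (u k + v k).
    move=> _ [m _ <-]; case: (leqP m k) => [mk|/ltnW km].
      by apply: le_trans (umono _ _ mk) _; rewrite lerDl.
    by apply: le_trans (vmono _ _ km); rewrite lerDl.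
  have hs : has_sup (range u) by split; [exists (u 0%N); exists 0%N|exists (u 0%N + v 0%N)].
  exists (sup (range u)) => k; apply/andP; split.
    by apply: sup_upper_bound => //; exists k.
  by apply: sup_le_ub => //; case: hs.
have [p hp] : exists p, forall k, X k <= p <= X k + w k.
  by apply: mono => // k; have [] := relS k.
have [q hq] : exists q, forall k, Y k <= q <= Y k + h k.
  by apply: mono => // k; have [] := relS k.
have pab : a <= p <= b.
  have [h1 h2 _ _ _] := QX 0%N; have /andP[h3 h4] := hp 0%N.
  by rewrite (le_trans h1 h3) (le_trans h4 h2).
have qcd : c <= q <= d.
  have [_ _ h1 h2 _] := QX 0%N; have /andP[h3 h4] := hq 0%N.
  by rewrite (le_trans h1 h3) (le_trans h4 h2).
pose T := (b - a) + (d - c).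
have T0 : 0 <= T by rewrite addr_ge0 // subr_ge0.
(* Chosen so that [e * T ^+ 2 < s], the final contradiction; the [+ 1] covers [T = 0]. *)
pose e := s / (2 * (T ^+ 2 + 1)).
have T2 : 0 < T ^+ 2 + 1 by rewrite ltr_wpDl // sqr_ge0.
have e0 : 0 < e by rewrite divr_gt0 // mulr_gt0.
have [dl dl0 hdl] := hloc p q pab qcd e e0.
have [k hk] : exists k, T / 2 ^+ k < dl.
  exists (Num.bound (T / dl)); rewrite ltr_pdivrMr ?exprn_gt0 //.
  have : T / dl < 2 ^+ (Num.bound (T / dl)).
    apply: lt_trans (archi_boundP (divr_ge0 T0 (ltW dl0))) _.
    by rewrite -natrX ltr_nat ltn_expl.
  by rewrite ltr_pdivrMr // mulrC.
have TE : T / 2 ^+ k = w k + h k by rewrite /T mulrDl.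
have [h1 h2 h3 h4 h5] := QX k; have /andP[h6 h7] := hp k; have /andP[h8 h9] := hq k.
have := hdl _ _ _ _ h1 h6 h7 h2 h3 h8 h9 h4.
have wk := w0 k; have hk' := h0 k.
rewrite ![_ + _ - _]addrAC !subrr !add0r => /(_ ltac:(lra) ltac:(lra)) => hbad.
have := le_trans h5 hbad; rewrite -TE expr_div_n.
have -> : (2 ^+ k) ^+ 2 = 4 ^+ k :> R by rewrite -exprM mulnC exprM; congr (_ ^+ _); ring.
rewrite mulrA ler_pdivrMr ?exprn_gt0 // divfK ?expf_neq0 ?pnatr_eq0 //.
apply/negP; rewrite -ltNge /e mulrAC ltr_pdivrMr ?mulr_gt0 //.
rewrite ltr_pM2l //; have := sqr_ge0 T; lra.
Qed.

End Bisection.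

(* [ring] compares atoms up to conversion, which unfolds integrals. *)
Ltac cint_ring := repeat match goal with |- context [@cint ?R ?g ?a ?b] =>
  generalize (@cint R g a b); intro end; ring.

(** * Cauchy's integral formula on a disc *)

Section CauchyFormula.
Variable R : realType.
Local Notation C := (Cplx R).
Local Notation T := (pi *+ 2 : R).
Implicit Types (f : C -> C) (x y : R) (z t : C).

Definition cis y : C := (cos y) +i* (sin y).

Lemma nr_cis y : nr (cis y) = 1.
Proof. by rewrite nr_def /= cos2Dsin2 sqrtr1. Qed.

Lemma continuous_cis : continuous cis.
Proof.
move=> y; apply: cvg_ReIm => /=; [exact: continuous_cos|exact: continuous_sin].
Qed.

Lemma cis2pi : cis T = cis 0.
Proof. by rewrite /cis cos2pi sin2pi cos0 sin0. Qed.

Lemma cint_icis y1 y2 : y1 <= y2 ->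
  cint (fun y => 'i%C * cis y) y1 y2 = cis y2 - cis y1.
Proof.
move=> y12; apply: cint_FTC => //.
- move=> y /=; rewrite mul0r mul1r sub0r; exact: is_derive_cos.
- move=> y /=; rewrite mul0r mul1r add0r; exact: is_derive_sin.
- by move=> y; apply: cvgM; [exact: cvg_cst|exact: continuous_cis].
Qed.

Lemma cint_expR x1 x2 : x1 <= x2 ->
  cint (fun x => (expR x)%:C : C) x1 x2 = (expR x2)%:C - (expR x1)%:C.
Proof.
move=> x12; apply: (@cint_FTC _ (fun x => (expR x)%:C : C)) => //=.
- by move=> x; exact: is_derive_cst.
- move=> x; apply: (continuous_comp (@continuous_expR R x)).
  exact: continuous_real.
Qed.

Lemma pi2_ge0 : 0 <= T.
Proof. by rewrite mulrn_wge0 // pi_ge0. Qed.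

Lemma nrJ (z : C) : nr (z^* : C) = nr z.
Proof. by rewrite !nr_def; case: z => a b /=; rewrite sqrrN. Qed.

Lemma diffC_mul f z h : 'd f z h = h * 'd f z 1 :> C.
Proof.
have -> : 'd f z h = 'd f z (h *: (1 : C^o)) by congr ('d f z _); rewrite /GRing.scale /= mulr1.
by rewrite linearZ.
Qed.

Lemma cvg_diff_comp f (s : R -> C) y : s @ y --> s y -> differentiable f (s y) ->
  f (s x) @[x --> y] --> f (s y).
Proof.
by move=> cs /differentiable_continuous; apply: (@continuous_comp _ _ _ s f y cs).
Qed.

Section Homotopy.
Variables (f : C -> C) (r : R) (t : C).
Hypothesis r0 : 0 < r.
Hypothesis df : forall z, nr z <= r -> differentiable f z.
Hypothesis tr : nr t < r.

Let s y : C := r%:C * cis y.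
(** A logarithmic homotopy: as [x] goes from 0 to minus infinity, the curve [zeta x] shrinks from
    the circle [s] to the point [t]. In these coordinates [dz / (z - t)] becomes [dx + kap y dy],
    because the derivative of [s] is ['i * s]. *)
Let zeta x y : C := t + (expR x)%:C * (s y - t).
Let kap y : C := 'i%C * s y / (s y - t).

Let nr_s y : nr (s y) = r.
Proof. by rewrite nrM nr_cis nr_real mulr1 gtr0_norm. Qed.

Let st_neq0 y : s y - t != 0.
Proof.
rewrite -nr_gt0; apply: lt_le_trans (nr_lbB _ _); by rewrite subr_gt0 nr_s.
Qed.

Let cont_s : continuous s.
Proof. by move=> y; apply: cvgM; [exact: cvg_cst|exact: continuous_cis]. Qed.

Let K := r / (r - nr t).

Let K0 : 0 < K.
Proof. by rewrite divr_gt0 // subr_gt0. Qed.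

Let nr_kap y : nr (kap y) <= K.
Proof.
rewrite nrM nrM nrV nr_s.
have -> : nr ('i%C : C) = 1 by rewrite nr_def /= expr0n expr1n add0r sqrtr1.
rewrite mul1r ler_pM2l // lef_pV2 ?posrE ?subr_gt0 ?nr_gt0 //.
by apply: le_trans (nr_lbB _ _); rewrite nr_s.
Qed.

Let cont_kap : continuous kap.
Proof.
move=> y; apply: cvgM.
  by apply: cvgM; [exact: cvg_cst|exact: cont_s].
apply: cvgV => //; apply: cvgB; [exact: cont_s|exact: cvg_cst].
Qed.

Let cont_zx y : continuous (zeta ^~ y).
Proof.
move=> x; apply: cvgD; first exact: cvg_cst.
apply: cvgM; last exact: cvg_cst.
by apply: (continuous_comp (@continuous_expR R x)); exact: continuous_real.
Qed.

Let cont_zy x : continuous (zeta x).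
Proof.
move=> y; apply: cvgD; first exact: cvg_cst.
apply: cvgM; first exact: cvg_cst.
by apply: cvgB; [exact: cont_s|exact: cvg_cst].
Qed.

Let nr_zeta x y : x <= 0 -> nr (zeta x y) <= r.
Proof.
move=> x0; have e1 : expR x <= 1 by rewrite -expR0 ler_expR.
have -> : zeta x y = (1 - expR x)%:C * t + (expR x)%:C * s y.
  by rewrite /zeta rmorphB rmorph1 /=; ring.
apply: le_trans (nrD _ _) _; rewrite nrM [X in _ + X]nrM nr_s !nr_real.
rewrite ger0_norm ?subr_ge0 // ger0_norm ?expR_ge0 //.
have : (1 - expR x) * nr t <= (1 - expR x) * r by rewrite ler_wpM2l ?subr_ge0 // ltW.
by lra.
Qed.

Let cont_fx y x1 x2 : x2 <= 0 -> cont_on (fun x => f (zeta x y)) x1 x2.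
Proof.
move=> x20 x /andP[_ hx]; apply: (@continuous_comp _ _ _ (zeta ^~ y) f); first exact: cont_zx.
by apply: differentiable_continuous; apply: df; apply: nr_zeta; exact: le_trans hx x20.
Qed.

Let cont_fy x y1 y2 : x <= 0 -> cont_on (fun y => f (zeta x y)) y1 y2.
Proof.
move=> x20 y _; apply: (@continuous_comp _ _ _ (zeta x) f); first exact: cont_zy.
by apply: differentiable_continuous; apply: df; exact: nr_zeta.
Qed.

Let cont_fk x y1 y2 : x <= 0 -> cont_on (fun y => f (zeta x y) * kap y) y1 y2.
Proof.
by move=> x0; apply: cont_onM; [exact: cont_fy|move=> y _; exact: cont_kap].
Qed.

(* The integral of f(z) dz/(z - t), pulled back by zeta, along the boundary
   of a rectangle. *)
Let bd (g : C -> C) x1 x2 y1 y2 : C :=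
  cint (fun x => g (zeta x y1)) x1 x2 + cint (fun y => g (zeta x2 y) * kap y) y1 y2
  - cint (fun x => g (zeta x y2)) x1 x2 - cint (fun y => g (zeta x1 y) * kap y) y1 y2.

Let bd_split x1 x2 y1 y2 : x1 <= x2 -> x2 <= 0 -> y1 <= y2 ->
  let xm := (x1 + x2) / 2 in let ym := (y1 + y2) / 2 in
  bd f x1 x2 y1 y2 =
  bd f x1 xm y1 ym + bd f xm x2 y1 ym + bd f x1 xm ym y2 + bd f xm x2 ym y2.
Proof.
move=> x12 x20 y12 /=; set xm := (x1 + x2) / 2; set ym := (y1 + y2) / 2.
have hx : x1 <= xm <= x2 by apply/andP; rewrite /xm; split; lra.
have hy : y1 <= ym <= y2 by apply/andP; rewrite /ym; split; lra.
have x10 : x1 <= 0 by lra.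
rewrite /bd (@cint_cat _ _ x1 xm x2 (cont_fx (y:=y1) x20) hx).
rewrite (@cint_cat _ _ x1 xm x2 (cont_fx (y:=y2) x20) hx).
rewrite (@cint_cat _ _ y1 ym y2 (cont_fk (y1:=y1) (y2:=y2) x20) hy).
rewrite (@cint_cat _ _ y1 ym y2 (cont_fk (y1:=y1) (y2:=y2) x10) hy).
by cint_ring.
Qed.

(** Together with [zeta_y]: the form [(z - t) dz / (z - t) = dz] has the primitive [zeta], so that
    affine functions contribute nothing around a rectangle. *)
Let zeta_x x1 x2 y : x1 <= x2 ->
  cint (fun x => zeta x y - t) x1 x2 = zeta x2 y - zeta x1 y.
Proof.
move=> x12; rewrite (_ : cint _ _ _ = cint (fun x => (s y - t) * (expR x)%:C) x1 x2).
  rewrite cintZ ?cint_expR //; first by rewrite /zeta; ring.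
  move=> x _; apply: (continuous_comp (@continuous_expR R x)).
  exact: continuous_real.
by apply: eq_cint => x _; rewrite /zeta; ring.
Qed.

Let zeta_y x y1 y2 : y1 <= y2 ->
  cint (fun y => (zeta x y - t) * kap y) y1 y2 = zeta x y2 - zeta x y1.
Proof.
move=> y12.
rewrite (_ : cint _ _ _ = cint (fun y => ((expR x)%:C * r%:C) * ('i%C * cis y)) y1 y2).
  rewrite cintZ ?cint_icis //; first by rewrite /zeta /s; ring.
  by move=> y _; apply: cvgM; [exact: cvg_cst|exact: continuous_cis].
apply: eq_cint => y _; rewrite /zeta /kap.
have /mulfV E := st_neq0 y.
transitivity ((expR x)%:C * ('i%C * s y) * ((s y - t) / (s y - t))); first by ring.
by rewrite E mulr1 /s; ring.
Qed.

(** In the direction [x] the speed is at most [nr (s y - t) <= 2 * r], in the direction [y] at most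
    [r]; each is doubled by [cint_bound]. *)
Let lip x1 x2 y1 y2 p q x y : x1 <= p <= x2 -> x1 <= x <= x2 -> x2 <= 0 ->
  y1 <= q <= y2 -> y1 <= y <= y2 ->
  nr (zeta x y - zeta p q) <= 4 * r * (x2 - x1 + (y2 - y1)).
Proof.
move=> hp hx x20 hq hy.
have zx (u v : R) : u <= v -> v <= 0 -> nr (zeta v y - zeta u y) <= 4 * r * (v - u).
  move=> uv v0; rewrite -zeta_x //.
  have h2 : 2 * (2 * r) * (v - u) = 4 * r * (v - u) by ring.
  rewrite -h2; apply: cint_bound => //.
    move=> w _; apply: cvgB; [exact: cont_zx|exact: cvg_cst].
  move=> w /andP[_ wv]; rewrite /zeta addrC addKr nrM nr_real ger0_norm ?expR_ge0 //.
  apply: (@le_trans _ _ (1 * nr (s y - t))).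
    rewrite ler_wpM2r ?nr_ge0 // -expR0 ler_expR; exact: le_trans wv v0.
  by rewrite mul1r; apply: le_trans (nrB _ _) _; rewrite nr_s mulr_natl mulr2n lerD2l ltW.
have zy (u v : R) : u <= v -> nr (zeta p v - zeta p u) <= 2 * r * (v - u).
  move=> uv; have -> : zeta p v - zeta p u = (expR p)%:C * (r%:C * (cis v - cis u)).
    by rewrite /zeta /s; ring.
  rewrite nrM nr_real ger0_norm ?expR_ge0 // nrM nr_real (gtr0_norm r0).
  apply: (@le_trans _ _ (1 * (r * nr (cis v - cis u)))).
    rewrite ler_wpM2r ?mulr_ge0 ?nr_ge0 ?(ltW r0) // -expR0 ler_expR.
    by move: hp => /andP[_ /le_trans]; apply.
  rewrite mul1r -mulrA mulrCA ler_pM2l // -cint_icis //.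
  rewrite -[2 * (v - u)]/(2 * (v - u)) -[2 in leRHS]mulr1.
  apply: cint_bound => //.
    by move=> y' _; apply: cvgM; [exact: cvg_cst|exact: continuous_cis].
  move=> y' _; rewrite nrM nr_cis mulr1.
  by rewrite nr_def /= expr0n expr1n add0r sqrtr1.
have zx' : nr (zeta x y - zeta p y) <= 4 * r * (x2 - x1).
  case: (leP p x) => [px|/ltW xp].
    apply: le_trans (zx _ _ px _) _; first by lra.
    by rewrite ler_pM2l ?mulr_gt0 //; lra.
  rewrite nrBC; apply: le_trans (zx _ _ xp _) _; first by lra.
  by rewrite ler_pM2l ?mulr_gt0 //; lra.
have zy' : nr (zeta p y - zeta p q) <= 2 * r * (y2 - y1).
  case: (leP q y) => [px|/ltW xp].
    by apply: le_trans (zy _ _ px) _; rewrite ler_pM2l ?mulr_gt0 //; lra.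
  by rewrite nrBC; apply: le_trans (zy _ _ xp) _; rewrite ler_pM2l ?mulr_gt0 //; lra.
apply: le_trans (nr_subD _ _ (zeta p y)) _; apply: le_trans (lerD zx' zy') _.
have : 0 <= r * (y2 - y1) by rewrite mulr_ge0 ?(ltW r0) //; lra.
by lra.
Qed.

(** The affine part of [f] at [zeta p q] drops out of [bd], and the remainder [er] is [eps] times
    the diameter, integrated over sides of comparable length. *)
Let bd_local p q x0 y1' y2' : x0 <= p <= 0 -> y1' <= q <= y2' -> forall e, 0 < e ->
  exists2 dl : R, 0 < dl & forall x1 x2 y1 y2,
    x0 <= x1 -> x1 <= p -> p <= x2 -> x2 <= 0 ->
    y1' <= y1 -> y1 <= q -> q <= y2 -> y2 <= y2' ->
    x2 - x1 < dl -> y2 - y1 < dl ->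
    nr (bd f x1 x2 y1 y2) <= e * (x2 - x1 + (y2 - y1)) ^+ 2.
Proof.
move=> /andP[_ p0] _ e e0.
(* The four sides add up to [4 * B * (1 + K) * w] with [B = eps * (4 * r * w)]. *)
pose eps := e / (16 * r * (1 + K)).
have D0 : 0 < 16 * r * (1 + K) by rewrite !mulr_gt0 // ltr_wpDl.
have eps0 : 0 < eps by rewrite divr_gt0.
pose z0 := zeta p q.
have [d d0 hd] := diff_nr (df (nr_zeta q p0)) eps0.
exists (d / (8 * r)); first by rewrite divr_gt0 // mulr_gt0.
move=> x1 x2 y1 y2 _ x1p px2 x20 _ y1q qy2 _ hx hy.
have x12 : x1 <= x2 by lra.
have y12 : y1 <= y2 by lra.
have x10 : x1 <= 0 by lra.
set w := x2 - x1 + (y2 - y1).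
have w0 : 0 <= w by rewrite /w; lra.
have wx : x2 - x1 <= w by rewrite /w lerDl subr_ge0.
have wy : y2 - y1 <= w by rewrite /w lerDr subr_ge0.
have wd : 4 * r * w < d.
  have : w < d / (4 * r).
    have E : d / (4 * r) = d / (8 * r) + d / (8 * r) by field; rewrite gt_eqF.
    by rewrite E; apply: ltrD.
  by rewrite ltr_pdivlMr ?mulr_gt0 // mulrC.
pose be : C := 'd f z0 1.
pose al : C := f z0 - be * (z0 - t).
pose aff z : C := al + be * (z - t).
pose er z : C := f z - aff z.
have E z : f z = aff z + er z by rewrite /er addrC subrK.
have her x y : x1 <= x <= x2 -> y1 <= y <= y2 ->
    nr (er (zeta x y)) <= eps * (4 * r * w).
  move=> hx' hy'.
  have l := @lip x1 x2 y1 y2 p q x y ltac:(by rewrite x1p px2) hx' x20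
    ltac:(by rewrite y1q qy2) hy'.
  have := hd (zeta x y - z0) (le_lt_trans l wd).
  have Ez : z0 + (zeta x y - z0) = zeta x y by rewrite addrC subrK.
  rewrite -/z0 Ez diffC_mul -/be => h.
  have -> : er (zeta x y) = f (zeta x y) - f z0 - (zeta x y - z0) * be.
    by rewrite /er /aff /al; ring.
  by apply: le_trans h _; rewrite ler_pM2l.
have caff_x y : cont_on (fun x => aff (zeta x y)) x1 x2.
  move=> x _; apply: cvgD; first exact: cvg_cst.
  apply: cvgM; first exact: cvg_cst.
  by apply: cvgB; [exact: cont_zx|exact: cvg_cst].
have caff_y x : cont_on (fun y => aff (zeta x y)) y1 y2.
  move=> y _; apply: cvgD; first exact: cvg_cst.
  apply: cvgM; first exact: cvg_cst.
  by apply: cvgB; [exact: cont_zy|exact: cvg_cst].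
have cer_x y : cont_on (fun x => er (zeta x y)) x1 x2.
  exact: (cont_onB (cont_fx (y:=y) x20) (caff_x y)).
have ck : cont_on kap y1 y2 by move=> y _; exact: cont_kap.
have cer_y x : x <= 0 -> cont_on (fun y => er (zeta x y) * kap y) y1 y2.
  move=> hx'; exact: (cont_onM (cont_onB (cont_fy (y1:=y1) (y2:=y2) hx') (caff_y x)) ck).
have intx y : cint (fun x => f (zeta x y)) x1 x2 =
    al * (x2 - x1)%:C + be * (zeta x2 y - zeta x1 y) + cint (fun x => er (zeta x y)) x1 x2.
  have c3 : cont_on (fun x => zeta x y - t) x1 x2.
    by move=> x _; apply: cvgB; [exact: cont_zx|exact: cvg_cst].
  have c1 : cont_on (fun=> al) x1 x2 by exact: cont_on_cst.
  have c2 : cont_on (fun x => be * (zeta x y - t)) x1 x2.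
    by apply: cont_onM c3; exact: cont_on_cst.
  transitivity (cint (fun x => aff (zeta x y) + er (zeta x y)) x1 x2).
    by apply: eq_cint => x _; exact: E.
  rewrite (cintD (caff_x y) (cer_x y)); congr (_ + _).
  transitivity (cint (fun=> al) x1 x2 + cint (fun x => be * (zeta x y - t)) x1 x2).
    exact: (cintD c1 c2).
  by rewrite (cint_cst _ x12) (cintZ _ c3) (zeta_x y x12).
have inty x : x <= 0 -> cint (fun y => f (zeta x y) * kap y) y1 y2 =
    al * cint kap y1 y2 + be * (zeta x y2 - zeta x y1) +
    cint (fun y => er (zeta x y) * kap y) y1 y2.
  move=> x_0.
  have c1 : cont_on (fun y => (zeta x y - t) * kap y) y1 y2.
    apply: cont_onM ck => y _.
    by apply: cvgB; [exact: cont_zy|exact: cvg_cst].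
  have c2 : cont_on (fun y => al * kap y) y1 y2.
    by apply: cont_onM ck; exact: cont_on_cst.
  have c3 : cont_on (fun y => be * ((zeta x y - t) * kap y)) y1 y2.
    by apply: cont_onM c1; exact: cont_on_cst.
  have c4 := cont_onD c2 c3.
  transitivity (cint (fun y => (al * kap y + be * ((zeta x y - t) * kap y))
                               + er (zeta x y) * kap y) y1 y2).
    by apply: eq_cint => y _; rewrite E /aff mulrDl mulrDl !mulrA.
  rewrite (cintD c4 (cer_y x x_0)) (cintD c2 c3); congr (_ + _).
  by rewrite (cintZ _ ck) (cintZ _ c1) (zeta_y x y12).
have -> : bd f x1 x2 y1 y2 = bd er x1 x2 y1 y2.
  by rewrite /bd (intx y1) (intx y2) (inty x1 x10) (inty x2 x20); cint_ring.
pose B := eps * (4 * r * w).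
have B0 : 0 <= B by rewrite mulr_ge0 ?(ltW eps0) // mulr_ge0 // mulr_ge0 // ltW.
have b1 y : y1 <= y <= y2 -> nr (cint (fun x => er (zeta x y)) x1 x2) <= 2 * B * w.
  move=> hy'; apply: (@le_trans _ _ (2 * B * (x2 - x1))).
    by apply: cint_bound => // x hx'; exact: her.
  by apply: ler_wpM2l wx; rewrite mulr_ge0.
have b2 x : x1 <= x <= x2 ->
    nr (cint (fun y => er (zeta x y) * kap y) y1 y2) <= 2 * (B * K) * w.
  move=> hx'; apply: (@le_trans _ _ (2 * (B * K) * (y2 - y1))).
    apply: cint_bound.
    - exact: y12.
    - by apply: cer_y; case/andP: hx' => _ /le_trans; apply.
    - by move=> y hy'; rewrite nrM; apply: ler_pM (nr_ge0 _) (nr_ge0 _) _ (nr_kap y); exact: her.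
  apply: ler_wpM2l wy; apply: mulr_ge0 => //; apply: mulr_ge0 B0 _; exact: ltW.
apply: (@le_trans _ _ (2 * B * w + 2 * (B * K) * w + 2 * B * w + 2 * (B * K) * w)).
  have h1 := b1 y1 (introT andP (conj (lexx _) y12)).
  have h2 := b2 x2 (introT andP (conj x12 (lexx _))).
  have h3 := b1 y2 (introT andP (conj y12 (lexx _))).
  have h4 := b2 x1 (introT andP (conj (lexx _) x12)).
  apply: le_trans (nrB _ _) (lerD _ h4).
  apply: le_trans (nrB _ _) (lerD _ h3).
  exact: le_trans (nrD _ _) (lerD h1 h2).
rewrite /B /eps le_eqVlt; apply/orP; left; apply/eqP; field.
by rewrite !gt_eqF //= ltr_wpDl.
Qed.

(** Around the rectangle between [x] and 0 the horizontal sides cancel by periodicity, so the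
    integral over [zeta x] does not depend on [x]. As [x] tends to minus infinity, [f (zeta x y)]
    tends to [f t] uniformly in [y]. The integral of [kap] is left unevaluated here. *)
Lemma homotopy_invariance :
  cint (fun y => f (s y) * kap y) 0 T = f t * cint kap 0 T.
Proof.
have key x : x <= 0 -> cint (fun y => f (zeta x y) * kap y) 0 T =
    cint (fun y => f (s y) * kap y) 0 T.
  move=> x0.
  have : bd f x 0 0 T = 0.
    apply: bisection_zero => //; first exact: pi2_ge0.
    - by move=> x1 x2 y1 y2 _ x12 x20 _ y12 _; apply: bd_split.
    - by move=> p q hp hq e e0; apply: bd_local.
  rewrite /bd.
  have -> : cint (fun x' => f (zeta x' T)) x 0 = cint (fun x' => f (zeta x' 0)) x 0.
    by apply: eq_cint => x' _; rewrite /zeta /s cis2pi.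
  rewrite addrAC -addrA [X in _ + X]addrC addrA addrAC addrC => h.
  have {}h : cint (fun y : R => f (zeta 0 y) * kap y) 0 T
            - cint (fun y : R => f (zeta x y) * kap y) 0 T = 0.
    by rewrite -h; cint_ring.
  move/eqP: h; rewrite subr_eq0 => /eqP <-.
  by apply: eq_cint => y _; rewrite /zeta expR0 mul1r addrC subrK.
apply/eqP; rewrite -subr_eq0 -nr_eq0 eq_le nr_ge0 andbT.
apply/ler_addgt0Pr => e e0; rewrite add0r.
have ft : {for t, continuous f} by apply: differentiable_continuous; apply: df; exact: ltW.
pose e' := e / (2 * K * (T + 1)).
have T1 : 0 < T + 1 by apply: ltr_wpDl pi2_ge0 _; exact: ltr01.
have D0 : 0 < 2 * K * (T + 1) by apply: mulr_gt0 T1; exact: mulr_gt0.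
have e'0 : 0 < e' by rewrite divr_gt0.
have /nbhs_nrP[d d0 hd] : nbhs t [set z | nr (f z - f t) < e'].
  by move/cvg_nrP: ft => /(_ e' e'0).
(* Makes [expR x * (2 * r) <= d / 2], hence [zeta x y] closer to [t] than [d]. *)
pose x := Num.min 0 (ln (d / (4 * r))).
have dr0 : 0 < d / (4 * r) by rewrite divr_gt0 // mulr_gt0.
have x0 : x <= 0 by rewrite ge_min lexx.
have ex : expR x <= d / (4 * r).
  by rewrite -[leRHS]lnK ?posrE // ler_expR ge_min lexx orbT.
rewrite -(key x x0).
have ck : cont_on kap 0 T by move=> y _; exact: cont_kap.
have cf : cont_on (fun y => f t * kap y) 0 T.
  by apply: cont_onM ck; exact: cont_on_cst.
have cfk := cont_fk (y1:=0) (y2:=T) x0.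
rewrite -(cintZ (f t) ck) -(cintB cfk cf).
apply: (@le_trans _ _ (2 * (e' * K) * (T - 0))).
  apply: cint_bound; [exact: pi2_ge0|exact: (cont_onB cfk cf)|].
  move=> y _; rewrite -mulrBl nrM ler_pM ?nr_ge0 //; apply/ltW/hd.
  rewrite /zeta addrC addKr nrM nr_real ger0_norm ?expR_ge0 //.
  apply: (@le_lt_trans _ _ (d / (4 * r) * (2 * r))).
    apply: ler_pM; rewrite ?expR_ge0 ?nr_ge0 //.
    by apply: le_trans (nrB _ _) _; rewrite nr_s mulr_natl mulr2n lerD2l ltW.
  have -> : d / (4 * r) * (2 * r) = d / 2 by field; rewrite gt_eqF.
  by lra.
rewrite subr0 /e'.
have aux (u v w : R) : v != 0 -> w + 1 != 0 ->
    2 * (u / (2 * v * (w + 1)) * v) * w = u * (w / (w + 1)).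
  by move=> v0 w0; field; apply/andP; split.
rewrite (aux e K T (lt0r_neq0 K0) (lt0r_neq0 T1)).
by apply: ler_piMr (ltW e0) _; rewrite ler_pdivrMr // mul1r lerDl.
Qed.

End Homotopy.

(** For [t = 0] the weight [kap] is the constant ['i]. *)
Lemma mean_value f (r : R) : 0 < r ->
  (forall z, nr z <= r -> differentiable f z) ->
  cint (fun y => f (r%:C * cis y)) 0 T = f 0 * T%:C.
Proof.
move=> r0 df.
have cf : cont_on (fun y => f (r%:C * cis y)) 0 T.
  move=> y _; apply: (@cvg_diff_comp f (fun y => r%:C * cis y)).
    by apply: cvgM; [exact: cvg_cst|exact: continuous_cis].
  by apply: df; rewrite nrM nr_cis nr_real mulr1 gtr0_norm.
have i0 : ('i%C : C) != 0 by rewrite -nr_gt0 nr_def /= expr0n expr1n add0r sqrtr1.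
have h := @homotopy_invariance f r 0 r0 df ltac:(by rewrite nr0).
have E y : 'i%C * (r%:C * cis y) / (r%:C * cis y - 0) = 'i%C :> C.
  have rc0 : r%:C * cis y != 0 :> C by rewrite -nr_gt0 nrM nr_cis nr_real mulr1 gtr0_norm.
  by rewrite subr0 mulfK.
apply: (mulfI i0); rewrite -cintZ //.
transitivity (cint (fun y => f (r%:C * cis y) * ('i%C * (r%:C * cis y) / (r%:C * cis y - 0))) 0 T).
  by apply: eq_cint => y _; rewrite E mulrC.
rewrite h (@eq_cint _ _ (fun=> 'i%C)) // cint_cst ?pi2_ge0 // subr0; exact: mulrCA.
Qed.

(** Homotopy invariance leaves the integral of [s / (s - t)]. On the circle the conjugate of [s] is
    [r ^+ 2 / s], so this function is the conjugate of [u (s y)], where [u] is holomorphic on the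
    closed disc and [u 0 = 1]; the mean value property evaluates it. *)
Lemma cauchy_formula f (r : R) (t : C) : 0 < r ->
  (forall z, nr z <= r -> differentiable f z) -> nr t < r ->
  cint (fun y => f (r%:C * cis y) * (r%:C * cis y / (r%:C * cis y - t))) 0 T = f t * T%:C.
Proof.
move=> r0 df tr.
set s := fun y => r%:C * cis y : C.
have nr_s y : nr (s y) = r by rewrite nrM nr_cis nr_real mulr1 gtr0_norm.
have st0 y : s y - t != 0.
  by rewrite -nr_gt0; apply: lt_le_trans (nr_lbB _ _); rewrite subr_gt0 nr_s.
have cs : continuous s by move=> y; apply: cvgM; [exact: cvg_cst|exact: continuous_cis].
have ck : continuous (fun y => s y / (s y - t)).
  move=> y; apply: cvgM; first exact: cs.
  by apply: cvgV => //; apply: cvgB; [exact: cs|exact: cvg_cst].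
have cfs : cont_on (fun y => f (s y)) 0 T.
  by move=> y _; apply: cvg_diff_comp; [exact: cs|apply: df; rewrite nr_s].
have i0 : ('i%C : C) != 0 by rewrite -nr_gt0 nr_def /= expr0n expr1n add0r sqrtr1.
have h := @homotopy_invariance f r t r0 df tr.
have main : cint (fun y => f (s y) * (s y / (s y - t))) 0 T =
    f t * cint (fun y => s y / (s y - t)) 0 T.
  have c1 : cont_on (fun y => s y / (s y - t)) 0 T by move=> y _; exact: ck.
  have c2 := cont_onM cfs c1.
  apply: (mulfI i0); rewrite mulrCA -(cintZ _ c1) -(cintZ _ c2).
  transitivity (cint (fun y => f (s y) * ('i%C * s y / (s y - t))) 0 T).
    by apply: eq_cint => y _; rewrite mulrCA -[in RHS]mulrA.
  transitivity (f t * cint (fun y => 'i%C * s y / (s y - t)) 0 T); first exact: h.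
  by congr (_ * _); apply: eq_cint => y _; rewrite mulrA.
rewrite main; congr (_ * _).
pose u (z : C) : C := (1 - t^* / (r ^+ 2)%:C * z)^-1.
have r2 : (r ^+ 2)%:C != 0 :> C by rewrite -nr_gt0 nr_real normr_gt0 expf_neq0 // gt_eqF.
have nt := nrJ t.
have u1 z : nr z <= r -> 1 - t^* / (r ^+ 2)%:C * z != 0.
  move=> zr; rewrite -nr_gt0; apply: lt_le_trans (nr_lbB _ _).
  rewrite nr1 subr_gt0 !nrM nrV nr_real nt (ger0_norm (sqr_ge0 r)).
  rewrite mulrAC ltr_pdivrMr ?exprn_gt0 // mul1r expr2.
  apply: (@le_lt_trans _ _ (nr t * r)); first by rewrite ler_wpM2l ?nr_ge0.
  by rewrite ltr_pM2r.
have du z : nr z <= r -> differentiable u z.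
  move=> zr; apply: differentiableV; last exact: u1.
  apply: differentiableB; first exact: differentiable_cst.
  by apply: differentiableM; [exact: differentiable_cst|exact: (@ex_diff _ _ _ _ _ _ _ (is_diff_id z))].
have hu := mean_value r0 du.
have sN0 y : s y != 0 by rewrite -nr_gt0 nr_s.
have E y : s y / (s y - t) = (u (s y))^*.
  have sJ : (s y)^* = (r ^+ 2)%:C / s y.
    apply: (mulIf (sN0 y)); rewrite divfK //; apply: Cplx_eq.
      rewrite CReM /=; have := cos2Dsin2 y; nra.
    by rewrite CImM /=; ring.
  have J (a b c : C) : ((1 - a / b * c)^-1)^* = (1 - a^* / b^* * c^*)^-1 :> C.
    by rewrite fmorphV rmorphB rmorph1 !rmorphM fmorphV.
  have sJ1 : Num.conj (s y) = (r ^+ 2)%:C / s y := sJ.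
  rewrite /u J conjCK sJ1.
  have -> : Num.conj ((r ^+ 2)%:C : C) = (r ^+ 2)%:C by apply: Cplx_eq => //=; rewrite oppr0.
  have aux (a b q : C) : a != 0 -> q != 0 -> a / (a - b) = (1 - b / q * (q / a))^-1.
    move=> a0 q0; rewrite mulrA divfK // -[1](divff a0) -mulrBl invfM invrK mulrC.
    by [].
  exact: aux.
transitivity ((cint (fun y => u (s y)) 0 T)^*).
  rewrite -cint_conj; first by apply: eq_cint => y _; exact: E.
  by move=> y _; apply: cvg_diff_comp; [exact: cs|apply: du; rewrite nr_s].
rewrite hu /u mulr0 subr0 invr1 mul1r; apply: Cplx_eq => //=.
by rewrite oppr0.
Qed.

End CauchyFormula.

(** * Taylor expansion with explicit remainder *)

Section Taylor.
Variable R : realType.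
Local Notation C := (Cplx R).
Local Notation T := (pi *+ 2 : R).
Implicit Types (u : C -> C).

Lemma T_neq0 : T%:C != 0 :> C.
Proof. by rewrite -nr_gt0 nr_real normr_gt0 gt_eqF // pmulrn_lgt0 ?pi_gt0. Qed.

(** The kernel [s / (s - t)] is expanded as a finite geometric sum, whose remainder is
    [(t / s) ^+ K * (s / (s - t))]. For [nr t <= r / 2] the last factor is at most 2; with the 2 of
    [cint_bound] this gives [4 * M]. The coefficients do not depend on [K]. *)
Lemma cauchy_taylor u (r M : R) : 0 < r ->
  (forall z, nr z <= r -> differentiable u z) ->
  (forall z, nr z <= r -> nr (u z) <= M) ->
  exists c : nat -> C, forall K (t : C), nr t <= r / 2 ->
    nr (u t - \sum_(k < K) c k * t ^+ k) <= 4 * M * (nr t / r) ^+ K.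
Proof.
move=> r0 du uM.
pose s y : C := r%:C * cis y.
have nr_s y : nr (s y) = r by rewrite nrM nr_cis nr_real mulr1 gtr0_norm.
have s0 y : s y != 0 by rewrite -nr_gt0 nr_s.
have cs : continuous s by move=> y; apply: cvgM; [exact: cvg_cst|exact: continuous_cis].
have cu : cont_on (fun y => u (s y)) 0 T.
  by move=> y _; apply: cvg_diff_comp; [exact: cs|apply: du; rewrite nr_s].
have cX (t : C) K : cont_on (fun y => (t / s y) ^+ K) 0 T.
  elim: K => [|K IH].
    by move=> y _; apply: cvg_cst.
  have h : cont_on (fun y => t / s y) 0 T.
    move=> y _; apply: cvgM; first exact: cvg_cst.
    by apply: cvgV; [exact: s0|exact: cs].
  have -> : (fun y => (t / s y) ^+ K.+1) = (fun y => (t / s y) * (t / s y) ^+ K).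
    by apply/funext => y; rewrite exprS.
  exact: cont_onM.
pose c k : C := cint (fun y => u (s y) * (1 / s y) ^+ k) 0 T / T%:C.
have st0 (t : C) y : nr t <= r / 2 -> s y - t != 0.
  move=> tr; rewrite -nr_gt0; apply: lt_le_trans (nr_lbB _ _); rewrite subr_gt0 nr_s.
  by apply: le_lt_trans tr _; lra.
have ck (t : C) : nr t <= r / 2 -> cont_on (fun y => s y / (s y - t)) 0 T.
  move=> tr y _; apply: cvgM; first exact: cs.
  by apply: cvgV; [exact: st0|apply: cvgB; [exact: cs|exact: cvg_cst]].
pose rem K (t : C) y : C := u (s y) * ((t / s y) ^+ K * (s y / (s y - t))).
have crem K (t : C) : nr t <= r / 2 -> cont_on (rem K t) 0 T.
  move=> tr; exact: (cont_onM cu (cont_onM (cX t K) (ck t tr))).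
have remE K (t : C) : nr t <= r / 2 ->
    u t - \sum_(k < K) c k * t ^+ k = cint (rem K t) 0 T / T%:C.
  move=> tr; elim: K => [|K IH].
    rewrite big_ord0 subr0 -[LHS](mulfK T_neq0); congr (_ / _).
    rewrite -(cauchy_formula r0 du); last by apply: le_lt_trans tr _; lra.
    by apply: eq_cint => y _; rewrite /rem expr0 mul1r.
  rewrite big_ord_recr /= opprD addrA IH /c.
  have c1 := cont_onM cu (cX t K).
  have -> : cint (rem K t) 0 T = cint (fun y => u (s y) * (t / s y) ^+ K) 0 T
                                + cint (rem K.+1 t) 0 T.
    rewrite -(cintD c1 (crem K.+1 t tr)); apply: eq_cint => y _.
    rewrite /rem -mulrDr; congr (_ * _); rewrite exprSr -mulrA.
    rewrite -[in RHS](mulr1 (_ ^+ K)) -mulrA -mulrDr; congr (_ * _).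
    have aux (a b : C) : a != 0 -> a - b != 0 -> a / (a - b) = 1 + b / a * (a / (a - b)).
      by move=> a0 ab0; field; rewrite ab0 a0.
    by rewrite mul1r; apply: aux; [exact: s0|exact: st0].
  have -> : cint (fun y => u (s y) * (t / s y) ^+ K) 0 T =
      t ^+ K * cint (fun y => u (s y) * (1 / s y) ^+ K) 0 T.
    rewrite -(cintZ _ (cont_onM cu (cX 1 K))); apply: eq_cint => y _.
    by rewrite [RHS]mulrCA -exprMn mul1r.
  by rewrite mulrDl addrAC -mulrA [t ^+ K * _]mulrC subrr add0r.
exists c => K t tr; rewrite remE // nrM nrV nr_real ger0_norm ?pi2_ge0 //.
have T0 : 0 < T by rewrite pmulrn_lgt0 ?pi_gt0.
rewrite ler_pdivrMr //.
have M0 : 0 <= M by apply: le_trans (nr_ge0 (u 0)) (uM _ _); rewrite nr0 ltW.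
apply: (@le_trans _ _ (2 * (M * ((nr t / r) ^+ K * 2)) * (T - 0))).
  apply: cint_bound; [exact: pi2_ge0|exact: crem|] => y _.
  rewrite /rem nrM; apply: ler_pM; rewrite ?nr_ge0 //.
    by apply: uM; rewrite nr_s.
  rewrite nrM nrX nrM nrV nr_s; apply: ler_wpM2l.
    by rewrite exprn_ge0 // divr_ge0 ?nr_ge0 // ltW.
  rewrite nrM nrV nr_s ler_pdivrMr ?nr_gt0 ?st0 //.
  have := nr_lbB (s y) t; rewrite nr_s; lra.
rewrite subr0 le_eqVlt; apply/orP; left; apply/eqP; ring.
Qed.

Lemma le_geometric0 (x B q : R) : 0 <= q <= 1 / 2 ->
  (forall k, x <= B * q ^+ k) -> x <= 0.
Proof.
move=> /andP[q0 q1] h; apply/ler_addgt0Pr => e e0; rewrite add0r.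
apply: le_trans (h (Num.bound (`|B| / e))) _; set k := Num.bound _.
have hk : `|B| / e < 2 ^+ k.
  apply: lt_trans (archi_boundP (divr_ge0 (normr_ge0 _) (ltW e0))) _.
  by rewrite -natrX ltr_nat ltn_expl.
have qk : q ^+ k <= (2 ^+ k)^-1.
  by rewrite -exprVn; apply: lerXn2r; rewrite ?nnegrE ?invr_ge0 //; lra.
apply: (@le_trans _ _ (`|B| * (2 ^+ k)^-1)).
  apply: (@le_trans _ _ (`|B| * q ^+ k)); first by rewrite ler_wpM2r ?exprn_ge0 // ler_norm.
  by rewrite ler_wpM2l.
rewrite ler_pdivrMr ?exprn_gt0 // mulrC -ler_pdivrMr //; exact: ltW.
Qed.
End Taylor.

(** * Holomorphic division *)

Section ZeroOrder.
Variable R : realType.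
Local Notation C := (Cplx R).
Local Notation T := (pi *+ 2 : R).
Implicit Types (u : C -> C).

Lemma differentiable_quad_lin (V : normedModType C) (f : V -> C) (x : V)
    (L : V -> C) (B M d : R) : linear L -> 0 < d ->
  (forall h, nr (L h) <= B * nr h) ->
  (forall h, nr h < d -> nr (f (x + h) - f x - L h) <= M * nr h ^+ 2) ->
  differentiable f x /\ ('d f x = L :> (V -> C)).
Proof.
move=> lL d0 hB hM.
pose L' : {linear V -> C} := HB.pack L (GRing.isLinear.Build _ _ _ _ L lL).
exact: (@differentiable_quad _ _ f x L' B M d).
Qed.

Lemma differentiable_near_eq (V : normedModType C) (f g : V -> C) (x : V) :
  (\forall y \near x, f y = g y) -> differentiable f x -> differentiable g x.
Proof.
move=> fg df.
have fgx : f x = g x := nbhs_singleton fg.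
have /diff_locallyP[dc /eqaddoP h] := df.
have hL : g \o shift x = cst (g x) + 'd f x +o_ 0 id.
  apply/eqaddoP => e e0; have := h e e0.
  have /nbhs_nrP[d d0 hd] := fg.
  have : \forall k \near (0 : V), f (k + x) = g (k + x).
    apply/nbhs_nrP; exists d => // k; rewrite subr0 => kd.
    by apply: hd; rewrite addrK.
  apply: filterS2 => k E; rewrite -fgx.
  have -> : ((f \o shift x) - (cst (f x) + 'd f x)) k =
      ((g \o shift x) - (cst (f x) + 'd f x)) k; last by [].
  transitivity (f (k + x) - (f x + 'd f x k)) => //.
  by rewrite E.
have dE : 'd g x = 'd f x :> (V -> C) by apply: diff_unique.
by apply/diff_locallyP; split; rewrite dE.
Qed.

Lemma differentiable_line (V : normedModType C) (x k : V) (t : C) :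
  differentiable (fun s : C => x + s *: k) t /\
  forall a : C, 'd (fun s : C => x + s *: k) t a = a *: k.
Proof.
have d1 : is_diff t (cst x : C -> V) 0 := is_diff_cst x t.
have d2 : is_diff t (fun s : C => s *: k) (fun s : C => s *: k) := is_diff_scalel t k.
have d3 := is_diffD d1 d2.
split; first exact: (@ex_diff _ _ _ _ _ _ _ d3).
move=> a; have := @diff_val _ _ _ _ _ _ _ d3.
by move=> /(congr1 (fun g : C -> V => g a)) -> /=; rewrite add0r.
Qed.

Lemma differentiable_shift (f : C -> C) (p z : C) :
  differentiable f (p + z) -> differentiable (fun w => f (p + w)) z.
Proof.
move=> df; have [h _] := @differentiable_line C p (1 : C) z.
have -> : (fun w => f (p + w)) = f \o (fun s : C => p + s *: (1 : C^o)).
  by apply/funext => w /=; rewrite /GRing.scale /= mulr1.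
apply: differentiable_comp h _.
by rewrite /GRing.scale /= mulr1.
Qed.

Section Factor.
Variables (u : C -> C) (r M : R) (c : nat -> C).
Hypothesis r0 : 0 < r.
Hypothesis hc : forall K (t : C), nr t <= r / 2 ->
  nr (u t - \sum_(k < K) c k * t ^+ k) <= 4 * M * (nr t / r) ^+ K.

(** Off 0 the factor is [u t / t ^+ m]. Dividing the remainder of order [m + 2] by [t ^+ m] leaves a
    quadratic error, so [v] has derivative [c m.+1] at 0. *)
Lemma taylor_factor m : (forall k, (k < m)%N -> c k = 0) ->
  exists v : C -> C, [/\ differentiable v 0, v 0 = c m & forall t, u t = t ^+ m * v t].
Proof.
move=> cm.
have sm K (t : C) : \sum_(k < m + K) c k * t ^+ k =
    t ^+ m * \sum_(k < K) c (m + k)%N * t ^+ k.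
  rewrite big_split_ord /= big1 ?add0r; last by move=> i _; rewrite cm ?mul0r.
  by rewrite big_distrr /=; apply: eq_bigr => i _; rewrite exprD mulrCA.
pose v (t : C) : C := if t == 0 then c m else u t / t ^+ m.
have v0 : v 0 = c m by rewrite /v eqxx.
have uv t : u t = t ^+ m * v t.
  rewrite /v; case: eqP => [->|/eqP t0]; last by rewrite mulrC divfK // expf_neq0.
  have := hc (m + 1)%N (t := 0); rewrite nr0 mul0r expr0n addn1 /= mulr0 => /(_ _).
  move=> /(_ (divr_ge0 (ltW r0) (ler0n _ 2))) h.
  have {h} : nr (u 0 - \sum_(k < (m + 1)%N) c k * 0 ^+ k) == 0.
    by rewrite addn1 eq_le h nr_ge0.
  rewrite nr_eq0 subr_eq0 => /eqP ->.
  by rewrite sm big_ord1 addn0 expr0 mulr1.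
exists v; split=> //.
pose a := c m.+1.
have lin : linear (fun h : C => h * a).
  by move=> k x y; rewrite mulrDl /GRing.scale /= mulrA.
have [|h||//] := @differentiable_quad_lin C v 0 (fun h => h * a) (nr a)
    (4 * M / r ^+ (m + 2)) (r / 2) lin.
- by rewrite divr_gt0.
- by rewrite nrM mulrC.
move=> h hr; rewrite add0r v0.
have [->|h0] := eqVneq h 0.
  by rewrite v0 subrr sub0r mul0r oppr0 nr0 expr0n mulr0.
have := hc (m + 2)%N (t := h) (ltW hr).
rewrite sm 2!big_ord_recr big_ord0 /= add0r addn0 addn1 expr0 mulr1 expr1.
rewrite uv -mulrBr nrM nrX opprD addrA [_ * h]mulrC -/a [h * a]mulrC.
have hm : 0 < nr h ^+ m by rewrite exprn_gt0 // nr_gt0.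
move=> hx; rewrite -(ler_pM2l hm); apply: le_trans hx _.
rewrite le_eqVlt; apply/orP; left; apply/eqP.
by rewrite expr_div_n exprD; ring.
Qed.

(** Once the coefficients below [k] vanish, [u t = t ^+ k * v t] with [v 0 = c k], and the growth
    bound with [k < m] forces [v] to tend to 0. *)
Lemma taylor_coef0 m (B e : R) : 0 < e ->
  (forall t, nr t < e -> nr (u t) <= B * nr t ^+ m) ->
  forall k, (k < m)%N -> c k = 0.
Proof.
move=> e0 hB; elim/ltn_ind => k IH km.
have [v [dv v0 uv]] : exists v : C -> C,
    [/\ differentiable v 0, v 0 = c k & forall t, u t = t ^+ k * v t].
  by apply: taylor_factor => j jk; apply: IH => //; exact: ltn_trans jk km.
apply/eqP; rewrite -nr_eq0 -v0 eq_le nr_ge0 andbT; apply/ler_addgt0Pr => d d0.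
rewrite add0r.
have d2 : 0 < d / 2 by rewrite divr_gt0.
have /nbhs_nrP[d1 d10 hd1] : nbhs (0 : C) [set z | nr (v z - v 0) < d / 2].
  by have /cvg_nrP := differentiable_continuous dv; apply.
(* A real test point: powers of [q] stay below 1, both hypotheses apply at [q], and
   [|B| * q <= d / 2]. *)
pose q := Num.min (Num.min 1 (e / 2)) (Num.min (d1 / 2) (d / (2 * (`|B| + 1)))).
have B1 : 0 < `|B| + 1 by rewrite ltr_wpDl.
have q0 : 0 < q by rewrite !lt_min ltr01 !divr_gt0 // mulr_gt0.
have /andP[/andP[q1 qe] /andP[qd1 qd]] :
    ((q <= 1) && (q <= e / 2)) && ((q <= d1 / 2) && (q <= d / (2 * (`|B| + 1)))).
  by rewrite -!le_min.
have nq : nr (q%:C : C) = q by rewrite nr_real gtr0_norm.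
have := hB q%:C; rewrite nq uv nrM nrX nq => /(_ ltac:(lra)).
have -> : q ^+ m = q ^+ k * (q * q ^+ (m - k.+1)).
  by rewrite -exprS -exprD; congr (_ ^+ _); rewrite addnS -addSn subnKC.
rewrite mulrCA ler_pM2l ?exprn_gt0 // => hq.
have hv : nr (v q%:C) <= d / 2.
  apply: le_trans hq _.
  apply: (@le_trans _ _ (`|B| * (q * q ^+ (m - k.+1)))).
    by rewrite ler_wpM2r ?ler_norm // mulr_ge0 ?exprn_ge0 ?(ltW q0).
  apply: (@le_trans _ _ (`|B| * q)).
    by rewrite ler_wpM2l // ler_piMr ?(ltW q0) // exprn_ile1 // ltW.
  move: qd; rewrite ler_pdivlMr ?mulr_gt0 //.
  have := normr_ge0 B; nra.
have /= := hd1 q%:C; rewrite subr0 nq => /(_ ltac:(lra)); rewrite nrBC => h1.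
have := nr_lbB (v 0) (v q%:C); lra.
Qed.

Lemma taylor_zero_or_order : (forall t, nr t <= r / 2 -> u t = 0) \/
  exists m (v : C -> C), [/\ differentiable v 0, v 0 != 0 & forall t, u t = t ^+ m * v t].
Proof.
have [[k ck]|nk] := pselect (exists k, c k != 0).
  right; have ex : exists k, c k != 0 by exists k.
  have [m cm mmin] := ex_minnP ex.
  have [v [dv v0 uv]] : exists v : C -> C,
      [/\ differentiable v 0, v 0 = c m & forall t, u t = t ^+ m * v t].
    apply: taylor_factor => j jm; apply/eqP; apply: contraTT jm => /mmin.
    by rewrite -leqNgt.
  by exists m, v; split=> //; rewrite v0.
left=> t tr; apply/eqP; rewrite -nr_eq0 eq_le nr_ge0 andbT.
apply: (@le_geometric0 _ _ (4 * M) (nr t / r)).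
  rewrite divr_ge0 ?nr_ge0 ?(ltW r0) //= ler_pdivrMr //; lra.
move=> K; have := hc K tr; rewrite big1 ?subr0 // => i _.
suff -> : c i = 0 by rewrite mul0r.
by apply: contrapT => /eqP ci; apply: nk; exists i.
Qed.

End Factor.

(** Write [h t = t ^+ m * v t] with [v 0 != 0]. The bound makes [g] vanish to order at least [m], so
    [g t = t ^+ m * w t] and [psi] is [w / v]. *)
Lemma quotient_removable (g h : C -> C) (r Mg Mh M : R) : 0 < r ->
  (forall z, nr z <= r -> differentiable g z) ->
  (forall z, nr z <= r -> differentiable h z) ->
  (forall z, nr z <= r -> nr (g z) <= Mg) ->
  (forall z, nr z <= r -> nr (h z) <= Mh) ->
  (forall z, nr z <= r -> nr (g z) <= M * nr (h z)) ->
  (exists2 t, nr t <= r / 2 & h t != 0) ->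
  exists (psi : C -> C) (e : R), [/\ 0 < e, differentiable psi 0,
    forall t, 0 < nr t < e -> h t != 0 /\ psi t = g t / h t
    & h 0 != 0 -> psi 0 = g 0 / h 0].
Proof.
move=> r0 dg dh gM hM ghM [t0 t0r ht0].
have [cg hcg] := cauchy_taylor r0 dg gM.
have [ch hch] := cauchy_taylor r0 dh hM.
have [h0|[m [v [dv v0 hv]]]] := taylor_zero_or_order r0 hch.
  by rewrite h0 ?eqxx in ht0.
have v0' : 0 < nr (v 0) / 2 by rewrite divr_gt0 // nr_gt0.
have /nbhs_nrP[d d0 hd] : nbhs (0 : C) [set z | nr (v z - v 0) < nr (v 0) / 2].
  by have /cvg_nrP := differentiable_continuous dv; apply.
pose e := Num.min d r.
have e0 : 0 < e by rewrite lt_min d0.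
have ve z : nr z < e -> nr (v 0) / 2 < nr (v z) /\ nr (v z) <= 2 * nr (v 0).
  rewrite lt_min => /andP[zd _]; have := hd z; rewrite subr0 => /(_ zd) /= h1.
  have h2 := nr_lbB (v 0) (v z); rewrite nrBC in h2.
  by have := nr_lbB (v z) (v 0); split; lra.
have cg0 : forall k, (k < m)%N -> cg k = 0.
  apply: (@taylor_coef0 g r Mg cg r0 hcg m (`|M| * (2 * nr (v 0))) e e0) => t te.
  have tr : nr t <= r by move: te; rewrite lt_min => /andP[_ /ltW].
  apply: le_trans (ghM t tr) _; rewrite hv nrM nrX.
  have [_ h2] := ve t te.
  apply: (@le_trans _ _ (`|M| * (nr t ^+ m * nr (v t)))).
    by rewrite ler_wpM2r ?ler_norm // mulr_ge0 ?exprn_ge0 ?nr_ge0.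
  rewrite -mulrA ler_wpM2l // mulrC ler_wpM2r // exprn_ge0 //; exact: nr_ge0.
have [w [dw w0 gw]] := taylor_factor r0 hcg cg0.
have vn z : nr z < e -> v z != 0.
  by move=> /ve[h1 _]; rewrite -nr_gt0; apply: lt_trans h1.
exists (fun t => w t * (v t)^-1), e; split.
- exact: e0.
- exact: (differentiableM dw (differentiableV dv v0)).
- move=> t /andP[t0' te].
  have tm : t ^+ m != 0 by rewrite expf_neq0 // -nr_gt0.
  rewrite hv gw mulf_neq0 ?vn //; split=> //.
  by rewrite invfM mulrACA divff // mul1r.
- rewrite hv mulf_eq0 negb_or => /andP[tm _].
  by rewrite gw invfM mulrACA divff // mul1r.
Qed.

(* Bounds on the disc of radius 5 rho are only there so that every point of
   the disc of radius rho is the centre of a disc of radius 4 rho. *)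
Lemma quotient_mean_value (g h : C -> C) (rho Mg Mh M : R) : 0 < rho ->
  (forall z, nr z <= 5 * rho -> differentiable g z) ->
  (forall z, nr z <= 5 * rho -> differentiable h z) ->
  (forall z, nr z <= 5 * rho -> nr (g z) <= Mg) ->
  (forall z, nr z <= 5 * rho -> nr (h z) <= Mh) ->
  (forall z, nr z <= 5 * rho -> nr (g z) <= M * nr (h z)) ->
  (forall y, 0 <= y <= T -> h (rho%:C * cis y) != 0) ->
  h 0 != 0 ->
  cint (fun y => g (rho%:C * cis y) / h (rho%:C * cis y)) 0 T = g 0 / h 0 * T%:C.
Proof.
move=> rho0 dg dh gM hM ghM hcirc h00.
have loc (p : C) : nr p <= rho -> exists (psi : C -> C) (e : R),
   [/\ 0 < e, differentiable psi p,
    forall t, 0 < nr (t - p) < e -> h t != 0 /\ psi t = g t / h t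
    & h p != 0 -> psi p = g p / h p].
  move=> pr.
  have nb z : nr z <= 4 * rho -> nr (p + z) <= 5 * rho.
    by move=> zr; apply: le_trans (nrD _ _) _; lra.
  have shift_diff (f : C -> C) z (df : differentiable f (p + z)) :
    differentiable (fun w => f (p + w)) z := differentiable_shift df.
  have [|||||||psi [e [e0 dpsi h1 h2]]] :=
    @quotient_removable (fun z => g (p + z)) (fun z => h (p + z)) (4 * rho) Mg Mh M.
  - by rewrite mulr_gt0.
  - by move=> z /nb /dg; exact: shift_diff.
  - by move=> z /nb /dh; exact: shift_diff.
  - by move=> z /nb /gM.
  - by move=> z /nb /hM.
  - by move=> z /nb /ghM.
  (* A point of the circle lies within [2 * rho] of [p], half of the radius [4 * rho], and [h] is
     nonzero there. *)
  - exists (rho%:C * cis 0 - p); last by rewrite addrC subrK hcirc // lexx pi2_ge0.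
    apply: le_trans (nrB _ _) _; rewrite nrM nr_cis nr_real mulr1 gtr0_norm //; lra.
  exists (fun z => psi (z - p)), e; split.
  - exact: e0.
  - have -> : (fun z => psi (z - p)) = (fun z => psi (- p + z)).
      by apply/funext => z; rewrite addrC.
    by apply: differentiable_shift; rewrite addNr.
  - by move=> t /h1; rewrite [p + _]addrC subrK.
  - by move: h2; rewrite subrr addr0.
have loc' (p : C) : exists a : C, nr p <= rho ->
   differentiable (fun z => if z == p then a else g z / h z) p /\
   (exists2 e : R, 0 < e & forall t, 0 < nr (t - p) < e -> h t != 0) /\
   (h p != 0 -> a = g p / h p).
  have [pr|npr] := boolP (nr p <= rho); last by exists 0.
  have [psi [e [e0 dpsi h1 h2]]] := loc p pr.
  exists (psi p) => _; split; last first.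
    by split; [exists e => // t /h1[]|exact: h2].
  apply: differentiable_near_eq dpsi; apply/nbhs_nrP; exists e => // y ye.
  case: eqP => [->//|/eqP yp].
  by have [] := h1 y; rewrite // nr_gt0 subr_eq0 yp.
have [a ha] := choice loc'.
(* The zeros of [h] in the disc are isolated and filled with the removable values [a]. The resulting
   [phi] is differentiable on the closed disc and equals [g / h] on the circle and at 0. *)
pose phi z := if h z == 0 then a z else g z / h z.
have dphi z : nr z <= rho -> differentiable phi z.
  move=> zr; have [d1 [[e e0 he] hz]] := ha z zr.
  apply: differentiable_near_eq d1; apply/nbhs_nrP; exists e => // y ye.
  rewrite /phi; case: (eqVneq y z) => [->|yz].
    by case: eqP => // /eqP; exact: hz.
  by rewrite (negbTE (he y _)) // nr_gt0 subr_eq0 yz.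
have := mean_value rho0 dphi; rewrite {2}/phi (negbTE h00) => <-.
by apply: eq_cint => y hy; rewrite /phi (negbTE (hcirc y hy)).
Qed.

End ZeroOrder.

(** * Holomorphic functions on normed spaces, along complex lines *)

Section SeveralVariables.
Variable R : realType.
Local Notation C := (Cplx R).
Local Notation T := (pi *+ 2 : R).
Variable V : normedModType C.
Implicit Types (f : V -> C) (x k : V).

Lemma differentiable_comp_line f x k (t : C) : differentiable f (x + t *: k) ->
  differentiable (fun s : C => f (x + s *: k)) t /\
  forall a : C, 'd (fun s : C => f (x + s *: k)) t a = 'd f (x + t *: k) (a *: k).
Proof.
move=> df; have [dl dlE] := differentiable_line x k t.
split; first exact: (differentiable_comp dl df).
move=> a; have := diff_comp dl df.
by move=> /(congr1 (fun g : C -> C => g a)) -> /=; rewrite dlE.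
Qed.

Section Estimates.
Variables (f : V -> C) (x : V) (r M : R).
Hypothesis r0 : 0 < r.
Hypothesis df : forall y, nr (y - x) <= r -> differentiable f y.
Hypothesis fM : forall y, nr (y - x) <= r -> nr (f y) <= M.

Let M0 : 0 <= M.
Proof. by apply: le_trans (nr_ge0 (f x)) (fM _); rewrite subrr nr0 ltW. Qed.

Let line_taylor k : k != 0 -> exists c : nat -> C,
  forall K (t : C), nr (t *: k) <= r / 2 ->
  nr (f (x + t *: k) - \sum_(i < K) c i * t ^+ i) <= 4 * M * (nr (t *: k) / r) ^+ K.
Proof.
move=> k0; have nk : 0 < nr k by rewrite nr_gt0.
have h (z : C) : nr z <= r / nr k -> nr (x + z *: k - x) <= r.
  by rewrite ler_pdivlMr // addrC addKr nrZ.
have du (z : C) : nr z <= r / nr k -> differentiable (fun s : C => f (x + s *: k)) z.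
  by move=> /h /df /differentiable_comp_line[].
have uM (z : C) : nr z <= r / nr k -> nr (f (x + z *: k)) <= M.
  by move=> /h; exact: fM.
have [c hc] := cauchy_taylor (divr_gt0 r0 nk) du uM.
exists c => K t; rewrite nrZ => tr.
have := hc K t; rewrite invfM invrK mulrA.
have -> : (nr t * nr k / r) = nr t / r * nr k by rewrite mulrAC.
apply; rewrite mulrAC ler_pdivlMr //; exact: tr.
Qed.

(** This is the Taylor estimate on the line through [x] in the direction [k]; uniqueness of the
    derivative identifies the linear coefficient with ['d f x k]. *)
Lemma second_order k : nr k <= r / 2 ->
  nr (f (x + k) - f x - 'd f x k) <= 4 * M * (nr k / r) ^+ 2.
Proof.
move=> kr; have [->|k0] := eqVneq k 0.
  by rewrite addr0 subrr linear0 subr0 !nr0 mul0r expr0n mulr0.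
have [c hc] := line_taylor k0.
have c0 : c 0%N = f x.
  have := hc 1%N 0; rewrite scale0r nr0 => /(_ (divr_ge0 (ltW r0) (ler0n _ 2))).
  rewrite big_ord1 expr0 mulr1 addr0 mul0r expr1 mulr0 => h.
  by apply/esym/eqP; rewrite -subr_eq0 -nr_eq0 eq_le h nr_ge0.
have dfx : differentiable f (x + 0 *: k).
  by rewrite scale0r addr0; apply: df; rewrite subrr nr0 ltW.
have [_ d2] := differentiable_comp_line dfx.
have lin : linear (fun h : C => h * c 1%N).
  by move=> a y z; rewrite mulrDl /GRing.scale /= mulrA.
have nk : 0 < nr k by rewrite nr_gt0.
have [|||_ dE] := @differentiable_quad_lin _ C (fun s : C => f (x + s *: k)) 0
    (fun h => h * c 1%N) (nr (c 1%N)) (4 * M * (nr k / r) ^+ 2) (r / 2 / nr k) lin.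
- by rewrite !divr_gt0.
- by move=> h; rewrite nrM mulrC.
- move=> h hr; have /(hc 2%N) : nr (h *: k) <= r / 2.
    by rewrite nrZ -ler_pdivlMr // ltW.
  rewrite 2!big_ord_recr big_ord0 /= add0r expr0 mulr1 expr1 c0 add0r scale0r addr0.
  rewrite opprD addrA [c 1%N * _]mulrC nrZ => /le_trans; apply.
  by rewrite le_eqVlt; apply/orP; left; apply/eqP; ring.
have : 'd f x k = c 1%N.
  have := d2 1; rewrite dE mul1r scale0r addr0 => ->.
  by congr ('d f x _); rewrite scale1r.
move=> ->; have := hc 2%N 1; rewrite scale1r => /(_ kr).
by rewrite 2!big_ord_recr big_ord0 /= add0r expr0 mulr1 expr1 c0 mulr1 opprD addrA.
Qed.

(** On a vector of norm [r / 2] the increment of [f] is at most [2 * M] and the second-order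
    remainder at most [M], so the derivative is at most [3 * M] there. *)
Lemma diff_bound k : nr ('d f x k) <= 6 * M / r * nr k.
Proof.
have [->|k0] := eqVneq k 0; first by rewrite linear0 !nr0 mulr0.
have nk : 0 < nr k by rewrite nr_gt0.
pose a : R := r / 2 / nr k.
have a0 : 0 < a by rewrite !divr_gt0.
have na : nr (a%:C : C) = a by rewrite nr_real gtr0_norm.
have nak : nr (a%:C *: k) = r / 2.
  by rewrite nrZ na /a divfK // gt_eqF.
have h2 := second_order (k := a%:C *: k) ltac:(by rewrite nak).
have f1 : nr (f (x + a%:C *: k)) <= M by apply: fM; rewrite addrC addKr nak; have := r0; lra.
have f0 : nr (f x) <= M by apply: fM; rewrite subrr nr0 ltW.
have q4 : 4 * M * (nr (a%:C *: k) / r) ^+ 2 = M.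
  by rewrite nak; field; rewrite gt_eqF.
have : nr ('d f x (a%:C *: k)) <= 3 * M.
  set D := 'd f x _ in h2 *.
  have := nr_lbB D (f (x + a%:C *: k) - f x).
  rewrite nrBC => h3; have h4 := nrB (f (x + a%:C *: k)) (f x).
  by rewrite q4 in h2; lra.
rewrite linearZ nrZ na /a mulrC -ler_pdivlMr ?divr_gt0 // => /le_trans; apply.
rewrite le_eqVlt; apply/orP; left; apply/eqP; field.
by rewrite !gt_eqF.
Qed.

(** On every line through [x] all Taylor coefficients vanish. The radius [r / 2] does not depend on
    the neighbourhood on which [f] is known to vanish; this uniformity lets zeros propagate. *)
Lemma local_identity : (\forall y \near x, f y = 0) ->
  forall y, nr (y - x) <= r / 2 -> f y = 0.
Proof.
move=> f0 y yr; have [yx|yx] := eqVneq (y - x) 0.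
  by move/eqP: yx; rewrite subr_eq0 => /eqP ->; exact: nbhs_singleton f0.
have [c hc] := line_taylor yx; set k := y - x in yr yx c hc *.
have nk : 0 < nr k by rewrite nr_gt0.
have yE : y = x + 1 *: k by rewrite scale1r addrC subrK.
have hc' K (t : C) : nr t <= (r / nr k) / 2 ->
    nr (f (x + t *: k) - \sum_(i < K) c i * t ^+ i) <= 4 * M * (nr t / (r / nr k)) ^+ K.
  move=> tr; have := hc K t; rewrite nrZ invfM invrK mulrA.
  have -> : (nr t * nr k / r) = nr t / r * nr k by rewrite mulrAC.
  by apply; rewrite -ler_pdivlMr // mulrAC.
have /nbhs_nrP[e e0 he] := f0.
have c0 i : c i = 0.
  apply: (taylor_coef0 (divr_gt0 r0 nk) hc' (m := i.+1) (B := 0) (divr_gt0 e0 nk)) => //.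
  move=> t te; rewrite mul0r he ?nr0 //.
  by rewrite addrC addKr nrZ -ltr_pdivlMr.
apply/eqP; rewrite -nr_eq0 eq_le nr_ge0 andbT.
apply: (@le_geometric0 _ _ (4 * M) (nr k / r)).
  rewrite divr_ge0 ?nr_ge0 ?(ltW r0) //= ler_pdivrMr //; have := yr; lra.
move=> K; have := hc K 1; rewrite scale1r => /(_ yr).
rewrite big1 ?subr0; last by move=> i _; rewrite c0 mul0r.
by rewrite [x + k]addrC subrK.
Qed.

End Estimates.

(* The interval of the parameter is slightly larger than [0, T] so that
   continuity on [0, T] is two-sided. *)
Lemma differentiable_param_integral (Q : V -> R -> C) (x : V) (eta M : R) : 0 < eta ->
  (forall y z, -1 <= y <= T + 1 -> nr (z - x) <= eta -> differentiable (Q ^~ y) z) ->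
  (forall y z, -1 <= y <= T + 1 -> nr (z - x) <= eta -> nr (Q z y) <= M) ->
  (forall z, nr (z - x) <= eta -> cont_on (Q z) 0 T) ->
  differentiable (fun z => cint (Q z) 0 T) x.
Proof.
move=> eta0 dQ QM cQ.
have T0 : 0 < T by rewrite pmulrn_lgt0 ?pi_gt0.
have xx : nr (x - x) <= eta by rewrite subrr nr0 ltW.
have M0 : 0 <= M by apply: le_trans (nr_ge0 (Q x 0)) (QM _ _ _ xx); apply/andP; split; lra.
have so y k : -1 <= y <= T + 1 -> nr k <= eta / 2 ->
    nr (Q (x + k) y - Q x y - 'd (Q ^~ y) x k) <= 4 * M * (nr k / eta) ^+ 2.
  move=> hy hk; apply: (second_order eta0 (f := Q ^~ y)) hk => z hz; [exact: dQ|exact: QM].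
have db y k : -1 <= y <= T + 1 -> nr ('d (Q ^~ y) x k) <= 6 * M / eta * nr k.
  move=> hy; apply: (diff_bound eta0 (f := Q ^~ y)) => z hz; [exact: dQ|exact: QM].
have sub y : 0 <= y <= T -> -1 <= y <= T + 1 by move=> /andP[? ?]; apply/andP; split; lra.
(* The derivative is a limit, uniform in the parameter, of the difference quotients [W], which are
   continuous; [second_order] bounds the error by [A * a]. *)
have cD k : cont_on (fun y => 'd (Q ^~ y) x k) 0 T.
  move=> y0 hy0; have [->|k0] := eqVneq k 0.
    under eq_fun do rewrite linear0.
    by rewrite linear0; exact: cvg_cst.
  have nk : 0 < nr k by rewrite nr_gt0.
  apply/cvg_nrP => e e0.
  pose A := 4 * M * (nr k / eta) ^+ 2.
  have A0 : 0 <= A by apply: mulr_ge0; [exact: mulr_ge0|exact: sqr_ge0].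
  pose a := Num.min (eta / 2 / nr k) (e / (4 * (A + 1))).
  have A1 : 0 < A + 1 by rewrite ltr_wpDl.
  have a0 : 0 < a by rewrite lt_min !divr_gt0 // mulr_gt0.
  have ak : nr (a%:C *: k) <= eta / 2.
    by rewrite nrZ nr_real gtr0_norm // -ler_pdivlMr // ge_min lexx.
  have aA : A * a <= e / 4.
    have h : a <= e / (4 * (A + 1)) by rewrite ge_min lexx orbT.
    move: h; rewrite ler_pdivlMr ?mulr_gt0 // => h; nra.
  pose W y : C := a%:C^-1 * (Q (x + a%:C *: k) y - Q x y).
  have aC : a%:C != 0 :> C by rewrite -nr_gt0 nr_real normr_gt0 gt_eqF.
  have hW y : -1 <= y <= T + 1 -> nr (W y - 'd (Q ^~ y) x k) <= e / 4.
    move=> hy; have := so y (a%:C *: k) hy ak.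
    rewrite linearZ => h.
    have -> : W y - 'd (Q ^~ y) x k =
        a%:C^-1 * (Q (x + a%:C *: k) y - Q x y - a%:C * 'd (Q ^~ y) x k).
      by rewrite /W [in RHS]mulrBr mulrA mulVf // mul1r.
    rewrite nrM nrV nr_real gtr0_norm // mulrC ler_pdivrMr //.
    apply: le_trans h _; apply: (@le_trans _ _ (A * a * a)).
      rewrite nrZ nr_real gtr0_norm // /A le_eqVlt; apply/orP; left; apply/eqP; ring.
    by rewrite ler_wpM2r // ltW.
  have cW : W @ y0 --> W y0.
    apply: cvgM; first exact: cvg_cst.
    have hk : nr (x + a%:C *: k - x) <= eta by rewrite addrC addKr; lra.
    by apply: cvgB; [exact: cQ hk _ hy0|exact: cQ xx _ hy0].
  have e4 : 0 < e / 4 by rewrite divr_gt0.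
  move/cvg_nrP: cW => /(_ _ e4) cW.
  have near1 : \forall y \near y0, -1 <= y <= T + 1.
    case/andP: hy0 => y00 y0T.
    apply: filterS (nbhsx_ballx y0 1 ltr01) => y.
    rewrite /ball /= ltr_distlC => /andP[h1 h2]; apply/andP; split; lra.
  near=> y.
  have hy : -1 <= y <= T + 1 by near: y.
  have h1 := hW y hy; have h2 := hW y0 (sub _ hy0).
  have h3 : nr (W y - W y0) < e / 4 by near: y.
  have := nr_subD ('d (Q ^~ y) x k) ('d (Q ^~ y0) x k) (W y).
  have := nr_subD (W y) ('d (Q ^~ y0) x k) (W y0).
  rewrite nrBC in h1; lra.
pose L k : C := cint (fun y => 'd (Q ^~ y) x k) 0 T.
have lL : linear L.
  move=> a k1 k2; transitivity (a * L k1 + L k2); last by [].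
  rewrite /L -(cintZ a (cD k1)).
  have c1 : cont_on (fun y => a * 'd (Q ^~ y) x k1) 0 T.
    by apply: cont_onM (cD k1); exact: cont_on_cst.
  rewrite -(cintD c1 (cD k2)); apply: eq_cint => y _.
  by rewrite linearP.
have [||h hr|] := @differentiable_quad_lin _ V (fun z => cint (Q z) 0 T) x L
    (2 * (6 * M / eta) * T) (2 * (4 * M / eta ^+ 2) * T) (eta / 2) lL; last by [].
- by rewrite divr_gt0.
- move=> h; apply: (@le_trans _ _ (2 * (6 * M / eta * nr h) * (T - 0))).
    apply: cint_bound; [exact: pi2_ge0|exact: cD|] => y hy.
    exact: db (sub _ hy).
  by rewrite subr0 le_eqVlt; apply/orP; left; apply/eqP; ring.
have xh : nr (x + h - x) <= eta by rewrite addrC addKr; lra.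
rewrite -(cintB (cQ _ xh) (cQ _ xx)) -(cintB (cont_onB (cQ _ xh) (cQ _ xx)) (cD h)).
apply: (@le_trans _ _ (2 * (4 * M * (nr h / eta) ^+ 2) * (T - 0))).
  apply: cint_bound; [exact: pi2_ge0|exact: (cont_onB (cont_onB (cQ _ xh) (cQ _ xx)) (cD h))|].
  by move=> y hy; apply: so (sub _ hy) (ltW hr).
rewrite subr0 expr_div_n le_eqVlt; apply/orP; left; apply/eqP; ring.
Unshelve. all: by end_near. Qed.

End SeveralVariables.

(** * Bounded quotients in several variables *)

Section Division.
Variable R : realType.
Local Notation C := (Cplx R).
Local Notation T := (pi *+ 2 : R).
Variable V : normedModType C.

(* Riemann extension for a locally bounded quotient g / h: average g / h over
   a circle in a direction along which h does not vanish identically. *)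
Lemma bounded_quotient_holomorphic (g h : V -> C) (x : V) (M : R) :
  (\forall y \near x, differentiable g y) ->
  (\forall y \near x, differentiable h y) ->
  (\forall y \near x, nr (g y) <= M * nr (h y)) ->
  ~ (\forall y \near x, h y = 0) ->
  exists q : V -> C, \forall y \near x, differentiable q y /\ g y = q y * h y.
Proof.
move=> ng nh ngh hn0.
have bnd (f : V -> C) : (\forall y \near x, differentiable f y) ->
    \forall y \near x, nr (f y) <= nr (f x) + 1.
  move=> /nbhs_singleton/differentiable_continuous/cvg_nrP/(_ 1 ltr01).
  by apply: filterS => y hy; have := nr_lbB (f y) (f x); lra.
have /nbhs_nrP[r0' r0'0 hr'] : \forall y \near x,
    (differentiable g y /\ differentiable h y) /\
    (nr (g y) <= nr (g x) + 1 /\ nr (h y) <= nr (h x) + 1) /\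
    nr (g y) <= M * nr (h y).
  have ng' := bnd g ng; have nh' := bnd h nh.
  by near=> y; split; [split|split; [split|]]; near: y.
set Mg := nr (g x) + 1 in hr'; set Mh := nr (h x) + 1 in hr'.
pose r := r0' / 2.
have r0 : 0 < r by rewrite divr_gt0.
have hr y : nr (y - x) <= r -> (differentiable g y /\ differentiable h y) /\
    (nr (g y) <= Mg /\ nr (h y) <= Mh) /\ nr (g y) <= M * nr (h y).
  by move=> yr; apply: hr'; apply: le_lt_trans yr _; rewrite /r; lra.
have [y1 [y1r hy1]] : exists y1, nr (y1 - x) < r / 2 /\ h y1 != 0.
  apply: contrapT => no; apply: hn0; apply/nbhs_nrP; exists (r / 2); first by rewrite divr_gt0.
  move=> y yr; apply/eqP; apply: contrapT => /negP hy; apply: no.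
  by exists y.
pose k := y1 - x.
have kin (t : C) : nr t <= 2 -> nr (x + t *: k - x) <= r.
  move=> t2; rewrite addrC addKr nrZ.
  apply: (@le_trans _ _ (2 * (r / 2))); last by rewrite mulrC divfK.
  by apply: ler_pM; rewrite ?nr_ge0 // ltW.
have du (t : C) : nr t <= 2 -> differentiable (fun s : C => h (x + s *: k)) t.
  by move=> /kin /hr[[_ /differentiable_comp_line[]]].
have uM (t : C) : nr t <= 2 -> nr (h (x + t *: k)) <= Mh.
  by move=> /kin /hr[_ [[]]].
have [c hc] := cauchy_taylor (ltr0Sn R 1) du uM.
have [h0|[m [v [dv v0 hv]]]] := taylor_zero_or_order (ltr0Sn R 1) hc.
  have := h0 1; rewrite nr1 divff ?pnatr_eq0 // => /(_ (lexx 1)).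
  by rewrite scale1r /k addrC subrK => h1; rewrite h1 eqxx in hy1.
have [e e0 he] : exists2 e : R, 0 < e & forall t : C, nr t < e -> v t != 0.
  have v00 : 0 < nr (v 0) by rewrite nr_gt0.
  have /nbhs_nrP[d d0 hd] : nbhs (0 : C) [set z | nr (v z - v 0) < nr (v 0)].
    by have /cvg_nrP := differentiable_continuous dv; apply.
  exists d => // t td; have /= := hd t; rewrite subr0 => /(_ td).
  by case: eqP => // ->; rewrite sub0r nrN ltxx.
(* The circle of radius [rho] misses the zeros of [h] on the line through [x], and the disc of
   radius [5 * rho] required by [quotient_mean_value] stays where the bounds hold. *)
pose rho := Num.min (e / 2) (1 / 5).
have rho0 : 0 < rho by rewrite lt_min !divr_gt0.
have rhoe : rho < e.
  have : rho <= e / 2 by rewrite ge_min lexx.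
  by lra.
have rho5 : 5 * rho <= 1.
  have : rho <= 1 / 5 by rewrite ge_min lexx orbT.
  by lra.
pose s y : C := rho%:C * cis y.
have nr_s y : nr (s y) = rho by rewrite nrM nr_cis nr_real mulr1 gtr0_norm.
have cs : continuous s by move=> y; apply: cvgM; [exact: cvg_cst|exact: continuous_cis].
have hs0 y : h (x + s y *: k) != 0.
  have := hv (s y) => /= ->; apply: mulf_neq0; last by apply: he; rewrite nr_s.
  by rewrite expf_neq0 // -nr_gt0 nr_s.
have zin (z : V) (t : C) : nr (z - x) <= r / 2 -> nr t <= 5 * rho ->
    nr (z + t *: k - x) <= r.
  move=> zr tr; rewrite addrAC; apply: le_trans (nrD _ _) _; rewrite nrZ.
  have h1 : nr t * nr k <= 1 * (r / 2).
    by apply: ler_pM; rewrite ?nr_ge0 ?(ltW y1r) // (le_trans tr).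
  by lra.
have sin z y : nr (z - x) <= r / 2 -> nr (z + s y *: k - x) <= r.
  by move=> zr; apply: zin => //; rewrite nr_s; lra.
have cpath (z : V) : continuous (fun y => z + s y *: k).
  move=> y; apply: cvgD; first exact: cvg_cst.
  by apply: cvgZr_tmp; exact: cs.
(* By compactness of the parameter interval, one circle serves for all centres [z] near [x]. *)
have near0 : \forall z \near x, `[(-1 : R), T + 1] `<=` [set y | h (z + s y *: k) != 0].
  have /compact_near_coveringP cover := @segment_compact R (-1) (T + 1).
  apply: (cover V (nbhs x) (fun z y => h (z + s y *: k) != 0) _) => y0 _.
  have ch : {for x + s y0 *: k, continuous h}.
    apply: differentiable_continuous.
    by have [[]] := hr _ (sin x y0 ltac:(by rewrite subrr nr0 divr_ge0 ?(ltW r0))).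
  have h00 : 0 < nr (h (x + s y0 *: k)) by rewrite nr_gt0.
  move/cvg_nrP: ch => /(_ _ h00) /nbhs_nrP[d d0 hd].
  have d2 : 0 < d / 2 by rewrite divr_gt0.
  have c1 : \forall y \near y0, nr (x + s y *: k - (x + s y0 *: k)) < d / 2.
    by have /cvg_nrP := cpath x y0; apply.
  have c2 : \forall z \near x, nr (z - x) < d / 2 by apply/nbhs_nrP; exists (d / 2).
  exists ([set y | nr (x + s y *: k - (x + s y0 *: k)) < d / 2],
          [set z | nr (z - x) < d / 2]) => //= -[y z] [/= hy hz].
  have lt : nr (z + s y *: k - (x + s y0 *: k)) < d.
    have -> : z + s y *: k - (x + s y0 *: k) =
        (z - x) + (x + s y *: k - (x + s y0 *: k)).
      by rewrite addrA addrA subrK.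
    by apply: le_lt_trans (nrD _ _) _; lra.
  have /= := hd _ lt; case: eqP => // ->.
  by rewrite sub0r nrN ltxx.
have /nbhs_nrP[eta' eta'0 heta'] := near0.
pose eta := Num.min (eta' / 2) (r / 2) / 2.
have eta0 : 0 < eta by rewrite !divr_gt0 // lt_min !divr_gt0.
have [etae etar] : eta * 2 < eta' /\ eta * 2 <= r / 2.
  have E : eta * 2 = Num.min (eta' / 2) (r / 2) by rewrite /eta divfK.
  rewrite E; split; last by rewrite ge_min lexx orbT.
  have : Num.min (eta' / 2) (r / 2) <= eta' / 2 by rewrite ge_min lexx.
  by lra.
have heta y z : -1 <= y <= T + 1 -> nr (z - x) <= eta * 2 -> h (z + s y *: k) != 0.
  move=> hy hz; apply: (heta' z (le_lt_trans hz etae)).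
  by rewrite /= in_itv.
pose Q z y : C := g (z + s y *: k) / h (z + s y *: k).
have dQ y z : -1 <= y <= T + 1 -> nr (z - x) <= eta * 2 -> differentiable (Q ^~ y) z.
  move=> hy hz; have [[dg dh] _] := hr _ (sin z y (le_trans hz etar)).
  have tr (f : V -> C) : differentiable f (z + s y *: k) ->
      differentiable (fun w => f (w + s y *: k)) z.
    move=> df; have d1 := is_diffD (is_diff_id z) (is_diff_cst (s y *: k) z).
    exact: (differentiable_comp (@ex_diff _ _ _ _ _ _ _ d1) df).
  exact: (differentiableM (tr g dg) (differentiableV (tr h dh) (heta y z hy hz))).
have QM y z : -1 <= y <= T + 1 -> nr (z - x) <= eta * 2 -> nr (Q z y) <= M.
  move=> hy hz; have [_ [_ gh]] := hr _ (sin z y (le_trans hz etar)).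
  by rewrite /Q nrM nrV ler_pdivrMr // nr_gt0 heta.
have sub y : 0 <= y <= T -> -1 <= y <= T + 1 by move=> /andP[? ?]; apply/andP; split; lra.
have cQ z : nr (z - x) <= eta * 2 -> cont_on (Q z) 0 T.
  move=> hz y hy; have [[dg dh] _] := hr _ (sin z y (le_trans hz etar)).
  have tr (f : V -> C) : differentiable f (z + s y *: k) ->
      f (z + s w *: k) @[w --> y] --> f (z + s y *: k).
    move=> /differentiable_continuous cf.
    exact: (@continuous_comp _ _ _ (fun w => z + s w *: k) f y (cpath z y) cf).
  exact: (cvgM (tr g dg) (cvgV (heta y z (sub y hy) hz) (tr h dh))).
exists (fun z => cint (Q z) 0 T / T%:C); apply/nbhs_nrP; exists eta; first exact: eta0.
move=> z zx.
have zz w : nr (w - z) <= eta -> nr (w - x) <= eta * 2.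
  by move=> wz; apply: le_trans (nr_subD _ _ z) _; lra.
split.
  have dI : differentiable (fun w => cint (Q w) 0 T) z.
    apply: (@differentiable_param_integral _ _ Q z eta M eta0).
    - by move=> y w hy /zz; exact: dQ.
    - by move=> y w hy /zz; exact: QM.
    - by move=> w /zz; exact: cQ.
  by apply: (differentiableM dI); exact: differentiable_cst.
have zr : nr (z - x) <= r / 2 by lra.
(* At a zero of [h] the bound makes [g] vanish too; elsewhere the average is the value of [g / h] at
   the centre. *)
have [hz|hz] := eqVneq (h z) 0.
  rewrite hz mulr0; have [_ [_]] := hr z ltac:(lra).
  rewrite hz nr0 mulr0 => gz; apply/eqP; rewrite -nr_eq0 eq_le gz; exact: nr_ge0.
have line (f : V -> C) (t : C) : differentiable f (z + t *: k) ->
    differentiable (fun t : C => f (z + t *: k)) t.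
  by move=> /differentiable_comp_line[].
have E := @quotient_mean_value _ (fun t => g (z + t *: k)) (fun t => h (z + t *: k))
  rho Mg Mh M rho0
  (fun t tr => line g t (hr _ (zin z t zr tr)).1.1)
  (fun t tr => line h t (hr _ (zin z t zr tr)).1.2)
  (fun t tr => (hr _ (zin z t zr tr)).2.1.1)
  (fun t tr => (hr _ (zin z t zr tr)).2.1.2)
  (fun t tr => (hr _ (zin z t zr tr)).2.2).
have {}E : cint (Q z) 0 T = g z / h z * T%:C.
  rewrite E ?scale0r ?addr0 //.
  by move=> y hy; apply: heta (sub y hy) _; lra.
by rewrite E mulfK ?T_neq0 // divfK.
Unshelve. all: by end_near. Qed.

End Division.

(** * Holomorphic functions on manifolds *)

Section Holomorphic.
Variables (R : realType) (X : complexManifold R).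
Local Notation C := (Cplx R).
Implicit Types (x y : X) (f g : X -> C).

Section Chart.
Variable c : chart R X.

Lemma chart_map_cvg x : chart_dom c x -> chart_map c y @[y --> x] --> chart_map c x.
Proof.
move=> cx; have := @chart_map_continuous R X c.
by rewrite continuous_open_subspace; [apply; exact: mem_set|exact: chart_dom_open].
Qed.

Lemma chart_inv_cvg x : chart_dom c x ->
  chart_inv c w @[w --> chart_map c x] --> x.
Proof.
move=> cx; have := @chart_inv_continuous R X c.
rewrite continuous_open_subspace; last exact: chart_img_open.
move=> /(_ (chart_map c x)); rewrite /prop_for /continuous_at chart_mapK //.
by apply; apply: mem_set; exists x.
Qed.

Lemma near_chart x (A : set X) : chart_dom c x ->
  (\forall w \near chart_map c x, A (chart_inv c w)) <-> (\forall y \near x, A y).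
Proof.
move=> cx; split=> [h|h]; last exact: (chart_inv_cvg cx h).
have dx : \forall y \near x, chart_dom c y.
  by apply: open_nbhs_nbhs; split=> //; exact: chart_dom_open.
have := chart_map_cvg cx h.
by apply: filterS2 dx => y cy /=; rewrite chart_mapK.
Qed.

End Chart.

Lemma near_near_eq (T : topologicalType) (x : T) (P : set T) :
  (\forall y \near x, P y) -> \forall y \near x, \forall z \near y, P z.
Proof. by move=> h; apply: nbhs_interior. Qed.

Lemma holomorphic_at_near_eq f g x : (\forall y \near x, f y = g y) ->
  holomorphic_at f x -> holomorphic_at g x.
Proof.
move=> fg hf c ca cx; have h1 := hf c ca cx.
have h2 : \forall w \near chart_map c x, f (chart_inv c w) = g (chart_inv c w).
  exact: (near_chart (fun y => f y = g y) cx).2.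
apply: filterS2 h1 (near_near_eq h2) => w df e.
exact: differentiable_near_eq e df.
Qed.

(** The definition quantifies over all charts at [x]; differentiability of the transition maps
    reduces it to a single one. *)
Lemma holomorphic_at_chart c f x : atlas c -> chart_dom c x ->
  (\forall w \near chart_map c x, differentiable (f \o chart_inv c) w) ->
  holomorphic_at f x.
Proof.
move=> ca cx hf c' ca' cx'.
have dx : \forall y \near x, chart_dom c y.
  by apply: open_nbhs_nbhs; split=> //; exact: chart_dom_open.
have dx' : \forall y \near x, chart_dom c' y.
  by apply: open_nbhs_nbhs; split=> //; exact: chart_dom_open.
have h1 : \forall y \near x, differentiable (f \o chart_inv c) (chart_map c y).
  apply/(near_chart (fun y => differentiable (f \o chart_inv c) (chart_map c y)) cx).
  have im : \forall w \near chart_map c x, (chart_map c @` chart_dom c) w.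
    by apply: open_nbhs_nbhs; split; [exact: chart_img_open|exists x].
  apply: filterS2 hf im => w d [y cy yw].
  by rewrite -yw (chart_mapK cy) yw; exact: d.
have im' : \forall w \near chart_map c' x, (chart_map c' @` chart_dom c') w.
  by apply: open_nbhs_nbhs; split; [exact: chart_img_open|exists x].
have h2 : \forall w \near chart_map c' x, chart_dom c (chart_inv c' w).
  exact: (near_chart (chart_dom c) cx').2.
have h3 : \forall w \near chart_map c' x,
    differentiable (f \o chart_inv c) (chart_map c (chart_inv c' w)).
  exact: (near_chart (fun y => differentiable (f \o chart_inv c) (chart_map c y)) cx').2.
have h2' := near_near_eq h2.
near=> w.
have [y cy' yw] : (chart_map c' @` chart_dom c') w by near: w.
have wE : chart_inv c' w = y by rewrite -yw chart_mapK.
have cy : chart_dom c y by rewrite -wE; near: w.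
have dt : differentiable (chart_map c \o chart_inv c') w.
  by apply: (atlas_compatible ca' ca); exists y.
have df : differentiable (f \o chart_inv c) (chart_map c (chart_inv c' w)) by near: w.
have := differentiable_comp dt df.
apply: differentiable_near_eq.
have : \forall w' \near w, chart_dom c (chart_inv c' w').
  by near: w; exact: h2'.
by apply: filterS => w' hw' /=; rewrite chart_mapK.
Unshelve. all: by end_near. Qed.

Lemma exists_chart x : exists2 c : chart R X, atlas c & chart_dom c x.
Proof. exact: atlas_cover. Qed.

Lemma holomorphic_at_near f x : holomorphic_at f x ->
  \forall y \near x, holomorphic_at f y.
Proof.
move=> hf; have [c ca cx] := exists_chart x.
have dx : \forall y \near x, chart_dom c y.
  by apply: open_nbhs_nbhs; split=> //; exact: chart_dom_open.
have h := near_near_eq (hf c ca cx).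
have h' : \forall y \near x, \forall w \near chart_map c y,
    differentiable (f \o chart_inv c) w := chart_map_cvg cx h.
apply: filterS2 dx h' => y cy hy.
exact: (holomorphic_at_chart ca cy hy).
Qed.

Lemma holomorphic_at_cvg f x : holomorphic_at f x -> f @ x --> f x.
Proof.
move=> hf; have [c ca cx] := exists_chart x.
apply/cvg_nrP => e e0; apply/(near_chart _ cx).
have /differentiable_continuous/cvg_nrP/(_ e e0) := nbhs_singleton (hf c ca cx).
by rewrite /= chart_mapK.
Qed.

Lemma holomorphic_at_cst (a : C) x : holomorphic_at (fun _ : X => a) x.
Proof. by move=> c _ _; near=> w; exact: differentiable_cst.
Unshelve. all: by end_near. Qed.

Lemma holomorphic_atD f g x : holomorphic_at f x -> holomorphic_at g x ->
  holomorphic_at (fun y => f y + g y) x.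
Proof.
move=> hf hg c ca cx; apply: filterS2 (hf c ca cx) (hg c ca cx) => w df dg.
exact: (differentiableD df dg).
Qed.

Lemma holomorphic_atM f g x : holomorphic_at f x -> holomorphic_at g x ->
  holomorphic_at (fun y => f y * g y) x.
Proof.
move=> hf hg c ca cx; apply: filterS2 (hf c ca cx) (hg c ca cx) => w df dg.
exact: (differentiableM df dg).
Qed.

Lemma holomorphic_atN f x : holomorphic_at f x -> holomorphic_at (fun y => - f y) x.
Proof.
move=> hf c ca cx; apply: filterS (hf c ca cx) => w df.
exact: (differentiableN df).
Qed.

Lemma holomorphic_atB f g x : holomorphic_at f x -> holomorphic_at g x ->
  holomorphic_at (fun y => f y - g y) x.
Proof. by move=> hf hg; apply: holomorphic_atD hf (holomorphic_atN hg). Qed.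

Lemma holomorphic_atV f x : holomorphic_at f x -> f x != 0 ->
  holomorphic_at (fun y => (f y)^-1) x.
Proof.
move=> hf fx c ca cx.
have h0 : \forall y \near x, f y != 0.
  have n0 : 0 < nr (f x) by rewrite nr_gt0.
  have /cvg_nrP/(_ _ n0) := holomorphic_at_cvg hf.
  by apply: filterS => y; case: eqP => // ->; rewrite sub0r nrN ltxx.
have h1 := (near_chart (fun y => f y != 0) cx).2 h0.
apply: filterS2 (hf c ca cx) h1 => w df hw.
exact: (differentiableV df hw).
Qed.

Lemma holomorphic_at_sum (I : Type) (r : seq I) (P : pred I) (F : I -> X -> C) x :
  (forall i, P i -> holomorphic_at (F i) x) ->
  holomorphic_at (fun y => \sum_(i <- r | P i) F i y) x.
Proof.
move=> hF; elim: r => [|i r IH].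
  by under [fun y => _]eq_fun do rewrite big_nil; exact: holomorphic_at_cst.
under [fun y => _]eq_fun do rewrite big_cons.
by case: (boolP (P i)) => // Pi; apply: holomorphic_atD => //; exact: hF.
Qed.

Lemma holomorphic_at_prod (I : Type) (r : seq I) (P : pred I) (F : I -> X -> C) x :
  (forall i, P i -> holomorphic_at (F i) x) ->
  holomorphic_at (fun y => \prod_(i <- r | P i) F i y) x.
Proof.
move=> hF; elim: r => [|i r IH].
  by under [fun y => _]eq_fun do rewrite big_nil; exact: holomorphic_at_cst.
under [fun y => _]eq_fun do rewrite big_cons.
by case: (boolP (P i)) => // Pi; apply: holomorphic_atM => //; exact: hF.
Qed.

(** The radius in [local_identity] is uniform for centres near [x], so a zero germ at a sufficiently
    close [y] reaches [x]. *)
Lemma near_zero_propagates f x : holomorphic_at f x ->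
  \forall y \near x, (\forall z \near y, f z = 0) -> \forall z \near x, f z = 0.
Proof.
move=> hf; have [c ca cx] := exists_chart x.
pose F := f \o chart_inv c; pose p := chart_map c x.
have /nbhs_nrP[r0 r00 hr0] : \forall w \near p, differentiable F w /\ nr (F w) <= nr (F p) + 1.
  have h1 := hf c ca cx.
  have /differentiable_continuous/cvg_nrP/(_ 1 ltr01) h2 := nbhs_singleton h1.
  by apply: filterS2 h1 h2 => w dw hw; split=> //; have := nr_lbB (F w) (F p); lra.
pose r := r0 / 2.
have r_gt0 : 0 < r by rewrite divr_gt0.
have hnear : \forall w \near p, nr (w - p) < r / 4 by apply/nbhs_nrP; exists (r / 4); rewrite ?divr_gt0.
have dx : \forall y \near x, chart_dom c y.
  by apply: open_nbhs_nbhs; split=> //; exact: chart_dom_open.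
have hnear' : \forall y \near x, nr (chart_map c y - p) < r / 4 := chart_map_cvg cx hnear.
apply: filterS2 dx hnear' => y cy hy fy0.
apply/(near_chart _ cx).
have Fy0 : \forall w \near chart_map c y, F w = 0.
  exact: (near_chart (fun z => f z = 0) cy).2.
apply/nbhs_nrP; exists (r / 4); first by rewrite divr_gt0.
move=> w hw; have b w' : nr (w' - chart_map c y) <= r -> nr (w' - p) < r0.
  move=> h; apply: le_lt_trans (nr_subD w' p (chart_map c y)) _.
  apply: (@le_lt_trans _ _ (r + r / 4)); first exact: lerD h (ltW hy).
  by move: r_gt0; rewrite /r; lra.
apply: (@local_identity _ _ F (chart_map c y) r (nr (F p) + 1) r_gt0 _ _ Fy0).
- by move=> w' /b /hr0[].
- by move=> w' /b /hr0[].
- rewrite nrBC in hy; apply: le_trans (nr_subD w _ p) _.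
  by apply: le_trans (lerD (ltW hw) (ltW hy)) _; move: r_gt0; lra.
Qed.

Lemma nonzero_dense f x : holomorphic_at f x -> ~ (\forall y \near x, f y = 0) ->
  \forall y \near x, forall W, nbhs y W -> exists2 z, W z & f z != 0.
Proof.
move=> hf hn; apply: filterS (near_zero_propagates hf) => y hy W nW.
apply: contrapT => no; apply: hn; apply: hy; apply: filterS nW => z Wz.
by apply/eqP; apply: contrapT => /negP h; apply: no; exists z.
Qed.

(** The ring of germs at [x] is an integral domain: if [g] is nonzero at points arbitrarily close to
    [x], then [f] vanishes near such points, hence near [x]. *)
Lemma germ_domain f g x : holomorphic_at f x -> holomorphic_at g x ->
  (\forall y \near x, f y * g y = 0) ->
  (\forall y \near x, f y = 0) \/ (\forall y \near x, g y = 0).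
Proof.
move=> hf hg fg; have [g0|gn] := pselect (\forall y \near x, g y = 0); first by right.
left; have hz := near_zero_propagates hf.
have cg : \forall y \near x, holomorphic_at g y := holomorphic_at_near hg.
apply: contrapT => fn; apply: gn.
have fg' := near_near_eq fg.
apply: filterS3 hz cg fg' => y h1 h2 h3.
apply: contrapT => /eqP gy; apply: fn; apply: h1.
have n0 : 0 < nr (g y) by rewrite nr_gt0.
have /cvg_nrP/(_ _ n0) h4 := holomorphic_at_cvg h2.
apply: filterS2 h3 h4 => z /eqP; rewrite mulf_eq0 => /orP[/eqP //|/eqP ->].
by rewrite sub0r nrN ltxx.
Qed.

Lemma identity_connected f (U : set X) x : open U -> connected U -> holomorphic U f ->
  U x -> (\forall y \near x, f y = 0) -> forall y, U y -> \forall z \near y, f z = 0.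
Proof.
move=> Uo Uc hf Ux fx y Uy.
pose B := [set z | U z /\ \forall w \near z, f w = 0].
suff : B = U by move=> E; have [] : B y by rewrite E.
apply: Uc.
- by exists x.
- exists [set z | \forall w \near z, f w = 0]; last by apply/seteqP; split => z [].
  by rewrite openE => z /= /near_near_eq.
- exists (closure B); first exact: closed_closure.
  apply/seteqP; split=> z.
    by move=> [Uz hz]; split=> //; exact: subset_closure.
  move=> [Uz clz]; split=> //.
  have [w [[Uw hw] hz]] := clz _ (near_zero_propagates (hf z Uz)).
  exact: hz.
Qed.

Lemma holomorphic_division f g x (M : R) : holomorphic_at f x -> holomorphic_at g x ->
  (\forall y \near x, nr (f y) <= M * nr (g y)) ->
  ~ (\forall y \near x, g y = 0) ->
  exists2 q : X -> C, holomorphic_at q x & \forall y \near x, f y = q y * g y.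
Proof.
move=> hf hg fg gn; have [c ca cx] := exists_chart x.
have [] := @bounded_quotient_holomorphic _ _ (f \o chart_inv c) (g \o chart_inv c)
  (chart_map c x) M (hf c ca cx) (hg c ca cx).
- exact: (near_chart (fun y => nr (f y) <= M * nr (g y)) cx).2.
- by move=> h; apply: gn; apply/(near_chart (fun y => g y = 0) cx).
move=> q hq; exists (q \o chart_map c).
  apply: (holomorphic_at_chart ca cx).
  have im : \forall w \near chart_map c x, (chart_map c @` chart_dom c) w.
    by apply: open_nbhs_nbhs; split; [exact: chart_img_open|exists x].
  apply: filterS2 hq (near_near_eq im) => w [dq _] hw.
  apply: differentiable_near_eq dq; apply: filterS hw => _ [y cy <-] /=.
  by rewrite chart_mapK.
have dx : \forall y \near x, chart_dom c y.
  by apply: open_nbhs_nbhs; split=> //; exact: chart_dom_open.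
have h0 : \forall w \near chart_map c x,
    (f \o chart_inv c) w = q w * (g \o chart_inv c) w by apply: filterS hq => w [].
have h' : \forall y \near x, (f \o chart_inv c) (chart_map c y) =
    q (chart_map c y) * (g \o chart_inv c) (chart_map c y) := chart_map_cvg cx h0.
by apply: filterS2 dx h' => y cy /=; rewrite (chart_mapK cy).
Qed.

Lemma connected_real_ball (V : normedModType C) (p : V) (e : R) :
  connected [set w | nr (w - p) < e].
Proof.
pose B := [set w | nr (w - p) < e].
have [e0|e0] := leP e 0.
  rewrite (_ : [set w | _] = set0); first exact: connected0.
  by apply/seteqP; split=> // w /= /lt_le_trans/(_ e0); rewrite ltNge nr_ge0.
rewrite (_ : [set w | _] =
    \bigcup_(w in B) [set p + t%:C *: (w - p) | t in `[0, 1]]).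
  apply: bigcup_connected.
    exists p => w _; exists 0; first by rewrite /= in_itv /= lexx ler01.
    by rewrite scale0r addr0.
  move=> w Bw; apply: connected_continuous_connected; first exact: segment_connected.
  apply: continuous_subspaceT => t; apply: cvgD; first exact: cvg_cst.
  apply: cvgZr_tmp; exact: continuous_real.
apply/seteqP; split=> [w Bw|w' [w Bw [t]]].
  exists w => //; exists 1; first by rewrite /= in_itv /= lexx ler01.
  by rewrite scale1r addrC subrK.
rewrite /= in_itv /= => /andP[t0 t1] <-; rewrite addrC addKr nrZ nr_real ger0_norm //.
by apply: le_lt_trans Bw; rewrite ler_piMl ?nr_ge0.
Qed.

Lemma connected_nbhs x (W : set X) : nbhs x W ->
  exists U : set X, [/\ open_nbhs x U, connected U & U `<=` W].
Proof.
move=> nW; have [c ca cx] := exists_chart x; set p := chart_map c x.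
have h1 := (near_chart W cx).2 nW.
have h2 : \forall w \near p, (chart_map c @` chart_dom c) w.
  by apply: open_nbhs_nbhs; split; [exact: chart_img_open|exists x].
have /nbhs_nrP[e e0 he] : \forall w \near p, W (chart_inv c w) /\
    (chart_map c @` chart_dom c) w by apply: filterS2 h1 h2.
pose B := [set w | nr (w - p) < e].
have pB : B p by rewrite /B /= subrr nr0.
exists (chart_inv c @` B); split.
- split; last by exists p => //; rewrite chart_mapK.
  rewrite openE => _ [w Bw <-]; have [_ [y cy yw]] := he w Bw.
  rewrite -yw (chart_mapK cy); apply/(near_chart _ cy).
  have nB : \forall w' \near chart_map c y, B w'.
    apply/nbhs_nrP; exists (e - nr (w - p)); first by rewrite subr_gt0.
    move=> w'; rewrite yw ltrBrDr /B /=; apply: le_lt_trans.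
    exact: nr_subD.
  by apply: filterS nB => w' Bw'; exists w'.
- apply: connected_continuous_connected; first exact: connected_real_ball.
  apply: continuous_in_subspaceT => w /set_mem Bw.
  have [_ [y cy yw]] := he w Bw; rewrite -yw.
  have := chart_inv_cvg cy; rewrite -[in X in _ --> X -> _](chart_mapK cy).
  by [].
- by move=> _ [w Bw <-]; have [] := he w Bw.
Qed.

End Holomorphic.

(** * Generalized eigenspaces, nilpotent chains, Jordan matrices *)

Section LinearAlgebra.
Variable F : fieldType.

Lemma mem_lker_mulmx m n (M : 'M[F]_(m, n)) (v : 'cV[F]_n) :
  (v \in lker (linfun (mulmx M))) = (M *m v == 0).
Proof. by rewrite memv_ker lfunE. Qed.

Section GeneralizedEigenspaces.
Variables (n : nat) (A : 'M[F]_n).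
Implicit Types (v : 'cV[F]_n) (a b : F).

Lemma comm_shift a b k l : GRing.comm ((A - a%:M) ^+ k) ((A - b%:M) ^+ l).
Proof.
have cA c (B : 'M[F]_n) : GRing.comm B c%:M by rewrite /GRing.comm -!mulmxE scalar_mxC.
apply: commrX; apply/commr_sym/commrX/commr_sym; apply: commrB; last exact: cA.
by apply/commr_sym/commrB; [exact: commr_refl|exact: cA].
Qed.

Lemma comm_shift_prod (I : Type) (s : seq I) (P : pred I) (c : I -> F) a k l :
  GRing.comm ((A - a%:M) ^+ k) (\prod_(i <- s | P i) (A - (c i)%:M) ^+ l).
Proof. by apply: commr_prod => i _; exact: comm_shift. Qed.

Lemma shift_pow_eigen a b v k : (A - b%:M) *m v = 0 ->
  (A - a%:M) ^+ k *m v = (b - a) ^+ k *: v.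
Proof.
rewrite mulmxBl mul_scalar_mx => /eqP; rewrite subr_eq0 => /eqP Av.
elim: k => [|k IH]; first by rewrite !expr0 mul1mx scale1r.
rewrite exprSr -mulmxE -mulmxA mulmxBl mul_scalar_mx Av -scalerBl.
by rewrite -scalemxAr IH scalerA -exprS.
Qed.

(** The last nonzero [(A - b%:M) ^+ j *m v] would be an eigenvector for [b], on which
    [(A - a%:M) ^+ k] acts as the nonzero scalar [(b - a) ^+ k]. *)
Lemma gen_eigen_inj a b v k l : a != b ->
  (A - a%:M) ^+ k *m v = 0 -> (A - b%:M) ^+ l *m v = 0 -> v = 0.
Proof.
move=> ab hv; elim: l => [|l IH]; first by rewrite expr0 mul1mx.
rewrite exprS -mulmxE -mulmxA; set w := _ ^+ l *m v => hw.
apply: IH; rewrite -/w.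
have : (A - a%:M) ^+ k *m w = 0.
  rewrite /w mulmxA mulmxE comm_shift -mulmxE -mulmxA hv.
  by rewrite mulmx0.
rewrite (shift_pow_eigen a k hw) => /eqP.
rewrite scaler_eq0 expf_eq0 subr_eq0 [b == a]eq_sym (negbTE ab) andbF => /eqP.
by [].
Qed.

Lemma gen_eigen_prod_inj (I : Type) (s : seq I) (P : pred I) (c : I -> F) a v k l :
  (forall i, P i -> c i != a) -> (A - a%:M) ^+ k *m v = 0 ->
  (\prod_(i <- s | P i) (A - (c i)%:M) ^+ l) *m v = 0 -> v = 0.
Proof.
move=> ca hv; elim: s => [|i s IH]; first by rewrite big_nil mul1mx.
rewrite big_cons; case: (boolP (P i)) => // Pi h; apply: IH.
apply: (@gen_eigen_inj a (c i) _ k l); first by rewrite eq_sym ca.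
  rewrite mulmxA mulmxE comm_shift_prod -mulmxE -mulmxA hv.
  by rewrite mulmx0.
by rewrite mulmxA.
Qed.

(** The product commutes with [(A - a%:M) ^+ k] and is injective on its kernel; by finite dimension
    it maps this kernel onto itself. *)
Lemma gen_eigen_image (I : Type) (s : seq I) (P : pred I) (c : I -> F) a v k l :
  (forall i, P i -> c i != a) -> (A - a%:M) ^+ k *m v = 0 ->
  exists w : 'cV[F]_n, v = (\prod_(i <- s | P i) (A - (c i)%:M) ^+ l) *m w.
Proof.
move=> ca hv; set B := \prod_(i <- s | P i) _.
pose W := lker (linfun (mulmx ((A - a%:M) ^+ k)) : 'Hom('cV[F]_n, 'cV[F]_n)).
pose f : 'Hom('cV[F]_n, 'cV[F]_n) := linfun (mulmx B).
have fW : (f @: W <= W)%VS.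
  apply/subvP => _ /memv_imgP[w wW ->]; move: wW.
  rewrite !mem_lker_mulmx lfunE /= => /eqP hw.
  rewrite mulmxA mulmxE comm_shift_prod -mulmxE -mulmxA hw.
  by rewrite mulmx0.
have inj : (W :&: lker f = 0)%VS.
  apply/eqP; rewrite -subv0; apply/subvP => w; rewrite memv_cap !mem_lker_mulmx.
  by move=> /andP[/eqP h1 /eqP h2]; rewrite memv0; apply/eqP; exact: gen_eigen_prod_inj h1 h2.
have E : (f @: W = W)%VS.
  by apply/eqP; rewrite eqEdim fW -[leqLHS](limg_ker_dim f) inj dimv0 add0n leqnn.
have : v \in (f @: W)%VS by rewrite E mem_lker_mulmx hv.
by case/memv_imgP => w _ ->; exists w; rewrite lfunE.
Qed.

Lemma gen_eigen_prod_kill (I : eqType) (s : seq I) (P : pred I) (c : I -> F) i v l :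
  i \in s -> P i -> (A - (c i)%:M) ^+ l *m v = 0 ->
  (\prod_(i <- s | P i) (A - (c i)%:M) ^+ l) *m v = 0.
Proof.
move=> + Pi hv; elim: s => // j s IH; rewrite inE big_cons => /predU1P[<-|/IH E].
  by rewrite Pi comm_shift_prod -mulmxE -mulmxA hv mulmx0.
by case: ifP => // _; rewrite -mulmxE -mulmxA E mulmx0.
Qed.

Lemma gen_eigen_sum_eq0 (r : nat) (c : 'I_r -> F) (w : 'I_r -> 'cV[F]_n) k :
  injective c -> (forall i, (A - (c i)%:M) ^+ k *m w i = 0) ->
  \sum_i w i = 0 -> forall i, w i = 0.
Proof.
move=> cinj hw sw i.
apply: (@gen_eigen_prod_inj _ (index_enum 'I_r) (fun j => j != i) c (c i) (w i) k k) => //.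
  by move=> j; apply: contra_neq => /cinj.
have Bw j : j != i -> (\prod_(j | j != i) (A - (c j)%:M) ^+ k) *m w j = 0.
  by move=> ji; apply: (@gen_eigen_prod_kill _ _ _ _ j); rewrite ?mem_index_enum.
have := congr1 (mulmx (\prod_(j | j != i) (A - (c j)%:M) ^+ k)) sw.
move: Bw; set B := \prod_(j | _) _ => Bw.
by rewrite mulmx0 mulmx_sumr (bigD1 i) //= big1 ?addr0.
Qed.

End GeneralizedEigenspaces.

(** * Chains of a nilpotent matrix *)

Section NilpotentChains.
Variables (n N : nat) (V : 'M[F]_n).
Hypothesis VN : V ^+ N = 0.
Implicit Types (v w : 'cV[F]_n) (W : {vspace 'cV[F]_n}).

Definition chain (p : 'cV[F]_n * nat) : seq 'cV[F]_n :=
  [seq V ^+ j *m p.1 | j <- iota 0 p.2].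

Let addX j k v : V ^+ j *m (V ^+ k *m v) = V ^+ (j + k) *m v.
Proof. by rewrite mulmxA mulmxE exprD. Qed.

Let X0 j k v : V ^+ j *m v = 0 -> (j <= k)%N -> V ^+ k *m v = 0.
Proof. by move=> h /subnK <-; rewrite -addX h mulmx0. Qed.

(* Around a longest chain v, .., V^(l-1) v, the vectors w on which a suitable
   functional kills w, .., V^(l-1) w form an invariant complement. *)
Lemma nilpotent_chains W : (forall w, w \in W -> V *m w \in W) ->
  exists s : seq ('cV[F]_n * nat),
    [/\ forall p, p \in s -> [/\ p.1 \in W, (0 < p.2)%N & V ^+ p.2 *m p.1 = 0],
        (sumn [seq p.2 | p <- s] <= \dim W)%N
      & (W <= <<flatten (map chain s)>>)%VS].
Proof.
have [m] := ubnP (\dim W); elim: m W => // m IH W dW VW.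
have [W0|Wn0] := eqVneq W 0%VS.
  by exists [::]; split; rewrite ?W0 ?sub0v.
have VXW j w : w \in W -> V ^+ j *m w \in W.
  by move=> wW; elim: j => [|j IHj]; rewrite ?expr0 ?mul1mx // exprS -mulmxE -mulmxA VW.
pose K l := lker (linfun (mulmx (V ^+ l)) : 'Hom('cV[F]_n, 'cV[F]_n)).
have exK : exists l, (W <= K l)%VS.
  by exists N; apply/subvP => w _; rewrite mem_lker_mulmx VN mul0mx.
have [l WK lmin] := ex_minnP exK.
have l0 : (0 < l)%N.
  rewrite lt0n; apply: contraNneq Wn0 => l0; rewrite -subv0; apply/subvP => w wW.
  have := subvP WK w wW; rewrite mem_lker_mulmx l0 expr0 mul1mx => /eqP ->.
  exact: mem0v.
have Wl w : w \in W -> V ^+ l *m w = 0.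
  by move=> /(subvP WK); rewrite mem_lker_mulmx => /eqP.
have [v vW vl] : exists2 v, v \in W & V ^+ l.-1 *m v != 0.
  have : ~~ (W <= K l.-1)%VS by apply/negP => /lmin; rewrite -ltnS prednK // ltnn.
  by move=> /subvPn[v vW]; rewrite mem_lker_mulmx => h; exists v.
have [i vi] : exists i, (V ^+ l.-1 *m v) i 0 != 0.
  apply: contrapT => no; move/eqP: vl; apply; apply/colP => i; rewrite !mxE.
  by apply/eqP; apply: contrapT => /negP h; apply: no; exists i; rewrite mxE.
set a := (V ^+ l.-1 *m v) i 0 in vi.
(* Row [j] applies to [V ^+ j *m w] the functional that takes coordinate [i] and divides by [a],
   normalised to 1 on [V ^+ l.-1 *m v]. *)
pose Psi : 'M[F]_(l, n) := \matrix_(j, k) (a^-1 * (V ^+ j) i k).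
have PsiE w j : (Psi *m w) j 0 = a^-1 * (V ^+ j *m w) i 0.
  rewrite !mxE big_distrr /=; apply: eq_bigr => k _; by rewrite mxE mulrA.
pose psi : 'Hom('cV[F]_n, 'cV[F]_l) := linfun (mulmx Psi).
have psiE w : psi w = Psi *m w by rewrite lfunE.
(* On the chain of [v] the map [psi] is triangular: [V ^+ (l.-1 - k) *m v] has entry 1 in row [k]
   and 0 in all later rows. Hence the chain already covers the target, and [W'] has codimension [l]
   in [W]. *)
have solve k (u : 'cV[F]_l) : (k <= l)%N -> (forall j : 'I_l, (k <= j)%N -> u j 0 = 0) ->
    exists2 y, y \in (<<chain (v, l)>> :&: W)%VS & psi y = u.
  elim: k u => [|k IHk] u kl hu.
    exists 0; rewrite ?mem0v // linear0; apply/colP => j; by rewrite mxE hu.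
  pose y1 := u (Ordinal kl) 0 *: (V ^+ (l.-1 - k) *m v).
  have y1in : y1 \in (<<chain (v, l)>> :&: W)%VS.
    rewrite memv_cap !memvZ ?VXW // memv_span //; apply/mapP.
    by exists (l.-1 - k)%N => //; rewrite mem_iota /= add0n (leq_ltn_trans (leq_subr _ _)) // prednK.
  have [||y yin hy] := IHk (u - psi y1); first exact: ltnW.
    move=> j kj; rewrite !mxE psiE PsiE /y1 -scalemxAr mxE addX.
    case: (ltngtP k j) kj => // [kj _|kj _].
      rewrite (hu _ kj) (@X0 l _ _ (Wl _ vW)); last by lia.
      by rewrite mxE !mulr0 subr0.
    have -> : (j + (l.-1 - k) = l.-1)%N by lia.
    have -> : Ordinal kl = j by apply/val_inj.
    by rewrite -/a mulrCA mulVf // mulr1 subrr.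
  exists (y + y1); first exact: memvD.
  by rewrite psiE mulmxDr -!psiE hy subrK.
pose W' := (W :&: lker psi)%VS.
have dimW' : (\dim W' + l)%N = \dim W.
  rewrite -[RHS](limg_ker_dim psi); congr (_ + _)%N.
  have -> : (psi @: W = fullv)%VS.
    apply/eqP; rewrite eqEsubv subvf; apply/subvP => u _.
    have [|y] := solve l u (leqnn l); first by move=> j; rewrite leqNgt ltn_ord.
    by rewrite memv_cap => /andP[_ yW] <-; apply: memv_img.
  by rewrite dimvf /dim /= muln1.
have [|w|s [h1 h2 h3]] := IH W'.
- by lia.
- rewrite !memv_cap !memv_ker !psiE => /andP[wW /eqP hw]; rewrite VW //=.
  apply/eqP/colP => j; rewrite PsiE [RHS]mxE.
  have -> : V *m w = V ^+ 1 *m w by rewrite expr1.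
  rewrite addX addn1.
  case: (ltnP j.+1 l) => jl; last by rewrite (@X0 l) ?Wl // mxE mulr0.
  by have := PsiE w (Ordinal jl); rewrite hw mxE.
exists ((v, l) :: s); split.
- move=> p; rewrite inE => /predU1P[->|/h1]; first by split=> //=; exact: Wl.
  by rewrite memv_cap => -[/andP[]].
- by rewrite /= addnC -dimW' leq_add2r.
apply/subvP => w wW; have [|y] := solve l (psi w) (leqnn l).
  by move=> j; rewrite leqNgt ltn_ord.
rewrite memv_cap => /andP[y1 yW] hy; rewrite /= span_cat -(subrK y w) addrC.
apply: memv_add => //; apply: (subvP h3).
by rewrite memv_cap memvB // memv_ker psiE mulmxBr -!psiE hy subrr eqxx.
Qed.

End NilpotentChains.
End LinearAlgebra.

(** * Rank, minors and kernels *)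

Section Rank.
Variable F : fieldType.

(** A coordinate-free maximal minor: with [L] and [T] fixed, invertibility of the compression is an
    open condition, which makes the rank lower semicontinuous. *)
Lemma rank_minor m n (A : 'M[F]_(m, n)) :
  exists (L : 'M[F]_(\rank A, m)) (T : 'M[F]_(n, \rank A)), L *m A *m T = 1%:M.
Proof.
exists (pid_mx (\rank A) *m invmx (col_ebase A)).
exists (invmx (row_ebase A) *m pid_mx (\rank A)).
transitivity ((pid_mx (\rank A) : 'M[F]_(\rank A, m)) *m invmx (col_ebase A) *m
  (col_ebase A *m pid_mx (\rank A) *m row_ebase A) *m
  (invmx (row_ebase A) *m (pid_mx (\rank A) : 'M[F]_(n, \rank A)))).
  by rewrite mulmx_ebase.
rewrite !mulmxA mulmxKV ?col_ebase_unit //.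
rewrite mulmxK ?row_ebase_unit // !mul_pid_mx.
have h1 := rank_leq_row A; have h2 := rank_leq_col A.
rewrite (_ : minn _ _ = \rank A) ?pid_mx_1 //; lia.
Qed.

Lemma rank_ge_minor m n k (A : 'M[F]_(m, n)) (L : 'M[F]_(k, m)) (T : 'M[F]_(n, k)) :
  L *m A *m T \in unitmx -> (k <= \rank A)%N.
Proof.
move=> /mxrank_unit <-; apply: leq_trans (mxrankM_maxl _ _) _.
exact: mxrankM_maxr.
Qed.

(** Without loss of rank the row spaces of [K *m A] and [A] agree, so [A] factors through
    [K *m A]. *)
Lemma rank_eq_ker m n p (A : 'M[F]_(m, n)) (K : 'M[F]_(p, m)) (u : 'cV_n) :
  (\rank A <= \rank (K *m A))%N -> K *m A *m u = 0 -> A *m u = 0.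
Proof.
move=> h hu; have : (A <= K *m A)%MS.
  by rewrite -(geq_leqif (mxrank_leqif_sup (submxMl K A))).
by case/submxP => D ->; rewrite -mulmxA hu mulmx0.
Qed.

Lemma mulmx_col m n p (A : 'M[F]_(m, n)) (B : 'M[F]_(n, p)) j :
  A *m col j B = col j (A *m B).
Proof. by rewrite !colE mulmxA. Qed.

Lemma nonunit_ker n (M : 'M[F]_n) : M \notin unitmx -> exists2 v : 'cV_n, v != 0 & M *m v = 0.
Proof.
rewrite -unitmx_tr -row_free_unit -kermx_eq0 => /rowV0Pn[v vk v0].
exists v^T; first by rewrite trmx_eq0.
by apply: trmx_inj; rewrite trmx_mul trmxK trmx0; apply/sub_kermxP.
Qed.

Lemma eigenvalueP_col n (M : 'M[F]_n) a :
  eigenvalue M a <-> exists2 v : 'cV_n, v != 0 & (M - a%:M) *m v = 0.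
Proof.
rewrite /eigenvalue /eigenspace kermx_eq0 row_free_unit; split.
  exact: nonunit_ker.
move=> [v v0 hv]; apply: contra v0 => u.
by rewrite -(mulKmx u v) hv mulmx0.
Qed.

Lemma strict_upper_nilpotent n (E : 'M[F]_n) :
  (forall i j, E i j != 0 -> (i < j)%N) -> E ^+ n = 0.
Proof.
move=> hE; have h k (i j : 'I_n) : (E ^+ k) i j != 0 -> (i + k <= j)%N.
  elim: k i j => [|k IH] i j.
    by rewrite expr0 mxE addn0; case: (eqVneq i j) => [->|_]; rewrite ?leqnn ?eqxx.
  rewrite exprSr -mulmxE mxE => h.
  have [l hl] : exists l, (E ^+ k) i l * E l j != 0.
    apply: contrapT => no; move/eqP: h; apply; apply: big1 => l _.
    by apply/eqP; apply: contrapT => /negP hl; apply: no; exists l.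
  move: hl; rewrite mulf_eq0 negb_or => /andP[/IH h1 /hE h2].
  by rewrite addnS; exact: leq_ltn_trans h1 h2.
apply/matrixP => i j; rewrite mxE; apply/eqP; apply: contraT => /h.
by rewrite leqNgt ltn_addl // ltn_ord.
Qed.

End Rank.

(** * Jordan matrices *)

Section JordanCanonical.
Variable R : realType.
Local Notation C := (Cplx R).

Lemma jordan_canonical_entries n (J : 'M[C]_n) : jordan_canonical J ->
  forall k l : 'I_n, k != l ->
    J k l = 0 \/ [/\ J k l = 1, (k < l)%N & J k k = J l l].
Proof.
case=> m [p [a [e [p0 ->]]]]; case: _ / e => k l.
rewrite castmx_id.
(* [conform_mx] is the cast occurring in the definition of [\mxdiag]. *)
have ent i j (x : 'I_(p i)) (y : 'I_(p j)) :
    (\mxdiag_i jordan_block (p i) (a i)) (tagnat.Rank i x) (tagnat.Rank j y) =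
    (if i == j then conform_mx 0 (jordan_block (p i) (a i)) else 0) x y.
  pose B i j : 'M[C]_(p i, p j) :=
    if i == j then conform_mx 0 (jordan_block (p i) (a i)) else 0.
  by have /matrixP/(_ x y) <- := mxblockK B i j; rewrite [RHS]mxE.
rewrite -(tagnat.sig2K k) -(tagnat.sig2K l).
move: (tagnat.sig1 k) (tagnat.sig2 k) (tagnat.sig1 l) (tagnat.sig2 l) => i x j y.
rewrite !ent !eqxx !conform_mx_id !mxE !eqxx.
case: (eqVneq i j) => [ij|_]; last by left; rewrite mxE.
move: y; rewrite -ij conform_mx_id => y xy; rewrite !mxE.
have [xy'|xy'] := eqVneq x y; first by rewrite xy' eqxx in xy.
case: eqP => [h|_]; [right|by left]; split=> //.
by rewrite !tagnat.RankEsum ltn_add2l -h.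
Qed.

Lemma jordan_canonical_split n (J : 'M[C]_n) : jordan_canonical J ->
  let D := diag_mx (\row_i J i i) in
  [/\ GRing.comm D (J - D), (J - D) ^+ n = 0 &
      forall i j, (J - D) i j = 0 \/ (J - D) i j = 1].
Proof.
move=> /jordan_canonical_entries hJ D; set E := J - D.
have hE i j : E i j = 0 \/ [/\ E i j = 1, (i < j)%N & J i i = J j j].
  have [<-|ij] := eqVneq i j.
    by left; rewrite !mxE eqxx subrr.
  by rewrite !mxE (negbTE ij) mulr0n subr0; apply: hJ.
split.
- rewrite /GRing.comm -!mulmxE; apply/matrixP => i j.
  rewrite mul_diag_mx mul_mx_diag !mxE.
  have := hE i j; rewrite !mxE => -[->|[_ _ ->]]; first by rewrite mulr0 mul0r.
  exact: mulrC.
- by apply: strict_upper_nilpotent => i j; case: (hE i j) => [->|[_ + _]//]; rewrite eqxx.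
- by move=> i j; case: (hE i j) => [|[]]; [left|right].
Qed.

(** [D - (J j j)%:M] kills the basis vector and commutes with [E], so on this vector the power
    reduces to [E ^+ n = 0]. *)
Lemma jordan_canonical_kill n (J : 'M[C]_n) (j : 'I_n) : jordan_canonical J ->
  (J - (J j j)%:M) ^+ n *m (delta_mx j 0 : 'cV_n) = 0.
Proof.
move=> /jordan_canonical_split/=; set D := diag_mx _ => -[DE En _].
set e := delta_mx j 0; set E := J - D in DE En.
have De : (D - (J j j)%:M) *m e = 0.
  rewrite mulmxBl mul_scalar_mx; apply/colP => i; rewrite mul_diag_mx !mxE.
  by case: eqP => [->|_]; rewrite ?mulr1 ?mulr0 ?subrr.
suff h k : (J - (J j j)%:M) ^+ k *m e = E ^+ k *m e by rewrite h En mul0mx.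
elim: k => [|k IH]; first by rewrite !expr0.
rewrite exprS -mulmxE -mulmxA IH.
have -> : J - (J j j)%:M = (D - (J j j)%:M) + E by rewrite /E [RHS]addrC addrA subrK.
rewrite mulmxDl [in RHS]exprS -[in RHS]mulmxE -[in RHS]mulmxA.
suff -> : (D - (J j j)%:M) *m (E ^+ k *m e) = 0 by rewrite add0r.
have cDE : GRing.comm (D - (J j j)%:M) (E ^+ k).
  apply: commrX; apply/commr_sym/commrB; first exact/commr_sym.
  by rewrite /GRing.comm -!mulmxE scalar_mxC.
by rewrite mulmxA mulmxE cDE -mulmxE -mulmxA De mulmx0.
Qed.

Section Similar.
Variables (n : nat) (A P J : 'M[C]_n).
Hypotheses (Pu : P \in unitmx) (JP : J = invmx P *m A *m P) (hJ : jordan_canonical J).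

Lemma similar_pow a k : (A - a%:M) ^+ k *m P = P *m (J - a%:M) ^+ k.
Proof.
have h1 : (A - a%:M) *m P = P *m (J - a%:M).
  by rewrite JP mulmxBr mulmxBl -!mulmxA mulKVmx // scalar_mxC.
elim: k => [|k IH]; first by rewrite !expr0 mulmx1 mul1mx.
by rewrite exprS exprSr -!mulmxE -mulmxA IH !mulmxA h1 -!mulmxA !mulmxE -exprS exprSr.
Qed.

Lemma jordan_columns j : (A - (J j j)%:M) ^+ n *m col j P = 0.
Proof.
by rewrite colE mulmxA similar_pow -mulmxA jordan_canonical_kill // mulmx0.
Qed.

(** The product of all [(A - (J j j)%:M) ^+ n] kills the columns of [P], which excludes other
    eigenvalues. Conversely the last nonzero [(A - (J j j)%:M) ^+ k *m col j P] is an
    eigenvector. *)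
Lemma similar_spectrum : spectrum A = [set J j j | j in setT].
Proof.
apply/seteqP; split=> [x /= /eigenvalueP_col[v v0 hv]|_ [j _ <-]].
  apply: contrapT => no; move/eqP: v0; apply.
  have K (w : 'cV[C]_n) : (\prod_(j <- index_enum 'I_n) (A - (J j j)%:M) ^+ n) *m w = 0.
    rewrite -[w](mulKVmx Pu); set u := invmx P *m w.
    have -> : u = \sum_j u j 0 *: delta_mx j 0.
      by rewrite [LHS]matrix_sum_delta; apply: eq_bigr => j _; rewrite big_ord1.
    rewrite !mulmx_sumr big1 // => j _.
    rewrite -!scalemxAr -colE (@gen_eigen_prod_kill _ _ _ _ _ _ _ j) ?scaler0 ?mem_index_enum //.
    exact: jordan_columns.
  apply: (@gen_eigen_prod_inj _ _ A _ (index_enum 'I_n) xpredT (fun j => J j j) x v 1 n) => //.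
  by move=> j _; apply/eqP => jx; apply: no; exists j.
apply/eigenvalueP_col; have h := jordan_columns j.
have c0 : col j P != 0.
  apply/eqP => c0; have := congr1 (mulmx (invmx P)) c0.
  rewrite colE mulmxA mulVmx // mul1mx mulmx0 => /matrixP/(_ j 0).
  by rewrite !mxE !eqxx => /eqP; rewrite oner_eq0.
have ex : exists k, (A - (J j j)%:M) ^+ k *m col j P == 0 by exists n; rewrite h.
have [[|k] /eqP hk kmin] := ex_minnP ex.
  by move: hk; rewrite expr0 mul1mx => hk; rewrite hk eqxx in c0.
exists ((A - (J j j)%:M) ^+ k *m col j P); first by apply/negP => /kmin; rewrite ltnn.
by rewrite mulmxA mulmxE -exprS.
Qed.

(* The Jordan-Chevalley decomposition is unique, whatever the numbers [lam i]
   (which may coincide). *)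
Lemma jordan_chevalley_rank r (lam : 'I_r -> C) (Pi : 'I_r -> 'M[C]_n) :
  \sum_i Pi i = 1%:M -> (forall i, GRing.comm A (Pi i)) ->
  (forall i, (A - (lam i)%:M) ^+ n *m Pi i = 0) ->
  let E := J - diag_mx (\row_i J i i) in
  A - \sum_i lam i *: Pi i = P *m E *m invmx P.
Proof.
move=> Pi1 APi kPi E; set La := \sum_i _.
have LaP : La *m P = P *m diag_mx (\row_i J i i).
  apply/matrixP => k j.
  have h := jordan_columns j.
  (* If the two numbers differ, [Pi i *m col j P] is killed by powers of two different shifts of
     [A], hence zero. *)
  have key i : lam i *: (Pi i *m col j P) = J j j *: (Pi i *m col j P).
    have [->//|ne] := eqVneq (lam i) (J j j).
    suff -> : Pi i *m col j P = 0 by rewrite !scaler0.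
    apply: (@gen_eigen_inj _ n A (lam i) (J j j) _ n n ne).
      by rewrite mulmxA kPi mul0mx.
    have cm : GRing.comm ((A - (J j j)%:M) ^+ n) (Pi i).
      apply/commr_sym/commrX/commrB; first exact/commr_sym.
      by rewrite /GRing.comm -!mulmxE scalar_mxC.
    by rewrite mulmxA mulmxE cm -mulmxE -mulmxA h mulmx0.
  have : La *m col j P = J j j *: col j P.
    rewrite mulmx_suml; under eq_bigr do rewrite -scalemxAl key.
    by rewrite -scaler_sumr -mulmx_suml Pi1 mul1mx.
  move=> /colP/(_ k); rewrite mulmx_col mxE => ->.
  by rewrite mul_mx_diag !mxE mulrC.
have -> : A = P *m J *m invmx P by rewrite JP !mulmxA mulmxV // mul1mx mulmxK.
by rewrite -{1}[La](mulmxK Pu) LaP -mulmxBl -mulmxBr.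
Qed.

End Similar.

(** The chain is listed backwards, eigenvector first, because [jordan_block] has its ones above the
    diagonal. *)
Lemma chain_jordan_block n (A : 'M[C]_n) a l (v : 'cV[C]_n) :
  (A - a%:M) ^+ l *m v = 0 ->
  let B : 'M[C]_(n, l) := \matrix_(i, j) ((A - a%:M) ^+ (l.-1 - j) *m v) i 0 in
  A *m B = B *m jordan_block l a.
Proof.
move=> hv B; pose N := A - a%:M.
have colB j : col j B = N ^+ (l.-1 - j) *m v by apply/colP => i; rewrite !mxE.
apply/matrixP => i j.
have h1 : (A *m B) i j = (A *m col j B) i 0 by rewrite mulmx_col [RHS]mxE.
rewrite h1 colB.
have -> : A = N + a%:M by rewrite /N subrK.
rewrite mulmxDl mul_scalar_mx mulmxA mulmxE -exprS -/N.
rewrite mxE [X in _ + X]mxE [in RHS]mxE (bigD1 j) //= [jordan_block _ _ j j]mxE eqxx.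
rewrite addrC; congr (_ + _); first by rewrite [B i j]mxE mulrC.
have jl := ltn_ord j.
case: (posnP j) => [j0|j0].
  rewrite j0 subn0 prednK ?(leq_ltn_trans _ jl) // hv mxE big1 // => k kj.
  by rewrite [jordan_block _ _ _ _]mxE (negbTE kj) j0 /= mulr0.
have kl : (j.-1 < l)%N by lia.
rewrite (bigD1 (Ordinal kl)) /=; last by rewrite -val_eqE /=; lia.
rewrite [jordan_block _ _ _ _]mxE -val_eqE /= prednK // eqxx.
have -> : (j.-1 == j :> nat) = false by lia.
rewrite mulr1 big1 ?addr0; last first.
  move=> k /andP[kj]; rewrite -val_eqE /= => kj'.
  rewrite [jordan_block _ _ _ _]mxE (negbTE kj).
  by have -> : (k.+1 == j :> nat) = false by [move: kj'; lia]; rewrite mulr0.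
rewrite [B _ _]mxE /=; congr ((_ ^+ _ *m _) _ _); lia.
Qed.

End JordanCanonical.

(** * Gap metric *)

Section MatrixLimits.
Variable R : realType.
Local Notation C := (Cplx R).
Variables (T : Type) (F : set_system T).
Context {FF : Filter F}.

(** The filter is arbitrary: both the neighbourhoods of a point and their trace outside [coal A]
    occur. *)
Definition mx_cvg p q (M : T -> 'M[C]_(p, q)) (M0 : 'M[C]_(p, q)) :=
  forall i j, M z i j @[z --> F] --> M0 i j.

Lemma mx_cvg_cst p q (M : 'M[C]_(p, q)) : mx_cvg (fun=> M) M.
Proof. by move=> i j; apply: cvg_cst. Qed.

Lemma sum_cvg (K : numFieldType) (U : normedModType K) (I : Type) (r : seq I)
    (P : pred I) (f : I -> T -> U) (a : I -> U) :
  (forall i, P i -> f i z @[z --> F] --> a i) ->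
  \sum_(i <- r | P i) f i z @[z --> F] --> \sum_(i <- r | P i) a i.
Proof.
move=> h; elim: r => [|i r IH].
  by rewrite big_nil; under eq_fun do rewrite big_nil; exact: cvg_cst.
rewrite big_cons; under eq_fun do rewrite big_cons.
case: (boolP (P i)) => Pi; last exact: IH.
exact: (cvgD (h i Pi) IH).
Qed.

Lemma cprod_cvg (I : Type) (r : seq I) (P : pred I) (f : I -> T -> C) (a : I -> C) :
  (forall i, P i -> f i z @[z --> F] --> a i) ->
  \prod_(i <- r | P i) f i z @[z --> F] --> \prod_(i <- r | P i) a i.
Proof.
move=> h; elim: r => [|i r IH].
  by rewrite big_nil; under eq_fun do rewrite big_nil; exact: cvg_cst.
rewrite big_cons; under eq_fun do rewrite big_cons.
case: (boolP (P i)) => Pi; last exact: IH.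
exact: (cvgM (h i Pi) IH).
Qed.

Lemma mx_cvgM p q r (M : T -> 'M[C]_(p, q)) (N : T -> 'M[C]_(q, r)) M0 N0 :
  mx_cvg M M0 -> mx_cvg N N0 -> mx_cvg (fun z => M z *m N z) (M0 *m N0).
Proof.
move=> hM hN i j; rewrite mxE; under eq_fun do rewrite mxE.
by apply: sum_cvg => k _; apply: cvgM; [exact: hM|exact: hN].
Qed.

Lemma mx_cvgB p q (M N : T -> 'M[C]_(p, q)) M0 N0 :
  mx_cvg M M0 -> mx_cvg N N0 -> mx_cvg (fun z => M z - N z) (M0 - N0).
Proof.
move=> hM hN i j; rewrite !mxE; under eq_fun do rewrite !mxE.
by apply: cvgB; [exact: hM|exact: hN].
Qed.

Lemma conj_cvg (f : T -> C) (a : C) :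
  f z @[z --> F] --> a -> Num.conj (f z) @[z --> F] --> Num.conj a.
Proof.
move=> /cvg_nrP h; apply/cvg_nrP => e /h; apply: filterS => z.
by rewrite -rmorphB /nr norm_conjC.
Qed.

Lemma mx_cvg_adj p q (M : T -> 'M[C]_(p, q)) M0 :
  mx_cvg M M0 -> mx_cvg (fun z => map_mx Num.conj (M z)^T) (map_mx Num.conj M0^T).
Proof.
move=> hM i j; rewrite !mxE; under eq_fun do rewrite !mxE.
exact: conj_cvg.
Qed.

Lemma det_cvg n (M : T -> 'M[C]_n) M0 : mx_cvg M M0 -> \det (M z) @[z --> F] --> \det M0.
Proof.
move=> hM; apply: sum_cvg => s _; apply: cvgM; first exact: cvg_cst.
by apply: cprod_cvg => i _; exact: hM.
Qed.

Lemma cvg_neq0 (f : T -> C) (a : C) : f z @[z --> F] --> a -> a != 0 ->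
  \forall z \near F, f z != 0.
Proof.
move=> /cvg_nrP h; rewrite -nr_gt0 => /h; apply: filterS => z.
by case: eqP => // ->; rewrite sub0r nrN ltxx.
Qed.

Lemma mx_cvg_unit n (M : T -> 'M[C]_n) M0 : mx_cvg M M0 -> M0 \in unitmx ->
  \forall z \near F, M z \in unitmx.
Proof.
move=> hM; rewrite unitmxE unitfE => /(cvg_neq0 (det_cvg hM)).
by apply: filterS => z; rewrite unitmxE unitfE.
Qed.

Lemma mx_cvgV n (M : T -> 'M[C]_n) M0 : mx_cvg M M0 -> M0 \in unitmx ->
  mx_cvg (fun z => invmx (M z)) (invmx M0).
Proof.
move=> hM uM i j; have un := mx_cvg_unit hM uM.
have d0 : \det M0 != 0 by rewrite -unitfE -unitmxE.
rewrite /invmx uM !mxE /cofactor.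
have : (\det (M z))^-1 * ((-1) ^+ (j + i) * \det (row' j (col' i (M z)))) @[z --> F]
    --> (\det M0)^-1 * ((-1) ^+ (j + i) * \det (row' j (col' i M0))).
  apply: cvgM; first by apply: cvgV; [exact: d0|exact: det_cvg].
  apply: cvgM; first exact: cvg_cst.
  by apply: det_cvg => k l; rewrite !mxE; under eq_fun do rewrite !mxE; exact: hM.
apply: cvg_trans; apply: near_eq_cvg; apply: filterS un => z uz.
by rewrite uz !mxE.
Qed.

Lemma rank_lsc p q (M : T -> 'M[C]_(p, q)) M0 : mx_cvg M M0 ->
  \forall z \near F, (\rank M0 <= \rank (M z))%N.
Proof.
move=> hM; have [L [N h]] := rank_minor M0.
have h1 := mx_cvgM (mx_cvgM (@mx_cvg_cst _ _ L) hM) (@mx_cvg_cst _ _ N).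
have := mx_cvg_unit h1; rewrite h unitmx1 => /(_ isT).
by apply: filterS => z; exact: rank_ge_minor.
Qed.

End MatrixLimits.

(** * Orthogonal projections and the gap *)

Section Gap.
Variables (R : realType) (n : nat).
Local Notation C := (Cplx R).
Local Notation V := ('cV[C]_n).
Implicit Types (v w : V) (L : {vspace V}).

Local Notation "M ^h" := (map_mx Num.conj M^T) (at level 3, format "M ^h").

Lemma hnE v : hermitian_norm v = Num.sqrt (\sum_i nr (v i 0) ^+ 2).
Proof. by []. Qed.

Lemma hn_ge0 v : 0 <= hermitian_norm v.
Proof. exact: sqrtr_ge0. Qed.

Lemma nr_entry_le_hn v i : nr (v i 0) <= hermitian_norm v.
Proof.
rewrite hnE -[leLHS]ger0_norm ?nr_ge0 // -sqrtr_sqr ler_wsqrtr //.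
by rewrite (bigD1 i) //= lerDl sumr_ge0 // => j _; exact: sqr_ge0.
Qed.

Lemma nr_entry_sub v w i : nr (v i 0 - w i 0) <= hermitian_norm (v - w).
Proof. by have := nr_entry_le_hn (v - w) i; rewrite !mxE. Qed.

Lemma nr_half_half (a b c : C) (e : R) :
  nr (c - a) <= e / 2 -> nr (c - b) <= e / 2 -> nr (a - b) <= e.
Proof.
move=> h1 h2; apply: le_trans (nr_subD _ _ c) _.
by rewrite [e]splitr nrBC; apply: lerD.
Qed.

Lemma hn_le_sum v : hermitian_norm v <= \sum_i nr (v i 0).
Proof.
have s0 : 0 <= \sum_i nr (v i 0) by apply: sumr_ge0 => i _; exact: nr_ge0.
rewrite hnE -[leRHS]ger0_norm // -sqrtr_sqr ler_wsqrtr //.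
rewrite [leRHS]expr2 big_distrl /=; apply: ler_sum => i _; rewrite expr2.
rewrite ler_wpM2l ?nr_ge0 // (bigD1 i) //= lerDl sumr_ge0 // => j _; exact: nr_ge0.
Qed.

Lemma hnZ (a : C) v : hermitian_norm (a *: v) = nr a * hermitian_norm v.
Proof.
rewrite !hnE; under eq_bigr do rewrite mxE nrM exprMn.
by rewrite -big_distrr /= sqrtrM ?sqr_ge0 // sqrtr_sqr ger0_norm ?nr_ge0.
Qed.

Lemma hn_eq0 v : hermitian_norm v = 0 -> v = 0.
Proof.
move=> h; apply/colP => i; rewrite mxE; apply/eqP.
by rewrite -nr_eq0 eq_le nr_ge0 -h nr_entry_le_hn.
Qed.

Lemma hnN v : hermitian_norm (- v) = hermitian_norm v.
Proof. by rewrite -scaleN1r hnZ nrN nr1 mul1r. Qed.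

Lemma hn_image_le (f : 'End(V)) v :
  hermitian_norm (f v) <= (\sum_i \sum_j nr ((f (delta_mx j 0)) i 0)) * hermitian_norm v.
Proof.
apply: le_trans (hn_le_sum _) _; rewrite big_distrl /=; apply: ler_sum => i _.
have -> : f v = \sum_j v j 0 *: f (delta_mx j 0).
  have {1}-> : v = \sum_j v j 0 *: delta_mx j 0.
    by rewrite [LHS]matrix_sum_delta; apply: eq_bigr => j _; rewrite big_ord1.
  by rewrite linear_sum; apply: eq_bigr => j _; rewrite linearZ.
rewrite summxE big_distrl /=; apply: le_trans (nr_sum _ _ _) _.
apply: ler_sum => j _; rewrite mxE nrM mulrC ler_wpM2l ?nr_ge0 //.
exact: nr_entry_le_hn.
Qed.

Lemma operator_norm_has_sup (f : 'End(V)) :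
  has_sup [set hermitian_norm (f v) | v in [set v | hermitian_norm v <= 1]].
Proof.
split.
  exists 0; exists 0; last by rewrite linear0 -[0 in LHS](scale0r 0) hnZ nr0 mul0r.
  by rewrite /= -[0 in X in X <= _](scale0r 0) hnZ nr0 mul0r ler01.
exists (\sum_i \sum_j nr ((f (delta_mx j 0)) i 0)) => _ [v /= v1 <-].
apply: le_trans (hn_image_le _ _) _; rewrite ler_piMr // sumr_ge0 // => i _.
by rewrite sumr_ge0 // => j _; exact: nr_ge0.
Qed.

Lemma operator_norm_le (f : 'End(V)) :
  operator_norm f <= \sum_i \sum_j nr ((f (delta_mx j 0)) i 0).
Proof.
have [ne _] := operator_norm_has_sup f.
apply: sup_le_ub => // _ [v /= v1 <-].
apply: le_trans (hn_image_le _ _) _; rewrite ler_piMr // sumr_ge0 // => i _.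
by rewrite sumr_ge0 // => j _; exact: nr_ge0.
Qed.

Lemma operator_norm_ge0 (f : 'End(V)) : 0 <= operator_norm f.
Proof.
have hs := operator_norm_has_sup f; apply: le_trans (hn_ge0 (f 0)) _.
apply: sup_upper_bound => //; exists 0 => //=.
by rewrite -[0 in X in X <= _](scale0r 0) hnZ nr0 mul0r ler01.
Qed.

Lemma hn_operator_norm (f : 'End(V)) v :
  hermitian_norm (f v) <= operator_norm f * hermitian_norm v.
Proof.
have [v0|v0] := eqVneq (hermitian_norm v) 0.
  by rewrite (hn_eq0 v0) linear0 -[0 in X in X <= _](scale0r 0) hnZ nr0 mul0r mulr_ge0 ?hn_ge0 ?operator_norm_ge0.
have vp : 0 < hermitian_norm v by rewrite lt_neqAle eq_sym v0 hn_ge0.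
rewrite -ler_pdivrMr // mulrC.
have n1 : nr ((hermitian_norm v)^-1%:C : C) = (hermitian_norm v)^-1.
  by rewrite nr_real gtr0_norm // invr_gt0.
rewrite -n1 -hnZ -linearZ; apply: sup_upper_bound; first exact: operator_norm_has_sup.
by exists ((hermitian_norm v)^-1%:C *: v) => //=; rewrite hnZ n1 mulVf.
Qed.

Lemma adjmxM m p q (A : 'M[C]_(m, p)) (B : 'M[C]_(p, q)) : (A *m B)^h = B^h *m A^h.
Proof. by rewrite trmx_mul map_mxM. Qed.

Lemma adjmx_self_eq0 v : v^h *m v = 0 -> v = 0.
Proof.
move=> /matrixP/(_ 0 0); rewrite !mxE => h.
have : \sum_i `|v i 0| ^+ 2 == 0.
  by rewrite -[X in _ == X]h; apply/eqP; apply: eq_bigr => i _; rewrite !mxE normCKC.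
rewrite psumr_eq0 => [/allP h0|i _]; last exact: exprn_ge0.
apply/colP => i; rewrite mxE; have := h0 i (mem_index_enum i).
by rewrite /= expf_eq0 /= normr_eq0 => /eqP.
Qed.

Lemma mem_orthogonal_complement L v :
  v \in orthogonal_complement L <-> forall u, u \in L -> u^h *m v = 0.
Proof.
have E (s : seq V) : (v \in \bigcap_(u <- s) lker (linfun (mulmx u^h)))%VS =
    all (fun u => u^h *m v == 0) s.
  elim: s => [|u s IH]; first by rewrite big_nil memvf.
  by rewrite big_cons memv_cap mem_lker_mulmx IH.
rewrite /orthogonal_complement E; split=> [/allP h u uL|h]; last first.
  by apply/allP => u /vbasis_mem /h ->.
rewrite (coord_vbasis uL) linear_sum /= map_mx_sum mulmx_suml big1 // => i _.
rewrite linearZ /= map_mxZ -scalemxAl.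
suff -> : ((vbasis L)`_i)^h *m v = 0 by rewrite scaler0.
by apply/eqP/h/mem_nth; rewrite size_tuple.
Qed.

Lemma capv_orthogonal_complement L : (L :&: orthogonal_complement L = 0)%VS.
Proof.
apply/eqP; rewrite -subv0; apply/subvP => v; rewrite memv_cap => /andP[vL].
by move=> /mem_orthogonal_complement/(_ v vL)/adjmx_self_eq0 ->; rewrite mem0v.
Qed.

(** The normal equations. No orthonormal basis is chosen, so the formula is continuous in the frame
    [B]. *)
Lemma orthogonal_projectionE m (B : 'M[C]_(n, m)) L :
  (forall v, v \in L <-> exists x, v = B *m x) -> (forall x : 'cV_m, B *m x = 0 -> x = 0) ->
  B^h *m B \in unitmx /\
  forall v, orthogonal_projection L v = B *m invmx (B^h *m B) *m B^h *m v.
Proof.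
move=> LB Binj.
have adjK p q (M : 'M[C]_(p, q)) : (M^h)^h = M.
  by apply/matrixP => i j; rewrite !mxE conjCK.
have u : B^h *m B \in unitmx.
  apply: contraT => /nonunit_ker[x x0 hx]; move/eqP: x0; case.
  apply/Binj/adjmx_self_eq0; rewrite adjmxM -mulmxA [_ *m (B *m x)]mulmxA hx.
  by rewrite mulmx0.
split=> // v; set w := B *m _ *m _ *m v.
have wL : w \in L by apply/LB; exists (invmx (B^h *m B) *m B^h *m v); rewrite !mulmxA.
have wo : v - w \in orthogonal_complement L.
  apply/mem_orthogonal_complement => _ /LB[x ->].
  rewrite adjmxM mulmxBr /w -!mulmxA.
  by rewrite (mulmxA B^h B) (mulmxA (B^h *m B)) mulmxV // mul1mx subrr.
have cap := capv_orthogonal_complement L.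
rewrite -[v in LHS](subrK w) addrC /orthogonal_projection linearD /= daddv_pi_id //.
have := daddv_pi_add cap (subvP (addvSr _ _) _ wo).
rewrite [X in _ + X]daddv_pi_id //; last by rewrite capvC.
by move=> /eqP; rewrite -subr_eq0 addrK => /eqP ->; rewrite addr0.
Qed.

Definition basis_mx L : 'M[C]_(n, \dim L) := \matrix_(i, j) (vbasis L)`_j i 0.

Lemma mul_basis_mx L (x : 'cV_(\dim L)) : basis_mx L *m x = \sum_j x j 0 *: (vbasis L)`_j.
Proof.
apply/colP => i; rewrite mxE summxE; apply: eq_bigr => j _.
by rewrite !mxE mulrC.
Qed.

Lemma mem_basis_mx L v : v \in L <-> exists x, v = basis_mx L *m x.
Proof.
split=> [vL|[x ->]].
  exists (\col_j coord (vbasis L) j v); rewrite mul_basis_mx {1}(coord_vbasis vL).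
  by apply: eq_bigr => j _; rewrite mxE.
rewrite mul_basis_mx memv_suml // => j _; rewrite memvZ // vbasis_mem // mem_nth //.
by rewrite size_tuple.
Qed.

Lemma basis_mx_inj L (x : 'cV_(\dim L)) : basis_mx L *m x = 0 -> x = 0.
Proof.
rewrite mul_basis_mx => h; apply/colP => i; rewrite mxE.
have /freeP f := basis_free (vbasisP L).
exact: (f (fun j => x j 0) h i).
Qed.

Lemma orthogonal_projection_mem L v : orthogonal_projection L v \in L.
Proof. exact: memv_pi. Qed.

Lemma orthogonal_projection_id L v : v \in L -> orthogonal_projection L v = v.
Proof. exact/daddv_pi_id/capv_orthogonal_complement. Qed.

Local Opaque orthogonal_projection operator_norm.

Lemma gap_bound L1 L2 v :
  hermitian_norm (orthogonal_projection L1 v - orthogonal_projection L2 v) <=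
  gap L1 L2 * hermitian_norm v.
Proof.
have := hn_operator_norm (orthogonal_projection L1 - orthogonal_projection L2) v.
by rewrite add_lfunE opp_lfunE.
Qed.

Lemma gap_ge0 L1 L2 : 0 <= gap L1 L2.
Proof. exact: operator_norm_ge0. Qed.

Lemma gap_bound_entry L1 L2 v i :
  nr ((orthogonal_projection L1 v) i 0 - (orthogonal_projection L2 v) i 0) <=
  gap L1 L2 * hermitian_norm v.
Proof.
exact: le_trans (nr_entry_sub _ _ i) (gap_bound _ _ v).
Qed.

Lemma gap_bound_id L1 L2 v : v \in L1 ->
  hermitian_norm (v - orthogonal_projection L2 v) <= gap L1 L2 * hermitian_norm v.
Proof.
by move=> vL; rewrite -{1}(orthogonal_projection_id vL); exact: gap_bound.
Qed.

(** A vector of [L1] killed by the projection onto [L2] has norm at most [gap L1 L2] times itself,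
    so this projection is injective on [L1]. *)
Lemma gap_dim_le L1 L2 : gap L1 L2 < 1 -> (\dim L1 <= \dim L2)%N.
Proof.
move=> g1; rewrite -(limg_ker_dim (orthogonal_projection L2) L1).
have -> : (L1 :&: lker (orthogonal_projection L2) = 0)%VS.
  apply/eqP; rewrite -subv0; apply/subvP => v; rewrite memv_cap memv_ker => /andP[vL /eqP v2].
  have h : hermitian_norm v <= gap L1 L2 * hermitian_norm v.
    by have := gap_bound_id L2 vL; rewrite v2 subr0.
  have [v0|v0] := eqVneq (hermitian_norm v) 0; first by rewrite (hn_eq0 v0) mem0v.
  have vp : 0 < hermitian_norm v by rewrite lt_neqAle eq_sym v0 hn_ge0.
  by move: h; rewrite ler_pMl // leNgt g1.
rewrite dimv0 add0n; apply: dimvS; apply/subvP => _ /memv_imgP[v _ ->].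
exact: orthogonal_projection_mem.
Qed.

Lemma gapC L1 L2 : gap L1 L2 = gap L2 L1.
Proof.
have h (f g : 'End(V)) v : hermitian_norm ((f - g) v) = hermitian_norm ((g - f) v).
  have -> : f - g = - (g - f) by rewrite opprB.
  by rewrite opp_lfunE hnN.
have E (f g : 'End(V)) : operator_norm (f - g) = operator_norm (g - f).
  Transparent operator_norm.
  congr (sup _); apply/seteqP.
  by split=> _ [v hv <-]; exists v => //; exact: h.
exact: E.
Qed.

Lemma gap_dim L1 L2 : gap L1 L2 < 1 -> \dim L1 = \dim L2.
Proof.
move=> g; have g' : gap L2 L1 < 1 by rewrite -(gapC L1 L2).
by apply/eqP; rewrite eqn_leq (gap_dim_le g) (gap_dim_le g').
Qed.

Section Limits.
Variables (T : Type) (F : set_system T).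
Context {FF : ProperFilter F}.

Lemma gap_cvg_unique (K : T -> {vspace V}) L L' :
  gap_cvg F K L -> gap_cvg F K L' -> L = L'.
Proof.
move=> h h'.
have gle (l : {vspace V}) : gap_cvg F K l -> forall e, 0 < e -> \forall z \near F, gap (K z) l < e.
  move=> /cvgrPdist_lt hl e e0; have := hl e e0; apply: filterS => z.
  by rewrite sub0r normrN; apply: le_lt_trans; exact: ler_norm.
have E v : orthogonal_projection L v = orthogonal_projection L' v.
  apply/colP => i; apply/eqP; rewrite -subr_eq0 -nr_eq0 eq_le nr_ge0 andbT.
  apply/ler_addgt0Pr => e e0; rewrite add0r.
  pose d := e / (2 * (hermitian_norm v + 1)).
  have hv1 : 0 < hermitian_norm v + 1 by rewrite ltr_wpDl ?hn_ge0.
  have d0 : 0 < d by rewrite divr_gt0 // mulr_gt0.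
  have [z [g1 g2]] := filter_ex (filterI (gle L h d d0) (gle L' h' d d0)).
  have b (l : {vspace V}) : gap (K z) l < d ->
      nr ((orthogonal_projection (K z) v) i 0 - (orthogonal_projection l v) i 0) <= e / 2.
    move=> g; apply: le_trans (gap_bound_entry _ _ _ _) _.
    apply: (@le_trans _ _ (d * (hermitian_norm v + 1))).
      apply: ler_pM; [exact: gap_ge0|exact: hn_ge0|exact: ltW|by rewrite lerDl].
    rewrite /d le_eqVlt; apply/orP; left; apply/eqP; field.
    exact: lt0r_neq0.
  exact: nr_half_half (b L g1) (b L' g2).
apply/vspaceP => v; apply/idP/idP => vL.
  by rewrite -(orthogonal_projection_id vL) E orthogonal_projection_mem.
by rewrite -(orthogonal_projection_id vL) -E orthogonal_projection_mem.
Qed.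

(** By the normal equations the projections converge entrywise, and the operator norm is at most the
    sum of the moduli of the entries. *)
Lemma gap_cvg_frame m (K : T -> {vspace V}) L (B : T -> 'M[C]_(n, m)) B0 :
  mx_cvg F B B0 -> (forall v, v \in L <-> exists x, v = B0 *m x) ->
  (forall x : 'cV_m, B0 *m x = 0 -> x = 0) ->
  (\forall z \near F, forall v, v \in K z <-> exists x, v = B z *m x) ->
  gap_cvg F K L.
Proof.
move=> hB LB B0inj KB.
have [u0 P0] := orthogonal_projectionE LB B0inj.
have cG : mx_cvg F (fun z => (B z)^h *m B z) (B0^h *m B0).
  exact: mx_cvgM (mx_cvg_adj hB) hB.
have un := mx_cvg_unit cG u0.
pose P (D : 'M[C]_(n, m)) := D *m invmx (D^h *m D) *m D^h.
have cP : mx_cvg F (fun z => P (B z)) (P B0).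
  exact: mx_cvgM (mx_cvgM hB (mx_cvgV cG u0)) (mx_cvg_adj hB).
have cS : \sum_i \sum_j nr ((P (B z) - P B0) i j) @[z --> F] --> (0 : R).
  have E : \sum_(i < n) \sum_(j < n) (0 : R) = 0 by rewrite big1 // => i _; rewrite big1.
  have h i j : nr ((P (B z) - P B0) i j) @[z --> F] --> (0 : R).
    have hc : mx_cvg F (fun z => P (B z) - P B0) (P B0 - P B0).
      by apply: mx_cvgB cP _; apply: mx_cvg_cst.
    have := hc i j; rewrite subrr [X in _ --> X -> _]mxE => /cvg_nrP h.
    apply/cvgrPdist_lt => e e0; have := h e e0; apply: filterS => z.
    by rewrite subr0 sub0r normrN ger0_norm ?nr_ge0.
  rewrite -[X in _ --> X]E; refine (@sum_cvg _ F _ R R _ (index_enum 'I_n) xpredT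
    (fun i z => \sum_j nr ((P (B z) - P B0) i j)) (fun=> \sum_(j < n) 0) _) => i _.
  by apply: (@sum_cvg _ F _ R R^o _ _ _ (fun j z => nr ((P (B z) - P B0) i j)) (fun=> 0)).
apply/cvgrPdist_le => e e0; move/cvgrPdist_le: cS => /(_ e e0).
apply: (@filterS3 _ F _) (un _) KB => z uz Kz.
have uz' : (B z)^h *m B z \in unitmx := uz.
have inj (x : 'cV_m) : B z *m x = 0 -> x = 0.
  by move=> hx; rewrite -(mulKmx uz' x) -mulmxA hx !mulmx0.
have [_ Pz] := orthogonal_projectionE Kz inj.
have hz : gap (K z) L <= \sum_i \sum_j nr ((P (B z) - P B0) i j).
  apply: le_trans (operator_norm_le _) _.
  rewrite le_eqVlt; apply/orP; left; apply/eqP; apply: eq_bigr => i _; apply: eq_bigr => j _.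
  rewrite add_lfunE opp_lfunE Pz P0 -/(P (B z)) -/(P B0) -mulmxBl.
  by rewrite -colE mxE.
rewrite !sub0r !normrN (ger0_norm (gap_ge0 _ _)) => hS.
exact: le_trans hz (le_trans (ler_norm _) hS).
Qed.

End Limits.

(* The factor [2 n] absorbs the comparison between the hermitian norm and the
   sum of the moduli of the coordinates. *)
Lemma gap_entry_bound L1 L2 v i : gap L1 L2 * (2 * n%:R) <= 1 -> v \in L1 ->
  nr (v i 0) <= 2 * \sum_j nr ((orthogonal_projection L2 v) j 0).
Proof.
move=> g vL; set s := \sum_j nr (v j 0); set b := \sum_j _.
have n0 : (0 < n)%N by case: n i => [[]|].
have hs : hermitian_norm v <= s := hn_le_sum v.
have : s <= n%:R * (gap L1 L2 * s) + b.
  have -> : n%:R * (gap L1 L2 * s) = \sum_(j < n) gap L1 L2 * s.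
    by rewrite sumr_const card_ord mulr_natl.
  rewrite -big_split /=; apply: ler_sum => j _.
  have h := nr_entry_sub v (orthogonal_projection L2 v) j.
  have h2 : hermitian_norm (v - orthogonal_projection L2 v) <= gap L1 L2 * s.
    by apply: le_trans (gap_bound_id L2 vL) _; rewrite ler_wpM2l // gap_ge0.
  have := nr_lbB (v j 0) ((orthogonal_projection L2 v) j 0); lra.
have s0 : 0 <= s by apply: le_trans hs; exact: hn_ge0.
have hi : nr (v i 0) <= s.
  by rewrite /s (bigD1 i) //= lerDl sumr_ge0 // => j _; exact: nr_ge0.
have : n%:R * (gap L1 L2 * s) * 2 <= s.
  have -> : n%:R * (gap L1 L2 * s) * 2 = (gap L1 L2 * (2 * n%:R)) * s by ring.
  by rewrite ler_piMl.
lra.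
Qed.

End Gap.

(** * Holomorphic matrices *)

Section HolomorphicMatrices.
Variables (R : realType) (X : complexManifold R).
Local Notation C := (Cplx R).
Implicit Types (x y : X).

Lemma hmx_cst p q (M : 'M[C]_(p, q)) x : holomorphic_mx_at (fun _ : X => M) x.
Proof. by move=> i j; exact: holomorphic_at_cst. Qed.

Lemma holomorphic_mx_atM p q r (M : X -> 'M[C]_(p, q)) (N : X -> 'M[C]_(q, r)) x :
  holomorphic_mx_at M x -> holomorphic_mx_at N x ->
  holomorphic_mx_at (fun y => M y *m N y) x.
Proof.
move=> hM hN i j; under [fun y => _]eq_fun do rewrite mxE.
by apply: holomorphic_at_sum => k _; apply: holomorphic_atM; [exact: hM|exact: hN].
Qed.

Lemma holomorphic_mx_at_mull p q r (P : 'M[C]_(p, q)) (M : X -> 'M[C]_(q, r)) x :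
  holomorphic_mx_at M x -> holomorphic_mx_at (fun y => P *m M y) x.
Proof. by move=> hM; apply: holomorphic_mx_atM => //; exact: hmx_cst. Qed.

Lemma holomorphic_mx_at_mulr p q r (M : X -> 'M[C]_(p, q)) (P : 'M[C]_(q, r)) x :
  holomorphic_mx_at M x -> holomorphic_mx_at (fun y => M y *m P) x.
Proof. by move=> hM; apply: holomorphic_mx_atM => //; exact: hmx_cst. Qed.

Lemma holomorphic_mx_atD p q (M N : X -> 'M[C]_(p, q)) x :
  holomorphic_mx_at M x -> holomorphic_mx_at N x ->
  holomorphic_mx_at (fun y => M y + N y) x.
Proof.
move=> hM hN i j; under [fun y => _]eq_fun do rewrite mxE.
by apply: holomorphic_atD; [exact: hM|exact: hN].
Qed.

Lemma holomorphic_mx_atB p q (M N : X -> 'M[C]_(p, q)) x :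
  holomorphic_mx_at M x -> holomorphic_mx_at N x ->
  holomorphic_mx_at (fun y => M y - N y) x.
Proof.
move=> hM hN i j; under [fun y => _]eq_fun do rewrite !mxE.
by apply: holomorphic_atB; [exact: hM|exact: hN].
Qed.

Lemma holomorphic_mx_atZ p q (f : X -> C) (M : X -> 'M[C]_(p, q)) x :
  holomorphic_at f x -> holomorphic_mx_at M x ->
  holomorphic_mx_at (fun y => f y *: M y) x.
Proof.
move=> hf hM i j; under [fun y => _]eq_fun do rewrite !mxE.
by apply: holomorphic_atM; [exact: hf|exact: hM].
Qed.

Lemma holomorphic_mx_at_sum (I : Type) (r : seq I) p q (M : I -> X -> 'M[C]_(p, q)) x :
  (forall i, holomorphic_mx_at (M i) x) ->
  holomorphic_mx_at (fun y => \sum_(i <- r) M i y) x.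
Proof.
move=> hM i j; under [fun y => _]eq_fun do rewrite summxE.
by apply: holomorphic_at_sum => k _; exact: hM.
Qed.

Lemma holomorphic_mx_at_scalar n (f : X -> C) x :
  holomorphic_at f x -> holomorphic_mx_at (fun y => (f y)%:M : 'M[C]_n) x.
Proof.
move=> hf i j; under [fun y => _]eq_fun do rewrite mxE.
by case: (i == j); [exact: hf|exact: holomorphic_at_cst].
Qed.

Lemma holomorphic_mx_atX n k (M : X -> 'M[C]_n) x :
  holomorphic_mx_at M x -> holomorphic_mx_at (fun y => M y ^+ k) x.
Proof.
move=> hM; elim: k => [|k IH]; first exact: hmx_cst.
under [fun y => _]eq_fun do rewrite exprS -mulmxE.
exact: holomorphic_mx_atM.
Qed.

Lemma holomorphic_mx_at_prod (I : Type) (r : seq I) (P : pred I) n (M : I -> X -> 'M[C]_n) x :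
  (forall i, holomorphic_mx_at (M i) x) ->
  holomorphic_mx_at (fun y => \prod_(i <- r | P i) M i y) x.
Proof.
move=> hM; elim: r => [|i r IH].
  by under [fun y => _]eq_fun do rewrite big_nil; exact: hmx_cst.
under [fun y => _]eq_fun do rewrite big_cons -mulmxE.
case: (P i); last exact: IH.
exact: holomorphic_mx_atM (hM i) IH.
Qed.

Lemma holomorphic_at_det n (M : X -> 'M[C]_n) x :
  holomorphic_mx_at M x -> holomorphic_at (fun y => \det (M y)) x.
Proof.
move=> hM; apply: holomorphic_at_sum => s _.
apply: holomorphic_atM; first exact: holomorphic_at_cst.
by apply: holomorphic_at_prod => i _; exact: hM.
Qed.

Lemma holomorphic_mx_at_adj n (M : X -> 'M[C]_n) x :
  holomorphic_mx_at M x -> holomorphic_mx_at (fun y => \adj (M y)) x.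
Proof.
move=> hM i j; under [fun y => _]eq_fun do rewrite mxE.
apply: holomorphic_atM; first exact: holomorphic_at_cst.
apply: holomorphic_at_det => k l; under [fun y => _]eq_fun do rewrite !mxE.
exact: hM.
Qed.

Lemma holomorphic_mx_at_cvg p q (M : X -> 'M[C]_(p, q)) x :
  holomorphic_mx_at M x -> mx_cvg (nbhs x) M (M x).
Proof. by move=> hM i j; exact: holomorphic_at_cvg. Qed.

Lemma holomorphic_mx_at_near_eq p q (M N : X -> 'M[C]_(p, q)) x :
  (\forall y \near x, M y = N y) -> holomorphic_mx_at M x -> holomorphic_mx_at N x.
Proof.
move=> MN hM i j; apply: holomorphic_at_near_eq (hM i j).
by apply: filterS MN => y ->.
Qed.

Lemma near_ord_forall (T : Type) (F : set_system T) (FF : Filter F) n (P : 'I_n -> T -> Prop) :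
  (forall i, \forall y \near F, P i y) -> \forall y \near F, forall i, P i y.
Proof. exact: filter_forall. Qed.

Lemma holomorphic_mx_at_near p q (M : X -> 'M[C]_(p, q)) x :
  holomorphic_mx_at M x -> \forall y \near x, holomorphic_mx_at M y.
Proof.
move=> hM; apply: near_ord_forall => i; apply: near_ord_forall => j.
exact: holomorphic_at_near.
Qed.

Lemma near_unitmx n (M : X -> 'M[C]_n) x : holomorphic_mx_at M x -> M x \in unitmx ->
  \forall y \near x, M y \in unitmx.
Proof. by move=> /holomorphic_mx_at_cvg; exact: mx_cvg_unit. Qed.

Lemma holomorphic_mx_atV n (M : X -> 'M[C]_n) x : holomorphic_mx_at M x ->
  M x \in unitmx -> holomorphic_mx_at (fun y => invmx (M y)) x.
Proof.
move=> hM uM.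
apply: (@holomorphic_mx_at_near_eq _ _ (fun y => (\det (M y))^-1 *: \adj (M y))).
  by apply: filterS (near_unitmx hM uM) => y uy; rewrite /invmx uy.
apply: holomorphic_mx_atZ; last exact: holomorphic_mx_at_adj.
apply: holomorphic_atV; first exact: holomorphic_at_det.
by rewrite -unitfE -unitmxE.
Qed.

Lemma injective_rank m n (M : 'M[C]_(n, m)) : (forall u : 'cV_m, M *m u = 0 -> u = 0) ->
  \rank M = m.
Proof.
move=> inj; apply/eqP; rewrite eqn_leq rank_leq_col leqNgt; apply/negP => lt.
have : cokermx M != 0 by rewrite -mxrank_eq0 mxrank_coker subn_eq0 -ltnNge.
move=> /eqP; apply; apply/matrixP => i j.
have hc : col j (cokermx M) = 0.
  by apply: inj; rewrite mulmx_col mulmx_coker; apply/colP => k; rewrite !mxE.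
by move/colP/(_ i): hc; rewrite mxE => ->; rewrite !mxE.
Qed.

Lemma near_injective m n (M : X -> 'M[C]_(n, m)) x : holomorphic_mx_at M x ->
  (forall u : 'cV_m, M x *m u = 0 -> u = 0) ->
  \forall y \near x, forall u : 'cV_m, M y *m u = 0 -> u = 0.
Proof.
move=> /holomorphic_mx_at_cvg/rank_lsc hM /injective_rank rx.
apply: filterS hM => y; rewrite rx => ry u hu.
have : row_full (M y) by rewrite /row_full eqn_leq rank_leq_col.
by case/row_fullP => D DM; rewrite -[u]mul1mx -DM -mulmxA hu mulmx0.
Qed.

Lemma eq0_of_dense (f : X -> C) x : holomorphic_at f x ->
  (forall W, nbhs x W -> exists2 z, W z & f z = 0) -> f x = 0.
Proof.
move=> hf hd; apply/eqP; apply: contrapT => /negP fx.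
have [z fz0 fz] := hd _ (cvg_neq0 (holomorphic_at_cvg hf) fx).
by rewrite fz eqxx in fz0.
Qed.

Lemma germ_domain_prod (I : Type) (s : seq I) (P : pred I) (f : I -> X -> C) x :
  (forall i, P i -> holomorphic_at (f i) x) ->
  (\forall y \near x, \prod_(i <- s | P i) f i y = 0) ->
  exists2 i, P i & \forall y \near x, f i y = 0.
Proof.
move=> hf; elim: s => [|i s IH].
  by move=> /nbhs_singleton; rewrite big_nil => /eqP; rewrite oner_eq0.
have hp : holomorphic_at (fun y => \prod_(j <- s | P j) f j y) x.
  exact: holomorphic_at_prod.
move=> h; case: (boolP (P i)) => [Pi|nPi]; last first.
  by apply: IH; apply: filterS h => y; rewrite big_cons (negbTE nPi).
have /(germ_domain (hf i Pi) hp)[hi|/IH //] : \forall y \near x, f i y * \prod_(j <- s | P j) f j y = 0.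
  by apply: filterS h => y; rewrite big_cons Pi.
by exists i.
Qed.

(* With [G = pinvmx (B x)], the vector [u y = (1 + G (B y - B x))^-1 v] satisfies
   [B x G B y u y = B x v = 0], and near [x] the matrices [B x G B y] and [B y]
   have the same rank, hence the same kernel. *)
Lemma constant_rank_kernel m n (B : X -> 'M[C]_(m, n)) x (v : 'cV[C]_n) :
  holomorphic_mx_at B x -> (\forall y \near x, \rank (B y) = \rank (B x)) ->
  B x *m v = 0 ->
  exists u : X -> 'cV[C]_n, [/\ holomorphic_mx_at u x, u x = v &
    \forall y \near x, B y *m u y = 0].
Proof.
move=> hB rB Bv; set G := pinvmx (B x).
have BGB : B x *m G *m B x = B x by apply: mulmxKpV.
pose Q (y : X) : 'M[C]_n := 1%:M + G *m (B y - B x).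
have hQ : holomorphic_mx_at Q x.
  apply: holomorphic_mx_atD; first exact: hmx_cst.
  apply: holomorphic_mx_atM; first exact: hmx_cst.
  by apply: holomorphic_mx_atB => //; exact: hmx_cst.
have Qx : Q x = 1%:M by rewrite /Q subrr mulmx0 addr0.
have uQ : Q x \in unitmx by rewrite Qx unitmx1.
exists (fun y => invmx (Q y) *m v); split.
- apply: holomorphic_mx_atM; last exact: hmx_cst.
  exact: holomorphic_mx_atV.
- by rewrite Qx invmx1 mul1mx.
have hK : holomorphic_mx_at (fun y => B x *m G *m B y) x.
  by apply: holomorphic_mx_atM => //; exact: hmx_cst.
have := rank_lsc (holomorphic_mx_at_cvg hK); rewrite BGB => rK.
have uQy := near_unitmx hQ uQ.
apply: filterS (filterI rB (filterI (rK _) uQy)) => y [rBy [rKy uy]].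
apply: (@rank_eq_ker _ _ _ _ _ (B x *m G)); first by rewrite rBy.
have E : B x *m Q y = B x *m G *m B y.
  by rewrite /Q mulmxDr mulmx1 mulmxA mulmxBr BGB addrC subrK.
by rewrite -E -mulmxA (mulKVmx uy).
Qed.

End HolomorphicMatrices.

(** * Frames and dimension counts *)

Section Frames.
Variables (F : fieldType) (n : nat).
Local Notation V := ('cV[F]_n).

Lemma dim_col m : \dim {: 'cV[F]_m}%VS = m.
Proof. rewrite dimvf dim_matrix; exact: muln1. Qed.

Section Frame.
Variables (m : nat) (B : 'M[F]_(n, m)) (W : {vspace V}).
Hypotheses (Binj : forall u : 'cV_m, B *m u = 0 -> u = 0)
  (BW : forall u : 'cV_m, B *m u \in W).

Let f : 'Hom('cV[F]_m, V) := linfun (mulmx B).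

Let dim_im : \dim (limg f) = m.
Proof.
rewrite limg_dim_eq ?dim_col //; apply/eqP; rewrite -subv0; apply/subvP => u.
by rewrite memv_cap mem_lker_mulmx => /andP[_ /eqP/Binj ->]; rewrite mem0v.
Qed.

Let im_W : (limg f <= W)%VS.
Proof. by apply/subvP => _ /memv_imgP[u _ ->]; rewrite lfunE; exact: BW. Qed.

Lemma frame_dim_le : (m <= \dim W)%N.
Proof. by rewrite -dim_im dimvS. Qed.

Lemma frame_span : (\dim W <= m)%N -> forall v, v \in W <-> exists u, v = B *m u.
Proof.
move=> dW v; have /eqP <- : limg f == W by rewrite eqEdim im_W dim_im.
split=> [/memv_imgP[u _ ->]|[u ->]]; first by exists u; rewrite lfunE.
by apply/memv_imgP; exists u; rewrite ?memvf ?lfunE.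
Qed.

End Frame.

Lemma mulmx_sum_col m (P : 'M[F]_(n, m)) (u : 'cV[F]_m) :
  P *m u = \sum_j u j 0 *: col j P.
Proof.
apply/colP => i; rewrite mxE summxE; apply: eq_bigr => j _.
by rewrite !mxE mulrC.
Qed.

Section Graded.
Variables (r : nat) (W : 'I_r -> {vspace V}).

Lemma sum_full_columns (P : 'M[F]_n) (s : 'I_n -> 'I_r) : P \in unitmx ->
  (forall j, col j P \in W (s j)) -> (\sum_i W i)%VS = fullv.
Proof.
move=> uP PW; apply/eqP; rewrite eqEsubv subvf /=; apply/subvP => v _.
rewrite -(mulKVmx uP v) mulmx_sum_col; apply: memv_suml => j _.
by rewrite memvZ //; apply: (subvP (sumv_sup (s j) isT (subvv _))).
Qed.

(** The chain [n <= \sum_i \dim (W i) <= \sum_i d i = n] consists of equalities. *)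
Lemma sum_full_dims (d : 'I_r -> nat) : (\sum_i W i)%VS = fullv ->
  (forall i, (\dim (W i) <= d i)%N) -> (\sum_i d i)%N = n ->
  directv (\sum_i W i) /\ forall i, \dim (W i) = d i.
Proof.
move=> Wf Wd dn.
have h1 : (\dim (\sum_i W i)%VS <= \sum_i \dim (W i))%N by exact: dimv_leq_sum.
have h2 : (\sum_i \dim (W i) <= \sum_i d i)%N by apply: leq_sum.
have E : (\sum_i \dim (W i))%N = n.
  by apply/eqP; rewrite eqn_leq -[X in (_ <= X)%N]dn h2 /= -[leqLHS]dim_col -Wf.
split; first by rewrite directvE /= Wf dim_col E.
have [_ ] := @leqif_sum _ xpredT _ _ _ (fun i _ => leqif_eq (Wd i)).
by rewrite E dn eqxx => /esym/forallP h i; apply/eqP; have := h i.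
Qed.

Lemma direct_dims (d : 'I_r -> nat) : (\sum_i W i)%VS = fullv -> directv (\sum_i W i) ->
  (forall i, (d i <= \dim (W i))%N) -> (\sum_i d i)%N = n -> forall i, \dim (W i) = d i.
Proof.
move=> Wf; rewrite directvE /= Wf dim_col => /eqP E Wd dn.
have [_ ] := @leqif_sum _ xpredT _ _ _ (fun i _ => leqif_eq (Wd i)).
by rewrite -E dn eqxx => /esym/forallP h i; apply/esym/eqP; have := h i.
Qed.

End Graded.

Lemma colsub_inj m p (P : 'M[F]_(n, m)) (f : 'I_p -> 'I_m) : injective f ->
  (forall u : 'cV_m, P *m u = 0 -> u = 0) -> forall u : 'cV_p, colsub f P *m u = 0 -> u = 0.
Proof.
move=> fI PI u; have -> : colsub f P = P *m colsub f 1%:M.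
  by rewrite mulmx_colsub mulmx1.
rewrite -mulmxA => /PI h; apply/colP => i; rewrite mxE.
have /colP/(_ (f i)) := h; rewrite mxE [RHS]mxE (bigD1 i) //= !mxE eqxx mul1r.
rewrite big1 ?addr0 // => j ji.
by rewrite !mxE (inj_eq fI) eq_sym (negbTE ji) mul0r.
Qed.

End Frames.

(** * Coalescing points and germs of generalized eigenvectors *)

Section SpectrumCard.
Variables (R : realType) (r : nat).
Local Notation C := (Cplx R).

Lemma card_spectrum_codom n (M : 'M[C]_n) (c : 'I_r -> C) :
  spectrum M = [set c i | i in setT] -> card_spectrum M = size (undup (codom c)).
Proof.
move=> h; rewrite /card_spectrum h -card_fseq; congr #|` _|%fset.
apply/fsetP => a; rewrite in_fset_set; last by apply: finite_image; exact: finite_finset.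
rewrite !inE; apply/idP/codomP => [/set_mem[i _ <-]|[i ->]]; first by exists i.
by apply/mem_set; exists i.
Qed.

Lemma card_spectrum_le n (M : 'M[C]_n) (c : 'I_r -> C) :
  spectrum M = [set c i | i in setT] -> (card_spectrum M <= r)%N.
Proof.
by move=> /card_spectrum_codom ->; rewrite (leq_trans (size_undup _)) // size_codom card_ord.
Qed.

Lemma card_spectrum_eq n (M : 'M[C]_n) (c : 'I_r -> C) :
  spectrum M = [set c i | i in setT] -> injective c <-> card_spectrum M = r.
Proof.
move=> /card_spectrum_codom ->.
have sz : size (codom c) = r by rewrite size_codom card_ord.
split=> [/injectiveP h|h]; first by rewrite undup_id // sz.
by apply/injectiveP/negbNE; rewrite -ltn_size_undup sz h ltnn.
Qed.

End SpectrumCard.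

(** * Coalescing points and branches of eigenvalues *)

Section Eigenvalues.
Variables (R : realType) (X : complexManifold R) (n : nat).
Local Notation C := (Cplx R).
Variables (A : X -> 'M[C]_n) (U : set X) (J : X -> 'M[C]_n) (x0 : X).
Hypothesis hA : holomorphic_mx setT A.
Hypothesis hJ : holomorphic_jordan_form A x0 U J.
Variables (r : nat) (lam : 'I_r -> X -> C).
Hypothesis hlam : holomorphic_eigenvalues A U lam.
Implicit Types (x y z : X).

Let oU : open U. Proof. by case: hJ => -[]. Qed.
Let Ux0 : U x0. Proof. by case: hJ => -[]. Qed.
Let cU : connected U. Proof. by case: hJ. Qed.

Lemma near_domain x : U x -> \forall y \near x, U y.
Proof. by move=> Ux; apply: open_nbhs_nbhs. Qed.

Lemma domain_zero f x : holomorphic U f -> U x -> (\forall y \near x, f y = 0) ->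
  forall y, U y -> f y = 0.
Proof.
move=> hf Ux fx y Uy.
exact: nbhs_singleton (identity_connected oU cU hf Ux fx Uy).
Qed.

Definition good x := injective (lam^~ x).

(** If the product of all differences vanished as a germ, one factor would, and by connectedness
    this difference would vanish on all of [U]. *)
Lemma good_dense x W : U x -> nbhs x W -> exists z, [/\ W z, U z & good z].
Proof.
move=> Ux nW; have [hl dl sl] := hlam.
pose P (p : 'I_r * 'I_r) := p.1 != p.2.
pose d (p : 'I_r * 'I_r) y := lam p.1 y - lam p.2 y.
have hd p y : U y -> holomorphic_at (d p) y.
  by move=> Uy; apply: holomorphic_atB; exact: hl.
pose delta y := \prod_(p | P p) d p y.
have hdelta : holomorphic_at delta x by apply: holomorphic_at_prod => p _; exact: hd.
have nz : ~ \forall y \near x, delta y = 0.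
  move=> /(germ_domain_prod (fun p _ => hd p x Ux))[p Pp zp].
  have [y Uy] := dl _ _ Pp; apply/negP; rewrite negbK -subr_eq0.
  by rewrite -/(d p y) (domain_zero (hd p) Ux zp Uy).
have := nbhs_singleton (nonzero_dense hdelta nz).
move=> /(_ (W `&` U) (filterI nW (near_domain Ux)))[z [Wz Uz] dz].
exists z; split=> // i j /= ij; apply: contraTeq dz => ne.
rewrite negbK; apply/prodf_eq0; exists (i, j) => //; apply/eqP.
by rewrite /d /= ij subrr.
Qed.

(** The spectrum has at most [r] elements on [U], with equality exactly at the good points, which
    are dense. *)
Lemma coal_good x : U x -> coal A x <-> ~ good x.
Proof.
move=> Ux; have [hl dl sl] := hlam; split.
  move=> cx gx; have [y Uy] := cx U (near_domain Ux).
  rewrite ((card_spectrum_eq (sl x Ux)).1 gx).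
  by rewrite ltnNge (card_spectrum_le (sl y Uy)).
move=> bx W nW; have [z [Wz Uz gz]] := good_dense Ux nW.
exists z => //; rewrite ((card_spectrum_eq (sl z Uz)).1 gz).
rewrite ltn_neqAle (card_spectrum_le (sl x Ux)) andbT.
by apply/eqP => /(card_spectrum_eq (sl x Ux)).2.
Qed.

Lemma noncoal_proper : ProperFilter (within (~` coal A) (nbhs x0)).
Proof.
apply: Build_ProperFilter => h; have [z [h1 Uz gz]] := good_dense Ux0 h.
by apply: h1 => /(coal_good Uz).
Qed.

Lemma near_noncoal_good : \forall z \near within (~` coal A) (nbhs x0), U z /\ good z.
Proof.
apply: filterS (near_domain Ux0) => z Uz nc; split=> //.
by apply: contrapT => ng; apply: nc; apply/(coal_good Uz).
Qed.

Lemma noncoal_near (P : set X) : (\forall z \near x0, P z) ->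
  \forall z \near within (~` coal A) (nbhs x0), P z.
Proof. by apply: filterS => z Pz _. Qed.

(** At each point [J y j j] is some [lam i y], so the product over [i] of the differences vanishes.
    The domain property of germs selects one [i], and the identity theorem extends it to [U]. *)
Lemma diagonal_branches : exists s : 'I_n -> 'I_r, forall j y, U y -> J y j j = lam (s j) y.
Proof.
have [hl dl sl] := hlam; have [_ _ hJh fJ] := hJ.
have h j : exists i, forall y, U y -> J y j j = lam i y.
  have hd i y : U y -> holomorphic_at (fun y => J y j j - lam i y) y.
    by move=> Uy; apply: holomorphic_atB; [exact: hJh|exact: hl].
  have /(germ_domain_prod (fun i _ => hd i x0 Ux0))[i _ hi] :
      \forall y \near x0, \prod_(i <- index_enum 'I_r | xpredT i) (J y j j - lam i y) = 0.
    apply: filterS (near_domain Ux0) => y Uy.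
    have [cJ [P uP JP]] := fJ y Uy.
    have : spectrum (A y) (J y j j) by rewrite (similar_spectrum uP JP cJ); exists j.
    rewrite sl // => -[i _ hi]; apply/eqP/prodf_eq0; exists i => //.
    by rewrite -hi subrr.
  by exists i => y Uy; apply/eqP; rewrite -subr_eq0; apply/eqP; exact: (domain_zero (hd i) Ux0 hi Uy).
by have [s hs] := choice h; exists s.
Qed.

End Eigenvalues.

(** * Germs in the kernel of a holomorphic matrix *)

Section KernelFrames.
Variables (R : realType) (X : complexManifold R) (n : nat).
Local Notation C := (Cplx R).
Implicit Types (T : X -> 'M[C]_n) (x y : X).

Lemma mem_kerv (M : 'M[C]_n) v : (v \in kerv M) = (M *m v == 0).
Proof. exact: mem_lker_mulmx. Qed.

Lemma calK_sub_ker T x : (calK T x <= kerv (T x))%VS.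
Proof.
apply/subvP => v /mem_calK[f [_ /nbhs_singleton Tf <-]].
by rewrite mem_kerv Tf.
Qed.

Lemma calK_germs T x m (F : X -> 'M[C]_(n, m)) : holomorphic_mx_at F x ->
  (\forall y \near x, T y *m F y = 0) -> forall u : 'cV_m, F x *m u \in calK T x.
Proof.
move=> hF TF u; apply/mem_calK; exists (fun y => F y *m u); split=> //.
  by apply: holomorphic_mx_atM hF _; exact: hmx_cst.
by apply: filterS TF => y TFy; rewrite mulmxA TFy mul0mx.
Qed.

(** The operator may depend on the column: it is constant in [calK_frame], and follows the summand
    of the column for a basis adapted to a direct sum. *)
Lemma germ_frame x m (B : 'M[C]_(n, m)) (K : 'I_m -> X -> 'M[C]_n) :
  (forall j, col j B \in calK (K j) x) ->
  exists F : X -> 'M[C]_(n, m), [/\ holomorphic_mx_at F x, F x = B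
    & \forall y \near x, forall j, K j y *m col j (F y) = 0].
Proof.
move=> hB.
have h j : exists f : X -> 'cV[C]_n, [/\ holomorphic_mx_at f x,
    \forall y \near x, K j y *m f y = 0 & f x = col j B] by apply/mem_calK.
have [f hf] := choice h.
exists (fun y => \matrix_(i, j) f j y i 0); split.
- move=> i j; under [fun y => _]eq_fun do rewrite mxE.
  by have [hfj _ _] := hf j; exact: hfj.
- by apply/matrixP => i j; have [_ _ E] := hf j; rewrite mxE E mxE.
- apply: near_ord_forall => j; have [_ Tf _] := hf j; apply: filterS Tf => y Tfy.
  by rewrite -[RHS]Tfy; congr (_ *m _); apply/colP => i; rewrite !mxE.
Qed.

Lemma calK_frame T x : exists F : X -> 'M[C]_(n, \dim (calK T x)),
  [/\ holomorphic_mx_at F x, F x = basis_mx (calK T x)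
    & \forall y \near x, T y *m F y = 0].
Proof.
have [|F [hF Fx TF]] := @germ_frame x _ (basis_mx (calK T x)) (fun=> T).
  move=> j; rewrite colE; apply/mem_basis_mx; by exists (delta_mx j 0).
exists F; split=> //; apply: filterS TF => y TFy; apply/matrixP => i j.
by have /colP/(_ i) := TFy j; rewrite mulmx_col mxE => ->; rewrite !mxE.
Qed.

Lemma calK_frame_near T x m (F : X -> 'M[C]_(n, m)) : holomorphic_mx_at F x ->
  (forall u : 'cV_m, F x *m u = 0 -> u = 0) -> (\forall y \near x, T y *m F y = 0) ->
  \forall y \near x,
    (forall u : 'cV_m, F y *m u = 0 -> u = 0) /\ forall u : 'cV_m, F y *m u \in calK T y.
Proof.
move=> hF Finj TF.
have h1 := near_injective hF Finj.
have h2 := holomorphic_mx_at_near hF.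
apply: filterS (filterI h1 (filterI h2 (near_near_eq TF))) => y [inj [hFy TFy]].
by split=> //; exact: calK_germs.
Qed.

Lemma calK_lsc T x : \forall y \near x, (\dim (calK T x) <= \dim (calK T y))%N.
Proof.
have [F [hF Fx TF]] := calK_frame T x.
have Finj (u : 'cV_(\dim (calK T x))) : F x *m u = 0 -> u = 0.
  by rewrite Fx; exact: basis_mx_inj.
by apply: filterS (calK_frame_near hF Finj TF) => y [inj Fy]; exact: frame_dim_le inj Fy.
Qed.

End KernelFrames.

(** * Multiplicities of the branches *)

Section Multiplicities.
Variables (R : realType) (X : complexManifold R) (n : nat).
Local Notation C := (Cplx R).
Variables (A : X -> 'M[C]_n) (U : set X) (J : X -> 'M[C]_n) (x0 : X).
Hypothesis hA : holomorphic_mx setT A.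
Hypothesis hJ : holomorphic_jordan_form A x0 U J.
Variables (r : nat) (lam : 'I_r -> X -> C).
Hypothesis hlam : holomorphic_eigenvalues A U lam.
Variable s : 'I_n -> 'I_r.
Hypothesis hs : forall j y, U y -> J y j j = lam (s j) y.
Implicit Types (x y z : X).

Let Ux0 : U x0. Proof. by case: hJ => -[]. Qed.

(** At good points this is the algebraic multiplicity of [lam i]; since [s] is fixed on [U], it is
    the same at all of them. *)
Definition mult i := #|[pred j | s j == i]|.

Lemma sum_mult : (\sum_i mult i)%N = n.
Proof.
rewrite -[RHS]card_ord -sum1_card (partition_big s xpredT) //=.
by apply: eq_bigr => i _; rewrite /mult -sum1_card.
Qed.

Local Notation N i := (shifted_power A (lam i)).
Let M i y : 'M[C]_n := \prod_(k | k != i) N k y.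

Let hN i x : U x -> holomorphic_mx_at (N i) x.
Proof.
move=> Ux; have [hl _ _] := hlam; apply: holomorphic_mx_atX.
by apply: holomorphic_mx_atB; [exact: hA|apply: holomorphic_mx_at_scalar; exact: hl].
Qed.

Let hM i x : U x -> holomorphic_mx_at (M i) x.
Proof. by move=> Ux; apply: holomorphic_mx_at_prod => k; exact: hN. Qed.

Lemma branch_columns y : U y -> exists2 P : 'M[C]_n, P \in unitmx &
  forall j, N (s j) y *m col j P = 0.
Proof.
move=> Uy; have [_ _ _ fJ] := hJ; have [cJ [P uP JP]] := fJ y Uy.
by exists P => // j; rewrite /shifted_power -hs //; exact: jordan_columns.
Qed.

(** The product of all the [N k] is zero because each column of the Jordan basis is killed by one of
    these commuting factors. *)
Let NM0 i y : U y -> N i y *m M i y = 0.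
Proof.
move=> Uy; have [P uP hP] := branch_columns Uy.
suff : N i y *m M i y *m P = 0 by move=> /(congr1 (mulmx^~ (invmx P))); rewrite mulmxK // mul0mx.
apply/matrixP => k j; rewrite [RHS]mxE.
suff : N i y *m M i y *m col j P = 0 by rewrite mulmx_col => /colP/(_ k); rewrite !mxE.
have [ji|ji] := eqVneq (s j) i.
  have -> : N i y *m M i y = M i y *m N i y by rewrite !mulmxE; exact: comm_shift_prod.
  by rewrite -mulmxA -ji hP mulmx0.
rewrite -mulmxA; have -> : M i y *m col j P = 0; last by rewrite mulmx0.
by apply: (gen_eigen_prod_kill (mem_index_enum (s j)) ji (hP j)).
Qed.

(** Take the product of the [N k] with [k != i]. Its columns are germs killed by [N i], and at a
    good point they fill the generalized eigenspace by [gen_eigen_image]; germs at such points come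
    from here. *)
Lemma branch_image i : exists T : X -> 'M[C]_n,
  [/\ forall x, U x -> holomorphic_mx_at T x, forall y, U y -> N i y *m T y = 0
    & forall z (v : 'cV_n), good lam z -> N i z *m v = 0 -> exists w : 'cV_n, v = T z *m w].
Proof.
exists (M i); split=> [x|y|z v gz hv]; [exact: hM|exact: NM0|].
have ne k : k != i -> lam k z != lam i z by apply: contra_neq => /gz.
exact: (gen_eigen_image (index_enum 'I_r) n ne hv).
Qed.

(** The columns of the Jordan basis belonging to branch [i] give the lower bound; the kernels are
    independent and the [mult i] add up to [n], so equality holds. *)
Lemma dim_ker_good i z : U z -> good lam z -> \dim (kerv (N i z)) = mult i.
Proof.
move=> Uz gz; have [P uP hP] := branch_columns Uz.
move: i; pose W i := kerv (N i z); apply: (@direct_dims _ _ _ W) sum_mult.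
- by apply: (@sum_full_columns _ _ _ W _ s uP) => j; rewrite mem_kerv hP.
- apply/directv_sum_independent => us hus us0 i _.
  apply: (gen_eigen_sum_eq0 (A := A z) (k := n) gz _ us0) => k.
  by apply/eqP; rewrite -mem_kerv; exact: hus.
- move=> i; pose f : 'I_(mult i) -> 'I_n := enum_val.
  apply: (@frame_dim_le _ _ _ (colsub f P)).
    apply: colsub_inj; first exact: enum_val_inj.
    by move=> u hu; rewrite -(mulKmx uP u) hu mulmx0.
  move=> u; rewrite mem_kerv mulmxA mulmx_colsub.
  suff -> : colsub f (N i z *m P) = 0 by rewrite mul0mx.
  apply/matrixP => k j; rewrite [RHS]mxE mxE.
  have := hP (f j); have /eqP -> : s (f j) == i by have := enum_valP j.
  by rewrite mulmx_col => /colP/(_ k); rewrite !mxE.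
Qed.

Lemma calK_good i z : U z -> good lam z -> calK (N i) z = kerv (N i z).
Proof.
move=> Uz gz; apply/eqP; rewrite eqEsubv calK_sub_ker /=.
apply/subvP => v; rewrite mem_kerv => /eqP hv.
have [T [hT NT /(_ z v gz hv)[w ->]]] := branch_image i.
apply: (@calK_germs _ _ _ _ _ _ T); first exact: hT.
by apply: filterS (near_domain hJ Uz) => y; exact: NT.
Qed.

(** Lower semicontinuity compares [x] with a nearby good point. *)
Lemma calK_dim_le i x : U x -> (\dim (calK (N i) x) <= mult i)%N.
Proof.
move=> Ux; have [z [hz Uz gz]] := good_dense hJ hlam Ux (calK_lsc (N i) x).
by rewrite -(dim_ker_good i Uz gz) -(calK_good i Uz gz).
Qed.

Lemma calK_dim_cvg i : {for x0, continuous (fun x => \dim (calK (N i) x))} <->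
  \dim (calK (N i) x0) = mult i.
Proof.
split=> [h|h].
  (* [nat] is discrete: a singleton is a neighbourhood, so continuity means local constancy. *)
  have h' : \forall y \near x0, \dim (calK (N i) y) = \dim (calK (N i) x0).
    exact: (h [set \dim (calK (N i) x0)]).
  have [z [hz Uz gz]] := good_dense hJ hlam Ux0 h'.
  by rewrite -(dim_ker_good i Uz gz) -(calK_good i Uz gz) hz.
move=> W /nbhs_singleton W0.
apply: filterS (filterI (near_domain hJ Ux0) (calK_lsc (N i) x0)) => y [Uy hy].
suff E : \dim (calK (N i) y) = \dim (calK (N i) x0) by move: W0; rewrite -E.
by apply/eqP; rewrite eqn_leq hy h calK_dim_le.
Qed.

End Multiplicities.

Section DenseEstimates.
Variables (R : realType) (X : complexManifold R).
Local Notation C := (Cplx R).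
Implicit Types (f g : X -> C) (x y : X).

Lemma le_of_dense f g x (K : R) : 0 <= K -> holomorphic_at f x -> holomorphic_at g x ->
  (forall W, nbhs x W -> exists2 z, W z & nr (f z) <= K * nr (g z)) ->
  nr (f x) <= K * nr (g x).
Proof.
move=> K0 /holomorphic_at_cvg/cvg_nrP hf /holomorphic_at_cvg/cvg_nrP hg hd.
rewrite leNgt; apply/negP => lt; pose e := nr (f x) - K * nr (g x).
have e0 : 0 < e by rewrite subr_gt0.
pose d := e / (2 * (K + 1)).
have K1 : 0 < K + 1 by rewrite ltr_wpDl.
have d0 : 0 < d by rewrite divr_gt0 // mulr_gt0.
have e2 : 0 < e / 2 by rewrite divr_gt0.
have [z [hfz hgz] hz] := hd _ (filterI (hf _ e2) (hg _ d0)).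
have h1 : nr (f x) <= nr (f z) + nr (f z - f x).
  by have := nr_lbB (f x) (f z); rewrite nrBC; lra.
have h2 : nr (g z) <= nr (g x) + nr (g z - g x).
  by have := nr_lbB (g z) (g x); lra.
have h3 : K * nr (g z) <= K * (nr (g x) + d).
  by rewrite ler_wpM2l //; have := ltW hgz; lra.
have h4 : K * d <= e / 2.
  have E : (K + 1) * d = e / 2 by rewrite /d; field; exact: lt0r_neq0.
  by rewrite -E ler_wpM2r ?lerDl // ltW.
have E : nr (f x) = e + K * nr (g x) by rewrite /e subrK.
by move: hfz; lra.
Qed.

Lemma mx_germ_domain p q f (T : X -> 'M[C]_(p, q)) x : holomorphic_at f x ->
  holomorphic_mx_at T x -> ~ (\forall y \near x, f y = 0) ->
  (\forall y \near x, f y *: T y = 0) -> \forall y \near x, T y = 0.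
Proof.
move=> hf hT fn fT.
have h : \forall y \near x, forall i j, T y i j = 0.
  apply: near_ord_forall => i; apply: near_ord_forall => j.
  case: (@germ_domain _ _ f (fun y => T y i j) x hf (hT i j)) => //.
  by apply: filterS fT => y /matrixP/(_ i j); rewrite !mxE.
by apply: filterS h => y hy; apply/matrixP => i j; rewrite hy mxE.
Qed.

End DenseEstimates.

(** * Limits of generalized eigenspaces *)

Section Limits.
Variables (R : realType) (X : complexManifold R) (n : nat).
Local Notation C := (Cplx R).
Variables (A : X -> 'M[C]_n) (U : set X) (J : X -> 'M[C]_n) (x0 : X).
Hypothesis hA : holomorphic_mx setT A.
Hypothesis hJ : holomorphic_jordan_form A x0 U J.
Variables (r : nat) (lam : 'I_r -> X -> C).
Hypothesis hlam : holomorphic_eigenvalues A U lam.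
Variable s : 'I_n -> 'I_r.
Hypothesis hs : forall j y, U y -> J y j j = lam (s j) y.
Implicit Types (x y z : X).

Let Ux0 : U x0. Proof. by case: hJ => -[]. Qed.

Local Notation N i := (shifted_power A (lam i)).
Local Notation F0 := (within (~` coal A) (nbhs x0)).

Lemma limit_calK i : \dim (calK (N i) x0) = mult s i ->
  generalized_eigenspace_limit A x0 (lam i) (calK (N i) x0).
Proof.
move=> hd; have [F [hF Fx NF]] := calK_frame (N i) x0.
have Finj (u : 'cV_(\dim (calK (N i) x0))) : F x0 *m u = 0 -> u = 0.
  by rewrite Fx; exact: basis_mx_inj.
apply: (@gap_cvg_frame _ _ _ _ (noncoal_proper hJ hlam) _ _ _ F (basis_mx (calK (N i) x0))).
- move=> k l; rewrite -Fx; apply: cvg_within_filter.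
  exact: holomorphic_mx_at_cvg hF k l.
- exact: mem_basis_mx.
- exact: basis_mx_inj.
have h1 := noncoal_near A (calK_frame_near hF Finj NF).
apply: filterS (filterI h1 (near_noncoal_good hJ hlam)) => z [[inj Fz] [Uz gz]].
apply: (frame_span inj).
  by move=> u; rewrite -(calK_good hA hJ hlam hs i Uz gz).
by rewrite (dim_ker_good hJ hs i Uz gz) hd.
Qed.

(* If the generalized eigenspaces converge to [L], project the image of
   [T = prod_(k != i) N k] to [L]: Cramer's rule gives a frame [G / h] of the
   generalized eigenspaces, which is bounded because the projections to [L] are
   close to the identity, hence holomorphic by division. *)
Lemma limit_dim i L : generalized_eigenspace_limit A x0 (lam i) L ->
  \dim (calK (N i) x0) = mult s i.
Proof.
move=> hL; apply/eqP; rewrite eqn_leq (calK_dim_le hA hJ hlam hs i Ux0) /=.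
pose good_gap z := [/\ U z, good lam z, gap (kerv (N i z)) L < 1
  & gap (kerv (N i z)) L * (2 * n%:R) <= 1].
have hgap : \forall z \near F0, good_gap z.
  (* Below this threshold both [gap < 1], which fixes the dimension, and the hypothesis of
     [gap_entry_bound] hold. *)
  pose e : R := (2 * n%:R + 1)^-1.
  have e1 : 0 < 2 * n%:R + 1 :> R by rewrite ltr_wpDl // mulr_ge0.
  have e0 : 0 < e by rewrite invr_gt0.
  have hLe : \forall z \near F0, gap (kerv (N i z)) L < e.
    move/cvgrPdist_lt: hL => /(_ e e0); apply: filterS => z.
    by rewrite sub0r normrN; apply: le_lt_trans; exact: ler_norm.
  apply: filterS (filterI hLe (near_noncoal_good hJ hlam)) => z [ge [Uz gz]].
  have ee : e * (2 * n%:R + 1) = 1 by rewrite mulVf // gt_eqF.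
  have ele : e * (2 * n%:R) <= 1 by rewrite -[leRHS]ee ler_wpM2l ?lerDl // ltW.
  split=> //.
    by apply: lt_le_trans ge _; rewrite -[leRHS]ee ler_peMr ?lerDr ?mulr_ge0 //; exact: ltW.
  by apply: le_trans ele; rewrite ler_wpM2r ?mulr_ge0 //; exact: ltW.
have [z1 [Uz1 gz1 g1 _g1]] := @filter_ex _ _ (noncoal_proper hJ hlam) _ hgap.
have dm : \dim L = mult s i by rewrite -(gap_dim g1) (dim_ker_good hJ hs i Uz1 gz1).
rewrite -dm; set m := \dim L.
pose B : 'M[C]_(n, m) := basis_mx L.
have [uB projE] := orthogonal_projectionE (mem_basis_mx L) (@basis_mx_inj _ _ L).
(* [B *m Psi] is the orthogonal projection onto [L], and [Psi] gives coordinates on [L]. *)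
pose Psi : 'M[C]_(m, n) := invmx (map_mx Num.conj B^T *m B) *m map_mx Num.conj B^T.
have PsiB : Psi *m B = 1%:M by rewrite /Psi -mulmxA mulVmx.
have key z (v : 'cV_n) k : good_gap z -> N i z *m v = 0 ->
    nr (v k 0) <= 2 * \sum_j nr ((B *m (Psi *m v)) j 0).
  move=> [_ _ _ g] hv.
  have vk : v \in kerv (N i z) by rewrite mem_kerv hv.
  have := gap_entry_bound k g vk; rewrite projE.
  by rewrite /Psi !mulmxA.
have [T [hT NT imT]] := branch_image hA hJ hlam hs i.
(* [Cm] selects combinations of the columns of [T] that project to a basis of [L] at the single good
   point [z1]. This gives [h z1 = 1], so by connectedness of [U] the germ of [h] at [x0] is
   nonzero. *)
have [Cm hCm] : exists Cm : 'M[C]_(n, m), Psi *m T z1 *m Cm = 1%:M.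
  pose K1 := basis_mx (kerv (N i z1)).
  have NK1 j : N i z1 *m col j K1 = 0.
    apply/eqP; rewrite -mem_kerv colE; apply/mem_basis_mx.
    by exists (delta_mx j 0).
  have [D hD] := choice (fun j => imT z1 _ gz1 (NK1 j)).
  have K1E : K1 = T z1 *m \matrix_(k, j) D j k 0.
    apply/matrixP => k j; have /colP/(_ k) := hD j; rewrite mxE => ->.
    by rewrite !mxE; apply: eq_bigr => l _; rewrite !mxE.
  have rk : \rank (Psi *m K1) = \dim (kerv (N i z1)).
    apply: injective_rank => u; rewrite -mulmxA => hu; apply: basis_mx_inj.
    apply/colP => k; apply/eqP; rewrite [X in _ == X]mxE -nr_eq0 eq_le nr_ge0 andbT.
    have Nu : N i z1 *m (K1 *m u) = 0.
      by apply/eqP; rewrite -mem_kerv; apply/mem_basis_mx; exists u.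
    have := key z1 _ k (And4 Uz1 gz1 g1 _g1) Nu; rewrite hu mulmx0.
    by rewrite big1 ?mulr0 // => j _; rewrite mxE nr0.
  have /row_freeP[E hE] : row_free (Psi *m K1).
    by rewrite /row_free rk (gap_dim g1).
  by exists ((\matrix_(k, j) D j k 0) *m E); rewrite -hE K1E !mulmxA.
pose H y : 'M[C]_m := Psi *m T y *m Cm.
pose h y := \det (H y).
(* Since [Psi *m G y = (h y)%:M], the quotient [G / h] has coordinates the identity on [L]; the
   adjugate clears the denominator and keeps [G] holomorphic. *)
pose G y : 'M[C]_(n, m) := T y *m Cm *m \adj (H y).
have hH y : U y -> holomorphic_mx_at H y.
  by move=> Uy; apply/holomorphic_mx_at_mulr/holomorphic_mx_at_mull; exact: hT.
have hh y : U y -> holomorphic_at h y by move=> Uy; exact: holomorphic_at_det (hH y Uy).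
have hG y : U y -> holomorphic_mx_at G y.
  move=> Uy; apply: holomorphic_mx_atM (holomorphic_mx_at_adj (hH y Uy)).
  by apply: holomorphic_mx_at_mulr; exact: hT.
have PsiG y : Psi *m G y = (h y)%:M by rewrite /G !mulmxA mul_mx_adj.
have NG y : U y -> N i y *m G y = 0 by move=> Uy; rewrite /G !mulmxA NT // !mul0mx.
have hn : ~ (\forall y \near x0, h y = 0).
  move=> /(domain_zero hJ hh Ux0)/(_ _ Uz1); rewrite /h /H hCm det1 => /eqP.
  by rewrite oner_eq0.
pose K0 : R := 2 * \sum_j \sum_k nr (B j k).
have K00 : 0 <= K0.
  by rewrite mulr_ge0 // sumr_ge0 // => j _; rewrite sumr_ge0 // => k _; exact: nr_ge0.
have bound z k l : good_gap z -> nr (G z k l) <= K0 * nr (h z).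
  move=> gz; have [Uz _ _ _] := gz.
  have Nv : N i z *m col l (G z) = 0 by rewrite mulmx_col NG //; apply/colP => a; rewrite !mxE.
  have := key z _ k gz Nv; rewrite mxE => /le_trans; apply.
  rewrite /K0 -mulrA ler_wpM2l // mulr_suml; apply: ler_sum => j _.
  have -> : (B *m (Psi *m col l (G z))) j 0 = h z * B j l.
    by rewrite mulmx_col PsiG mulmx_col mul_mx_scalar mxE [LHS]mxE.
  rewrite nrM mulrC; apply: ler_wpM2r; first exact: nr_ge0.
  by rewrite (bigD1 l) //= lerDl sumr_ge0 // => a _; exact: nr_ge0.
(* [y] itself may be a coalescing point; the bound passes to it from nearby good points by
   continuity. *)
have hb k l : \forall y \near x0, nr (G y k l) <= K0 * nr (h y).
  have hgap' : \forall y \near x0, (~` coal A) y -> good_gap y by exact: hgap.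
  apply: filterS (filterI (near_domain hJ Ux0) (near_near_eq hgap')) => y [Uy gy].
  apply: (le_of_dense K00 (hG y Uy k l) (hh y Uy)) => W nW.
  have [z [[Wz gz] Uz gdz]] := good_dense hJ hlam Uy (filterI nW gy).
  by exists z => //; apply: bound; apply: gz => /(coal_good hJ hlam Uz).
have [q hq] : exists q : 'I_n * 'I_m -> X -> C, forall p, holomorphic_at (q p) x0 /\
    \forall y \near x0, G y p.1 p.2 = q p y * h y.
  have : forall p : 'I_n * 'I_m, exists q, holomorphic_at q x0 /\
      \forall y \near x0, G y p.1 p.2 = q y * h y.
    move=> [k l].
    by have [q] := holomorphic_division (hG _ Ux0 k l) (hh _ Ux0) (hb k l) hn; exists q.
  by move=> /choice[q hq]; exists q.
pose Q y : 'M[C]_(n, m) := \matrix_(k, l) q (k, l) y.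
have hQ : holomorphic_mx_at Q x0.
  move=> k l; under [fun y => _]eq_fun do rewrite mxE.
  by have [] := hq (k, l).
have GQ : \forall y \near x0, G y = h y *: Q y.
  have : \forall y \near x0, forall k l, G y k l = q (k, l) y * h y.
    apply: near_ord_forall => k; apply: near_ord_forall => l.
    by have [_] := hq (k, l).
  apply: filterS => y e; apply/matrixP => k l.
  by rewrite e !mxE mulrC.
(* The identity holds after multiplication by [h], a nonzero germ that can be cancelled. It shows
   that the columns of [Q x0] are independent even where [h x0 = 0]. *)
have PsiQ : Psi *m Q x0 = 1%:M.
  have : \forall y \near x0, Psi *m Q y - 1%:M = 0.
    apply: (mx_germ_domain (hh _ Ux0)) => //.
      apply: holomorphic_mx_atB; last exact: hmx_cst.
      exact: holomorphic_mx_at_mull.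
    apply: filterS GQ => y e.
    by rewrite scalerBr scalemxAr -e PsiG scalemx1 subrr.
  by move/nbhs_singleton/eqP; rewrite subr_eq0 => /eqP.
have hN : holomorphic_mx_at (N i) x0.
  have [hl _ _] := hlam; apply: holomorphic_mx_atX.
  by apply: holomorphic_mx_atB; [exact: hA|apply: holomorphic_mx_at_scalar; exact: hl].
have NQ : \forall y \near x0, N i y *m Q y = 0.
  apply: (mx_germ_domain (hh _ Ux0)) => //; first exact: holomorphic_mx_atM hN hQ.
  apply: filterS (filterI GQ (near_domain hJ Ux0)) => y [e Uy].
  by rewrite scalemxAr -e NG.
apply: (frame_dim_le _ (calK_germs hQ NQ)) => u hu.
by rewrite -[u]mul1mx -PsiQ -mulmxA hu mulmx0.
Qed.

End Limits.

(** * Equivalence of the conditions *)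

Section Equivalences.
Variables (R : realType) (X : complexManifold R) (n : nat).
Local Notation C := (Cplx R).
Variables (A : X -> 'M[C]_n) (x0 : X).
Hypothesis hA : holomorphic_mx setT A.
Implicit Types (x y z : X) (U : set X).

(** The branches are the diagonal entries of [J] up to equality as functions on [U]. The
    representative [rep] is the same throughout a class, since [pick] depends only on the
    predicate. *)
Lemma jordan_branches U J : holomorphic_jordan_form A x0 U J ->
  exists (r : nat) (lam : 'I_r -> X -> C), holomorphic_eigenvalues A U lam.
Proof.
move=> [oU cU hJ fJ].
pose same (j k : 'I_n) := `[< forall y, U y -> J y j j = J y k k >].
pose rep j := odflt j [pick k | same j k].
have repE j y : U y -> J y (rep j) (rep j) = J y j j.
  by rewrite /rep; case: pickP => //= k /asboolP h Uy; rewrite h.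
have rep_inj j k : (forall y, U y -> J y j j = J y k k) -> rep j = rep k.
  move=> jk; rewrite /rep.
  have -> : [pick l | same j l] = [pick l | same k l].
    apply: eq_pick => l; apply/asboolP/asboolP => h y Uy; first by rewrite -jk ?h.
    by rewrite jk ?h.
  by case: pickP => //= /(_ k) /negP; case; apply/asboolP.
pose T := [set rep j | j : 'I_n]%SET.
exists #|T|, (fun i y => J y (enum_val i) (enum_val i)); split.
- by move=> i y Uy; exact: hJ.
- move=> i i' ii'; apply: contrapT => no; move/eqP: ii'; apply; apply: enum_val_inj.
  have /imsetP[j _ Ej] := enum_valP i; have /imsetP[j' _ Ej'] := enum_valP i'.
  rewrite Ej Ej'; apply: rep_inj => y Uy.
  rewrite -(repE j) // -(repE j') // -Ej -Ej'.
  by apply/eqP; apply: contrapT => /negP ne; apply: no; exists y.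
- move=> y Uy; have [cJ [P uP JP]] := fJ y Uy.
  rewrite (similar_spectrum uP JP cJ); apply/seteqP; split=> [_ [j _ <-]|_ [i _ <-]].
    have jT : rep j \in T by apply/imsetP; exists j.
    by exists (enum_rank_in jT (rep j)) => //; rewrite enum_rankK_in // repE.
  by exists (enum_val i).
Qed.

Section Given.
Variables (U : set X) (J : X -> 'M[C]_n).
Hypothesis hJ : holomorphic_jordan_form A x0 U J.
Variables (r : nat) (lam : 'I_r -> X -> C).
Hypothesis hlam : holomorphic_eigenvalues A U lam.

Let Ux0 : U x0. Proof. by case: hJ => -[]. Qed.

Local Notation K i := (calK (shifted_power A (lam i)) x0).

Lemma limits_exist_calK : limits_exist A x0 lam <-> calK_dim_continuous A x0 lam.
Proof.
have [s hs] := diagonal_branches hJ hlam; split=> h i.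
  have [L hL] := h i; apply/(calK_dim_cvg hA hJ hlam hs).
  exact: (limit_dim hA hJ hlam hs hL).
exists (K i); apply: (limit_calK hA hJ hlam hs).
by apply/(calK_dim_cvg hA hJ hlam hs); exact: h.
Qed.

(** Spanning forces each dimension up to its maximum [mult s i], which is the situation of
    [limit_calK]. *)
Lemma calK_direct_sum_limits : calK_direct_sum A x0 lam ->
  forall i, generalized_eigenspace_limit A x0 (lam i) (K i).
Proof.
have [s hs] := diagonal_branches hJ hlam; move=> [full dir] i.
apply: (limit_calK hA hJ hlam hs).
have [_] := sum_full_dims full (fun i => calK_dim_le hA hJ hlam hs i Ux0) (sum_mult s).
exact.
Qed.

Lemma limits_direct_sum_calK : limits_direct_sum A x0 lam <-> calK_direct_sum A x0 lam.
Proof.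
have [s hs] := diagonal_branches hJ hlam; split=> [[L [hL dL]]|h]; last first.
  exists (fun i => K i); split; first exact: calK_direct_sum_limits.
  exact: h.
rewrite /calK_direct_sum; have -> // : (fun i => K i) = L.
apply/funext => i; apply: (gap_cvg_unique (FF := noncoal_proper hJ hlam) _ (hL i)).
apply: (limit_calK hA hJ hlam hs).
exact: (limit_dim hA hJ hlam hs (hL i)).
Qed.

(** Column [j] of [S] is itself a holomorphic germ killed by the shifted power of branch [s j], so
    the germ spaces span. *)
Lemma columns_calK_direct_sum (S : X -> 'M[C]_n) : holomorphic_mx_at S x0 ->
  S x0 \in unitmx ->
  (\forall y \near x0, S y \in unitmx /\ J y = invmx (S y) *m A y *m S y) ->
  calK_direct_sum A x0 lam.
Proof.
move=> hS uS SJ; have [s hs] := diagonal_branches hJ hlam.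
have full : (\sum_i K i)%VS = fullv.
  apply: (@sum_full_columns _ _ _ (fun i => K i) (S x0) s uS) => j.
  apply/mem_calK; exists (fun y => col j (S y)); split=> //.
    by move=> i k; under [fun y => _]eq_fun do rewrite mxE; exact: hS.
  apply: filterS (filterI (near_domain hJ Ux0) SJ) => y [Uy [uy Jy]].
  have [_ _ _ fJ] := hJ; have [cJ _] := fJ y Uy.
  by rewrite /shifted_power -hs //; exact: jordan_columns.
have [dir _] := sum_full_dims full (fun i => calK_dim_le hA hJ hlam hs i Ux0) (sum_mult s).
by split.
Qed.

End Given.

Lemma jordanizable_limits : locally_holomorphically_jordanizable A x0 ->
  exists (U : set X) (J : X -> 'M[C]_n) (r : nat) (lam : 'I_r -> X -> C),
    [/\ holomorphic_jordan_form A x0 U J, holomorphic_eigenvalues A U lam,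
        limits_exist A x0 lam & limits_direct_sum A x0 lam].
Proof.
move=> [U [S [oU hS uS cS]]].
have [U' [oU' cU' U'U]] := connected_nbhs (open_nbhs_nbhs oU).
pose J y := invmx (S y) *m A y *m S y.
have hJ : holomorphic_jordan_form A x0 U' J.
  split=> // y U'y; have Uy := U'U y U'y.
    apply: holomorphic_mx_atM (hS y Uy).
    by apply: holomorphic_mx_atM; [exact: holomorphic_mx_atV (hS y Uy) (uS y Uy)|exact: hA].
  by split; [exact: cS|exists (S y) => //; exact: uS].
have [r [lam hlam]] := jordan_branches hJ.
have U'x0 : U' x0 by case: oU'.
have dir : calK_direct_sum A x0 lam.
  apply: (columns_calK_direct_sum hJ hlam (hS _ (U'U _ U'x0)) (uS _ (U'U _ U'x0))).
  by apply: filterS (near_domain hJ U'x0) => y /U'U Uy; split=> //; exact: uS.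
exists U', J, r, lam; split=> //; last exact/(limits_direct_sum_calK hJ hlam).
by move=> i; eexists; exact: (calK_direct_sum_limits hJ hlam dir).
Qed.

End Equivalences.

(** * Construction of a holomorphic Jordan basis *)

Section DirectSumBasis.
Variables (R : realType) (n : nat).
Local Notation C := (Cplx R).

Lemma mulmx_castmx m m' p (e : m = m') (M : 'M[C]_(n, m)) (D : 'M[C]_(m, p)) :
  castmx (erefl, e) M *m castmx (e, erefl) D = M *m D.
Proof. by case: m' / e. Qed.

Lemma mul_mx_castmx m m' p (e : m = m') (M : 'M[C]_(p, n)) (D : 'M[C]_(n, m)) :
  M *m castmx (erefl, e) D = castmx (erefl, e) (M *m D).
Proof. by case: m' / e. Qed.

Lemma mulmx_castmx2 m m' (e : m = m') (M : 'M[C]_(n, m)) (D : 'M[C]_m) :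
  castmx (erefl, e) M *m castmx (e, e) D = castmx (erefl, e) (M *m D).
Proof. by case: m' / e. Qed.

Lemma eq_on_columns (F M M' : 'M[C]_n) : F \in unitmx ->
  (forall j, M *m col j F = M' *m col j F) -> M = M'.
Proof.
move=> uF h; apply: (can_inj (mulmxK uF)); apply/matrixP => i j.
by have := h j; rewrite !mulmx_col => /colP/(_ i); rewrite !mxE.
Qed.

Lemma surjective_unit (B : 'M[C]_n) : (forall v : 'cV_n, exists u, v = B *m u) -> B \in unitmx.
Proof.
move=> h; have [D hD] := choice (fun j => h (col j 1%:M)).
have : B *m \matrix_(i, j) D j i 0 = 1%:M.
  apply/matrixP => i j; have /colP/(_ i) := hD j; rewrite [LHS]mxE => ->.
  by rewrite !mxE; apply: eq_bigr => k _; rewrite !mxE.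
by case/mulmx1_unit.
Qed.

Lemma direct_sum_basis r (L : 'I_r -> {vspace 'cV[C]_n}) : direct_sum_full L ->
  exists (B : 'M[C]_n) (t : 'I_n -> 'I_r), B \in unitmx /\ forall j, col j B \in L (t j).
Proof.
move=> [full dir].
have e : (\sum_i \dim (L i))%N = n.
  by move: dir; rewrite directvE /= full dim_col => /eqP/esym.
pose B := castmx (erefl, e) (\mxrow_i basis_mx (L i)).
exists B, (fun j => tagnat.sig1 (cast_ord (esym e) j)); split.
  apply: surjective_unit => v.
  have /memv_sumP[u uL ->] : v \in (\sum_i L i)%VS by rewrite full memvf.
  pose c i := cid ((mem_basis_mx (L i) (u i)).1 (uL i isT)).
  exists (castmx (e, erefl) (\mxcol_i projT1 (c i))); rewrite mulmx_castmx mul_mxrow_mxcol.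
  by apply: eq_bigr => i _; exact: projT2 (c i).
move=> j; set j' := cast_ord _ j.
suff -> : col j B = col (tagnat.sig2 j') (basis_mx (L (tagnat.sig1 j'))).
  by rewrite colE; apply/mem_basis_mx; eexists.
by apply/colP => k; rewrite !mxE castmxE /= !mxE /= cast_ord_id.
Qed.

End DirectSumBasis.

(** * Holomorphic spectral projections *)

Section SpectralProjections.
Variables (R : realType) (X : complexManifold R) (n : nat).
Local Notation C := (Cplx R).
Variables (A : X -> 'M[C]_n) (U : set X) (J : X -> 'M[C]_n) (x0 : X).
Hypothesis hA : holomorphic_mx setT A.
Hypothesis hJ : holomorphic_jordan_form A x0 U J.
Variables (r : nat) (lam : 'I_r -> X -> C).
Hypothesis hlam : holomorphic_eigenvalues A U lam.
Implicit Types (x y z : X).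

Let Ux0 : U x0. Proof. by case: hJ => -[]. Qed.

Local Notation N i := (shifted_power A (lam i)).

Lemma mx_zero_dense p q (T : X -> 'M[C]_(p, q)) : holomorphic_mx_at T x0 ->
  (\forall z \near x0, good lam z -> T z = 0) -> \forall y \near x0, T y = 0.
Proof.
move=> hT T0; apply: filterS (filterI (near_domain hJ Ux0)
  (filterI (holomorphic_mx_at_near hT) (near_near_eq T0))) => y [Uy [hTy T0y]].
apply/matrixP => i j; rewrite mxE.
apply: (eq0_of_dense (hTy i j)) => W nW.
have [z [[Wz gT] Uz gz]] := good_dense hJ hlam Uy (filterI nW T0y).
by exists z => //; rewrite gT // mxE.
Qed.

(* At good points these are the spectral projections, which commute with [A];
   the commutation extends to a neighbourhood by density. *)
Lemma spectral_projections : calK_direct_sum A x0 lam ->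
  exists Pi : 'I_r -> X -> 'M[C]_n, (forall i, holomorphic_mx_at (Pi i) x0) /\
    \forall y \near x0, [/\ \sum_i Pi i y = 1%:M,
      forall i k, Pi i y *m Pi k y = if i == k then Pi k y else 0,
      forall i, GRing.comm (A y) (Pi i y)
      & forall i, N i y *m Pi i y = 0].
Proof.
move=> /direct_sum_basis[B [t [uB Bt]]].
have [F [hF Fx0 NF]] := germ_frame Bt.
have uF : \forall y \near x0, F y \in unitmx by apply: near_unitmx hF _; rewrite Fx0.
(* [Pi i y] projects onto the columns of the frame [F y] of type [i], along the others; frame and
   type are fixed at [x0]. *)
pose D i : 'M[C]_n := diag_mx (\row_j (t j == i)%:R).
pose Pi i y := F y *m D i *m invmx (F y).
have hPi i : holomorphic_mx_at (Pi i) x0.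
  apply: holomorphic_mx_atM; first exact: holomorphic_mx_at_mulr.
  by apply: holomorphic_mx_atV => //; rewrite Fx0.
have PiF i y j : F y \in unitmx -> Pi i y *m col j (F y) = (t j == i)%:R *: col j (F y).
  move=> uy; rewrite mulmx_col /Pi mulmxKV //; apply/colP => k.
  by rewrite mul_mx_diag !mxE mulrC.
have NPi : \forall y \near x0, forall i, N i y *m Pi i y = 0.
  apply: filterS (filterI uF NF) => y [uy NFy] i; apply: (eq_on_columns uy) => j.
  rewrite -mulmxA PiF // -scalemxAr mul0mx.
  by case: (eqVneq (t j) i) => [<-|_]; [rewrite NFy scaler0|rewrite scale0r].
have Pi1 : \forall y \near x0, \sum_i Pi i y = 1%:M.
  apply: filterS uF => y uy; apply: (eq_on_columns uy) => j.
  rewrite mulmx_suml mul1mx (bigD1 (t j)) //= big1 ?addr0 => [|i it].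
    by rewrite PiF // eqxx scale1r.
  by rewrite PiF // eq_sym (negbTE it) scale0r.
have APi i : \forall y \near x0, A y *m Pi i y - Pi i y *m A y = 0.
  apply: mx_zero_dense.
    by apply: holomorphic_mx_atB; apply: holomorphic_mx_atM => //; exact: hA.
  apply: filterS (filterI (filterI uF NF) (filterI NPi Pi1)) => y [[uy NFy] [NPiy Pi1y]] gy.
  (* At a good point the vectors [w l] lie in different generalized eigenspaces and add up to 0, so
     each of them vanishes. *)
  have key k (v : 'cV_n) : N k y *m v = 0 -> Pi i y *m v = (k == i)%:R *: v.
    move=> hv; apply/eqP; rewrite -subr_eq0; apply/eqP.
    pose w l : 'cV_n := Pi l y *m v - (k == l)%:R *: v.
    apply: (@gen_eigen_sum_eq0 _ _ (A y) r (lam^~ y) w n gy _ _ i) => [l|].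
      rewrite -/(N l y) mulmxBr mulmxA NPiy mul0mx sub0r -scalemxAr.
      by case: (eqVneq k l) => [<-|_]; [rewrite hv scaler0 oppr0|rewrite scale0r oppr0].
    rewrite sumrB -mulmx_suml Pi1y mul1mx -scaler_suml (bigD1 k) //= eqxx.
    by rewrite big1 ?addr0 ?scale1r ?subrr // => l lk; rewrite eq_sym (negbTE lk).
  apply/eqP; rewrite subr_eq0; apply/eqP; apply: (eq_on_columns uy) => j.
  rewrite -(mulmxA (A y)) -(mulmxA (Pi i y)) (PiF i y j uy) -scalemxAr (key (t j)) //.
  have cA : GRing.comm (N (t j) y) (A y).
    apply/commr_sym/commrX/commrB; first exact: commr_refl.
    by rewrite /GRing.comm -!mulmxE scalar_mxC.
  by rewrite mulmxA mulmxE cA -mulmxE -mulmxA NFy mulmx0.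
exists Pi; split=> //.
have APi' : \forall y \near x0, forall i, A y *m Pi i y - Pi i y *m A y = 0.
  exact: near_ord_forall.
apply: filterS (filterI (filterI uF NPi) (filterI Pi1 APi')) => y [[uy NPiy] [Pi1y APiy]].
split=> // [i k|i]; last by apply/eqP; rewrite -subr_eq0 -!mulmxE APiy.
apply: (eq_on_columns uy) => j; rewrite -mulmxA PiF // -scalemxAr PiF // scalerA.
have [<-|ik] := eqVneq i k; first by rewrite PiF //; case: (t j == i); rewrite ?mulr1 ?mulr0.
by rewrite mul0mx; case: (eqVneq (t j) k) => [->|_];
  rewrite ?mul0r ?scale0r // eq_sym (negbTE ik) mulr0 scale0r.
Qed.

End SpectralProjections.

(** * The nilpotent part of a matrix with spectral projections *)

Section NilpotentPart.
Variables (R : realType) (n r : nat).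
Local Notation C := (Cplx R).
Variables (A : 'M[C]_n) (c : 'I_r -> C) (Pi : 'I_r -> 'M[C]_n).
Hypotheses (Pi1 : \sum_i Pi i = 1%:M)
  (PiPi : forall i k, Pi i *m Pi k = if i == k then Pi k else 0)
  (APi : forall i, GRing.comm A (Pi i)).

Definition nilpotent_part := A - \sum_i c i *: Pi i.

Lemma nilpotent_part_comm i : GRing.comm nilpotent_part (Pi i).
Proof.
apply/commr_sym/commrB; first exact/commr_sym.
apply: commr_sum => k _; rewrite /GRing.comm -!mulmxE -scalemxAr -scalemxAl !PiPi.
by rewrite eq_sym; case: eqVneq => [->|].
Qed.

(** On the range of [Pi i] the nilpotent part acts as [A - (c i)%:M]; this translates its chains
    into Jordan chains of [A]. *)
Lemma nilpotent_part_pow i l :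
  (A - (c i)%:M) ^+ l *m Pi i = nilpotent_part ^+ l *m Pi i.
Proof.
have h1 : (A - (c i)%:M) *m Pi i = nilpotent_part *m Pi i.
  rewrite !mulmxBl mul_scalar_mx mulmx_suml; congr (_ - _).
  rewrite (bigD1 i) //= -scalemxAl PiPi eqxx big1 ?addr0 // => k ki.
  by rewrite -scalemxAl PiPi (negbTE ki) scaler0.
elim: l => [|l IH]; first by rewrite !expr0.
have cm : nilpotent_part *m Pi i = Pi i *m nilpotent_part := nilpotent_part_comm i.
rewrite exprSr -mulmxE -mulmxA h1 [in RHS]exprSr -[in RHS]mulmxE -[in RHS]mulmxA.
by rewrite cm !mulmxA IH.
Qed.

End NilpotentPart.

(** * Jordan basis from chains of germs *)

Section Construction.
Variables (R : realType) (X : complexManifold R) (n : nat).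
Local Notation C := (Cplx R).
Variables (A : X -> 'M[C]_n) (U : set X) (J : X -> 'M[C]_n) (x0 : X).
Hypothesis hA : holomorphic_mx setT A.
Hypothesis hJ : holomorphic_jordan_form A x0 U J.
Variables (r : nat) (lam : 'I_r -> X -> C).
Hypothesis hlam : holomorphic_eigenvalues A U lam.
Variable Pi : 'I_r -> X -> 'M[C]_n.
Hypothesis hPi : forall i, holomorphic_mx_at (Pi i) x0.
Hypothesis PiE : \forall y \near x0, [/\ \sum_i Pi i y = 1%:M,
  forall i k, Pi i y *m Pi k y = if i == k then Pi k y else 0,
  forall i, GRing.comm (A y) (Pi i y)
  & forall i, shifted_power A (lam i) y *m Pi i y = 0].
Implicit Types (x y z : X).

Let Ux0 : U x0. Proof. by case: hJ => -[]. Qed.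

Let hl i : holomorphic_at (lam i) x0.
Proof. by have [h _ _] := hlam; exact: h. Qed.

Let V y := nilpotent_part (A y) (lam^~ y) (Pi^~ y).
Let E y := J y - diag_mx (\row_i J y i i).

(* The entries of [E] are 0 or 1 and vary continuously. *)
Let E_const : \forall y \near x0, E y = E x0.
Proof.
have [_ _ hJh fJ] := hJ.
have Ent y i j : E y i j = if i == j then 0 else J y i j.
  by rewrite !mxE; case: eqVneq => [->|]; rewrite ?mulr1n ?subrr // mulr0n subr0.
suff : \forall y \near x0, forall i j, E y i j = E x0 i j.
  by apply: filterS => y h; apply/matrixP => i j; rewrite h.
apply: near_ord_forall => i; apply: near_ord_forall => j.
have hE : holomorphic_at (fun y => E y i j) x0.
  under [fun y => _]eq_fun do rewrite Ent.
  by case: (i == j); [exact: holomorphic_at_cst|exact: hJh].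
have /cvg_nrP/(_ 1 ltr01) := holomorphic_at_cvg hE.
move=> h; apply: filterS (filterI h (near_domain hJ Ux0)) => y [+ Uy].
have E01 z : U z -> E z i j = 0 \/ E z i j = 1.
  by move=> Uz; have [cJ _] := fJ z Uz; have [_ _] := jordan_canonical_split cJ; exact.
by case: (E01 y Uy) (E01 x0 Ux0) => -> [] ->; rewrite ?subr0 ?sub0r ?nrN ?nr1 ?ltxx.
Qed.

Let conj_pow (P D : 'M[C]_n) l : P \in unitmx ->
  (P *m D *m invmx P) ^+ l = P *m D ^+ l *m invmx P.
Proof.
move=> uP; elim: l => [|l IH]; first by rewrite !expr0 mulmx1 mulmxV.
by rewrite exprS -mulmxE IH !mulmxA (mulmxKV uP) exprS -mulmxE !mulmxA.
Qed.

Let V_conj : \forall y \near x0, exists2 P : 'M[C]_n, P \in unitmx &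
  V y = P *m E x0 *m invmx P.
Proof.
apply: filterS (filterI PiE (filterI E_const (near_domain hJ Ux0))).
move=> y [[Pi1 PiPi APi NPi] [Ey Uy]].
have [_ _ _ fJ] := hJ; have [cJ [P uP JP]] := fJ y Uy.
exists P => //; rewrite -Ey /V /nilpotent_part.
exact: (jordan_chevalley_rank uP JP cJ Pi1 APi NPi).
Qed.

Let V_rank l : \forall y \near x0, \rank (V y ^+ l) = \rank (V x0 ^+ l).
Proof.
have rk y : (exists2 P : 'M[C]_n, P \in unitmx & V y = P *m E x0 *m invmx P) ->
    \rank (V y ^+ l) = \rank (E x0 ^+ l).
  move=> [P uP ->]; rewrite conj_pow // mxrankMfree ?row_free_unit ?unitmx_inv //.
  by rewrite -mxrank_tr trmx_mul mxrankMfree ?mxrank_tr // row_free_unit unitmx_tr.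
apply: filterS V_conj => y /rk Vy.
exact: etrans Vy (esym (rk x0 (nbhs_singleton V_conj))).
Qed.

Let V_nilpotent : V x0 ^+ n = 0.
Proof.
have [P uP ->] := nbhs_singleton V_conj; rewrite conj_pow //.
have [_ _ _ fJ] := hJ; have [cJ _] := fJ x0 Ux0.
by have [_ -> _] := jordan_canonical_split cJ; rewrite mulmx0 mul0mx.
Qed.

Let hV : holomorphic_mx_at V x0.
Proof.
apply: holomorphic_mx_atB; first exact: hA.
by apply: holomorphic_mx_at_sum => i; exact: holomorphic_mx_atZ.
Qed.

Let hshift i k : holomorphic_mx_at (fun y => (A y - (lam i y)%:M) ^+ k) x0.
Proof.
apply: holomorphic_mx_atX; apply: holomorphic_mx_atB; first exact: hA.
exact: holomorphic_mx_at_scalar.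
Qed.

(** The germ [u] given by constant rank may leave the range of [Pi i] away from [x0]. Applying
    [Pi i] brings it back, keeps the value [v] at [x0], and preserves the equation because [Pi i]
    commutes with [V]. *)
Let chain_germ i l v : Pi i x0 *m v = v -> V x0 ^+ l *m v = 0 ->
  exists w : X -> 'cV[C]_n, [/\ holomorphic_mx_at w x0, w x0 = v &
    \forall y \near x0, (A y - (lam i y)%:M) ^+ l *m w y = 0].
Proof.
move=> Piv Vv.
have [u [hu ux0 Vu]] := constant_rank_kernel (holomorphic_mx_atX l hV) (V_rank l) Vv.
exists (fun y => Pi i y *m u y); split.
- exact: holomorphic_mx_atM (hPi i) hu.
- by rewrite ux0.
apply: filterS (filterI PiE Vu) => y [[Pi1 PiPi APi _] Vuy].
have powE := nilpotent_part_pow (lam^~ y) PiPi APi i l.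
rewrite mulmxA powE.
have cV : V y ^+ l *m Pi i y = Pi i y *m V y ^+ l.
  rewrite !mulmxE; apply/commr_sym/commrX/commr_sym.
  exact: nilpotent_part_comm PiPi APi i.
by rewrite -/(V y) cV -mulmxA Vuy mulmx0.
Qed.

Let W i : {vspace 'cV[C]_n} := lker (linfun (mulmx (Pi i x0 - 1%:M))).

Let mem_W i v : v \in W i <-> Pi i x0 *m v = v.
Proof.
rewrite mem_lker_mulmx mulmxBl mul1mx subr_eq0.
by split=> [/eqP|->].
Qed.

Let sum_dim_W : (\sum_i \dim (W i) <= n)%N.
Proof.
have [_ PiPi _ _] := nbhs_singleton PiE.
have : directv (\sum_i W i).
  apply/directv_sum_independent => us usW us0 k _.
  have /(congr1 (mulmx (Pi k x0))) := us0; rewrite mulmx0 mulmx_sumr (bigD1 k) //=.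
  rewrite big1 ?addr0 => [|i ik]; first by move/mem_W: (usW k isT) => ->.
  by move/mem_W: (usW i isT) => <-; rewrite mulmxA PiPi eq_sym (negbTE ik) mul0mx.
by rewrite directvE /= => /eqP <-; rewrite -[leqRHS](@dim_col C n) dimvS ?subvf.
Qed.

(* Columns of the Jordan basis are grouped in chains [(A - lam i)^j w], where
   the generator [w] is a germ extending the generator of a chain at [x0]. *)
Lemma projections_jordanizable : locally_holomorphically_jordanizable A x0.
Proof.
have [Pi1 PiPi APi _] := nbhs_singleton PiE.
have VW i w : w \in W i -> V x0 *m w \in W i.
  move=> /mem_W hw; apply/mem_W; rewrite -[in RHS]hw !mulmxA; congr (_ *m _).
  by have := nilpotent_part_comm (lam^~ x0) PiPi APi i.
have [sq hsq] := choice (fun i => nilpotent_chains V_nilpotent (VW i)).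
pose blks := [seq (i, p) | i <- enum 'I_r, p <- sq i].
pose blk t := tnth (in_tuple blks) t.
have blkP t : (blk t).2 \in sq (blk t).1.
  by rewrite /blk; have /allpairsPdep[i [p [_ ps ->]]] := mem_tnth t (in_tuple blks).
pose l t := (blk t).2.2.
have [w hw] : exists w : 'I_(size blks) -> X -> 'cV[C]_n, forall t,
    [/\ holomorphic_mx_at (w t) x0, w t x0 = (blk t).2.1 &
      \forall y \near x0, (A y - (lam (blk t).1 y)%:M) ^+ l t *m w t y = 0].
  have h t := let: And3 h1 _ _ := hsq (blk t).1 in h1 _ (blkP t).
  have : forall t, exists w : X -> 'cV[C]_n, [/\ holomorphic_mx_at w x0,
      w x0 = (blk t).2.1 &
      \forall y \near x0, (A y - (lam (blk t).1 y)%:M) ^+ l t *m w y = 0].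
    by move=> t; have [/mem_W h1 _ h3] := h t; exact: chain_germ.
  by move=> /choice[w hw]; exists w.
pose B t y : 'M[C]_(n, l t) :=
  \matrix_(i, j) ((A y - (lam (blk t).1 y)%:M) ^+ ((l t).-1 - j) *m w t y) i 0.
have hB t : holomorphic_mx_at (B t) x0.
  move=> i j; under [fun y => _]eq_fun do rewrite mxE.
  have [hwt _ _] := hw t.
  exact: (holomorphic_mx_atM (hshift (blk t).1 ((l t).-1 - j)) hwt) i 0.
have AB : \forall y \near x0, forall t,
    A y *m B t y = B t y *m jordan_block (l t) (lam (blk t).1 y).
  apply: near_ord_forall => t; have [_ _ hk] := hw t.
  by apply: filterS hk => y; exact: chain_jordan_block.
pose S0 y := \mxrow_t B t y.
have colS0 t j y : col (tagnat.Rank t j) (S0 y) = col j (B t y).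
  apply/colP => k; rewrite !mxE.
  by have /matrixP/(_ k j) := mxrowK (fun t => B t y) t; rewrite !mxE.
have surj0 (v : 'cV_n) : exists u, v = S0 x0 *m u.
  pose f : 'Hom('cV[C]_(\sum_t l t), 'cV[C]_n) := linfun (mulmx (S0 x0)).
  suff : v \in limg f by case/memv_imgP => u _ ->; exists u; rewrite lfunE.
  have WL i : (W i <= limg f)%VS.
    have [h1 _ h3] := hsq i; apply: subv_trans h3 _.
    apply/span_subvP => _ /flatten_mapP[p ps] /mapP[j + ->].
    rewrite mem_iota add0n => /= jp.
    have pb : (i, p) \in blks by apply/allpairsPdep; exists i, p; rewrite mem_enum.
    have /tnthP[t tE] : (i, p) \in in_tuple blks by [].
    have bt : blk t = (i, p) by rewrite /blk -tE.
    have jl : ((l t).-1 - j < l t)%N by rewrite /l bt /=; lia.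
    have [/mem_W pW _ _] := h1 _ ps.
    have -> : V x0 ^+ j *m p.1 = col (tagnat.Rank t (Ordinal jl)) (S0 x0).
      rewrite colS0; apply/colP => k; rewrite [RHS]mxE [RHS]mxE /=.
      have [_ -> _] := hw t; have -> : ((l t).-1 - ((l t).-1 - j))%N = j.
        by rewrite /l bt /=; lia.
      by rewrite bt /= -{2}pW mulmxA (nilpotent_part_pow (lam^~ x0) PiPi APi i j) -mulmxA pW.
    by apply/memv_imgP; exists (delta_mx (tagnat.Rank t (Ordinal jl)) 0);
      rewrite ?memvf // lfunE /= -colE.
  rewrite -[v]mul1mx -Pi1 mulmx_suml; apply: memv_suml => i _.
  by apply: (subvP (WL i)); apply/mem_W; rewrite mulmxA PiPi eqxx.
(* The lengths add up to at most the sum of the dimensions of the [W i], hence to at most [n]; at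
   least [n] columns are required because [S0 x0] is onto. *)
have e : (\sum_t l t)%N = n.
  apply/eqP; rewrite eqn_leq; apply/andP; split.
    apply: leq_trans sum_dim_W.
    have -> : (\sum_t l t = \sum_(b <- blks) b.2.2)%N.
      by rewrite [RHS](big_tnth _ _ blks).
    rewrite big_allpairs_dep /= big_enum /=; apply: leq_sum => i _.
    by have [_ + _] := hsq i; rewrite sumnE big_map.
  have [D hD] := choice (fun j => surj0 (col j 1%:M)).
  have : S0 x0 *m \matrix_(i, j) D j i 0 = 1%:M.
    apply/matrixP => i j; have /colP/(_ i) := hD j; rewrite [LHS]mxE => ->.
    by rewrite !mxE; apply: eq_bigr => k _; rewrite !mxE.
  move=> h; rewrite -[leqLHS](mxrank1 C n) -h.
  by apply: leq_trans (mxrankM_maxl _ _) _; exact: rank_leq_col.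
pose S y : 'M[C]_n := castmx (erefl, e) (S0 y).
pose Jf y : 'M[C]_n := castmx (e, e) (\mxdiag_t jordan_block (l t) (lam (blk t).1 y)).
have hS : holomorphic_mx_at S x0.
  move=> i j; under [fun y => _]eq_fun do rewrite castmxE mxE.
  exact: hB.
have uS : S x0 \in unitmx.
  apply: surjective_unit => v; have [u ->] := surj0 v.
  by exists (castmx (e, erefl) u); rewrite mulmx_castmx.
have AS : \forall y \near x0, A y *m S y = S y *m Jf y.
  apply: filterS AB => y ABy.
  rewrite mul_mx_castmx mulmx_castmx2 mul_mxrow mul_mxrow_mxdiag.
  by congr castmx; apply: eq_mxrow => t.
pose Q y := [/\ holomorphic_mx_at S y, S y \in unitmx & A y *m S y = S y *m Jf y].
have hQ : \forall y \near x0, Q y.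
  by apply: filterS3 (holomorphic_mx_at_near hS) (near_unitmx hS uS) AS => y.
(* The interior of the set where [Q] holds, which is open and contains [x0]. *)
exists [set y | \forall z \near y, Q z], S; split.
- by split; [exact: open_interior|].
- by move=> y /nbhs_singleton[].
- by move=> y /nbhs_singleton[].
- move=> y /nbhs_singleton[_ uy ASy]; rewrite -mulmxA ASy mulKmx //.
  exists (size blks), l, (fun t => lam (blk t).1 y), e; split=> // t.
  by have [h1 _ _] := hsq (blk t).1; have [_ + _] := h1 _ (blkP t).
Qed.

End Construction.

Theorem theorem3p21 (R : realType) (X : complexManifold R) (n : nat)
    (A : X -> 'M[Cplx R]_n) (hA : holomorphic_mx setT A) (x0 : X) :
  [/\ locally_holomorphically_jordanizable A x0 <->
      (exists (U : set X) (J : X -> 'M[Cplx R]_n) (r : nat)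
              (lam : 'I_r -> X -> Cplx R),
         [/\ holomorphic_jordan_form A x0 U J,
             holomorphic_eigenvalues A U lam,
             limits_exist A x0 lam
           & limits_direct_sum A x0 lam]),
      (forall (U : set X) (J : X -> 'M[Cplx R]_n),
         holomorphic_jordan_form A x0 U J ->
         exists (r : nat) (lam : 'I_r -> X -> Cplx R),
           holomorphic_eigenvalues A U lam)
    & (forall (U : set X) (J : X -> 'M[Cplx R]_n) (r : nat)
              (lam : 'I_r -> X -> Cplx R),
         holomorphic_jordan_form A x0 U J ->
         holomorphic_eigenvalues A U lam ->
         (limits_exist A x0 lam <-> calK_dim_continuous A x0 lam) /\
         (limits_direct_sum A x0 lam <-> calK_direct_sum A x0 lam))].
Proof.
split.
- split; first exact: jordanizable_limits.
  move=> [U [J [r [lam [hJ hlam _ /(limits_direct_sum_calK hA hJ hlam) dir]]]]].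
  have [Pi [hPi PiE]] := spectral_projections hA hJ hlam dir.
  exact: (projections_jordanizable hA hJ hlam hPi PiE).
- by move=> U J; exact: jordan_branches.
- move=> U J r lam hJ hlam; split.
    exact: (limits_exist_calK hA hJ hlam).
  exact: (limits_direct_sum_calK hA hJ hlam).
Qed.
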